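(* Let $\mu$ be a probability measure on $\partial\mathbb{D}$ with $\mu_{\mathrm s}=0$ satisfying the Szeg\H{o} condition, and let $R>1$. If $D^{-1}$ has an analytic continuation to $\{z:|z|<R\}$, then $F$ is meromorphic there with singularities precisely at the zeros of $D^{-1}$, and the order of any pole of $F$ is precisely the order of the corresponding zero of $D^{-1}$. Moreover $(\delta_0D)(z)$ is meromorphic in $\{z:|z|<R\}$ with poles precisely at the poles of $F$, of order no greater than those of $F$. Finally $(D^{(1)})^{-1}$ is analytic in $\{z:|z|<R\}$, and hence (by induction) so is each $(D^{(n)})^{-1}$, $n\ge1$.
   Context: $\mathbb{D}=\{|z|<1\}$. Write $d\mu=w(\theta)\frac{d\theta}{2\pi}+d\mu_{\mathrm s}$; the Szeg\H{o} condition is $\int\log w\,\frac{d\theta}{2\pi}>-\infty$, and then the Szeg\H{o} function is $D(z)=\exp\bigl(\int\frac{e^{i\theta}+z}{e^{i\theta}-z}\log w(\theta)\frac{d\theta}{4\pi}\bigr)$, $z\in\mathbb{D}$. Let $\alpha_0,\alpha_1,\dots$ be the Verblunsky coefficients of $\mu$ (recursion coefficients $\Phi_{k+1}(z)=z\Phi_k(z)-\bar\alpha_k\Phi_k^*(z)$, $\Phi_k^*(z)=z^k\overline{\Phi_k(1/\bar z)}$ of the monic orthogonal polynomials), $\rho_n=(1-|\alpha_n|^2)^{1/2}$. $\mu^{(n)}$ is the probability measure with Verblunsky coefficients $\{\alpha_{n+k}\}_{k\ge0}$ ($\mu^{(0)}=\mu$), $D^{(n)}$ its Szeg\H{o} function,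 $F^{(n)}(z)=\int\frac{e^{i\theta}+z}{e^{i\theta}-z}d\mu^{(n)}(\theta)$, and $f^{(n)}$ is defined by $F^{(n)}=\frac{1+zf^{(n)}}{1-zf^{(n)}}$. $F=F^{(0)}$, $D=D^{(0)}$, $f=f^{(0)}$. The relative Szeg\H{o} function is $(\delta_0D)(z)=\frac{1-\bar\alpha_0f(z)}{\rho_0}\cdot\frac{1-zf^{(1)}(z)}{1-zf(z)}$, which equals $D(z)/D^{(1)}(z)$ on $\mathbb D$. *)

(* Defs.v *)
(* Complex numbers are R[i]
   (mathcomp-real-closed `complex`) over an arbitrary R : realType;
   R[i]^o is a normed module over R[i], so `derivable f z 1` is complex
   differentiability.  The unit circle is parametrized by the angle
   theta in circ = [0, 2 pi). *)
From HB Require Import structures.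
From mathcomp Require Import all_boot all_order all_algebra.
From mathcomp Require Import complex.
From mathcomp Require Import all_classical all_reals all_analysis.
Import Order.TTheory GRing.Theory Num.Theory.
Import numFieldNormedType.Exports.

Set Implicit Arguments.
Unset Strict Implicit.
Unset Printing Implicit Defensive.

Local Open Scope classical_set_scope.
Local Open Scope ring_scope.

Section Defs.
Context {R : realType}.
Local Notation C := R[i].

(** the circle, parametrized by theta in [0, 2 pi) *)
Definition circ : set R := `[0, pi *+ 2[.

(** e^{i t} *)
Definition eit (t : R) : C := (cos t +i* sin t)%C.

(** complex exponential *)
Definition cexp (z : C) : C :=
  (expR (complex.Re z))%:C%C * (cos (complex.Im z) +i* sin (complex.Im z))%C.

(** integral over the circle of a complex valued function w.r.t. mu *)
Definition cint (mu : {measure set (measurableTypeR R) -> \bar R}) (f : R -> C) : C :=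
  (Rintegral mu circ (fun t => complex.Re (f t)))%:C%C
  + 'i%C * (Rintegral mu circ (fun t => complex.Im (f t)))%:C%C.

(** mu is a probability measure on the circle *)
Definition circle_prob (mu : {measure set (measurableTypeR R) -> \bar R}) : Prop :=
  mu setT = 1%E /\ mu (~` circ) = 0%E.

(** Lebesgue decomposition  d mu = w dtheta/(2 pi) + d mus  on the circle,
    with mus singular (w.r.t. Lebesgue measure) *)
Definition lebesgue_decomp (mu : {measure set (measurableTypeR R) -> \bar R}) (w : R -> R)
    (mus : {measure set (measurableTypeR R) -> \bar R}) : Prop :=
  (forall t, 0 <= w t) /\ measurable_fun (circ : set (measurableTypeR R)) w /\
  (exists N : set (measurableTypeR R), measurable N /\ N `<=` circ /\
      lebesgue_measure N = 0%E /\ mus (~` N) = 0%E) /\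
  (forall A : set (measurableTypeR R), measurable A ->
     mu A = (\int[lebesgue_measure]_(t in A `&` circ) (w t / (pi *+ 2))%:E
             + mus A)%E).

(** extended logarithm: log 0 = -oo *)
Definition logE (x : R) : \bar R := if 0 < x then (ln x)%:E else -oo%E.

(** Szego condition  int log w dtheta/(2 pi) > -oo *)
Definition szego_cond (w : R -> R) : Prop :=
  (-oo < \int[lebesgue_measure]_(t in circ) (logE (w t) * ((pi *+ 2)^-1)%:E))%E.

(** Szego function D(z) = exp( int (e^{it}+z)/(e^{it}-z) log w(t) dt/(4 pi) ) *)
Definition szego (w : R -> R) (z : C) : C :=
  cexp (cint lebesgue_measure
          (fun t => (eit t + z) / (eit t - z) * (ln (w t))%:C%C / (pi *+ 4)%:C%C)).

(** Caratheodory function F(z) = int (e^{it}+z)/(e^{it}-z) dmu(t) *)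
Definition carath (mu : {measure set (measurableTypeR R) -> \bar R}) (z : C) : C :=
  cint mu (fun t => (eit t + z) / (eit t - z)).

(** Schur function f, defined by F = (1 + z f)/(1 - z f); at z = 0 by
    continuity (f(0) = F'(0)/2). *)
Definition schur (mu : {measure set (measurableTypeR R) -> \bar R}) (z : C) : C :=
  if z == 0 then 'D_1 (carath mu : C^o -> C^o) 0 / 2
  else (carath mu z - 1) / (z * (carath mu z + 1)).

(** reversed polynomial  p^*(z) = z^n conj(p(1/conj z))  for degree n *)
Definition pstar (n : nat) (p : {poly C}) : {poly C} :=
  \poly_(i < n.+1) (p`_(n - i))^*.

(** monic OPUC generated by the Szego recursion from coefficients a *)
Fixpoint opuc (a : nat -> C) (n : nat) : {poly C} :=
  if n is k.+1 then 'X * opuc a k - ((a k)^*)%:P * pstar k (opuc a k)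
  else 1.

(** a is the sequence of Verblunsky coefficients of mu: the polynomials
    generated by the recursion with coefficients a are the monic
    orthogonal polynomials of mu. *)
Definition verblunsky (mu : {measure set (measurableTypeR R) -> \bar R}) (a : nat -> C) : Prop :=
  forall n j : nat, (j < n)%N ->
    cint mu (fun t => (eit t ^+ j)^* * (opuc a n).[eit t]) = 0.

Definition rho (a : C) : C := sqrtC (1 - `|a| ^+ 2).

(** relative Szego function (delta_0 D)(z), mu1 = mu^(1), a0 = alpha_0 *)
Definition rel_szego (mu mu1 : {measure set (measurableTypeR R) -> \bar R}) (a0 : C) (z : C) : C :=
  (1 - a0^* * schur mu z) / rho a0 * ((1 - z * schur mu1 z) / (1 - z * schur mu z)).

(** complex analysis *)
Definition cball (c : C) (r : R) : set C := [set z | `|z - c| < r%:C%C].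

Definition holo (U : set C) (f : C -> C) : Prop :=
  forall z, U z -> derivable (f : C^o -> C^o) z 1.

(** g has a zero of order k at a (k = 0: g a <> 0) *)
Definition zero_order (g : C -> C) (a : C) (k : nat) : Prop :=
  exists e : R, 0 < e /\ exists h : C -> C,
    holo (cball a e) h /\ h a != 0 /\
    forall z, cball a e z -> g z = (z - a) ^+ k * h z.

(** G has a pole of order k >= 1 at a *)
Definition pole_order (G : C -> C) (a : C) (k : nat) : Prop :=
  (0 < k)%N /\ exists e : R, 0 < e /\ exists h : C -> C,
    holo (cball a e) h /\ h a != 0 /\
    forall z, cball a e z -> z != a -> G z = h z / (z - a) ^+ k.

(** h (given on the unit disc) has an analytic continuation to |z| < r *)
Definition analytic_cont (h : C -> C) (r : R) : Prop :=
  exists g : C -> C, holo (cball 0 r) g /\ forall z, cball 0 1 z -> g z = h z.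

End Defs.

(* Main.v *)
(* On the unit circle, [g = D^{-1}] has no zero: [|D(r e^(it))|^2 <= 2/(1 - r)]
   by Jensen's inequality, whereas [|g(r e^(it))| = O(1 - r)] at a zero.  Since
   [ln |g|^2] is then continuous on the circle, comparing Poisson integrals gives
   [w = 1/|g|^2] almost everywhere.  Hence [F] is the Herglotz integral of
   [1/(g g^#)] with [g^#(z) = conj(g(1/conj z))], and moving the contour to
   [|zeta| = r0 > 1] picks up the residue [2/(g g^#)]; so [Q = g F] continues
   analytically to [|z| < Rad], with [Q = 2/g^# <> 0] at the zeros of [g].

   The functions [a_0 = F + 1], [z b_0 = F - 1],
     [a_(n+1) = a_n - conj(alpha_n) b_n], [z b_(n+1) = b_n - alpha_n a_n]
   are Cauchy integrals of the orthogonal polynomials, and [b_n / a_n] is the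
   n-th Schur function, so [F^(n) = (a_n + z b_n) / (a_n - z b_n)].  Multiplied by
   [g] they continue to [|z| < Rad], and [|g a_n|^2 - |g b_n|^2] is a positive
   constant [kappa] on the circle.  Therefore [V = g (a_n - z b_n)] has no zero in
   the closed disc, [w_n = Re F^(n) = kappa / |V|^2] almost everywhere, and
   [V D^(n)] has constant modulus on the circle, so it is constant.  For [n = 1],
   [delta_0 D = V / (2 rho_0 g)], and at a zero [p] of [g],
   [V(p) = Q(p) ((1 + alpha_0) p - conj(1 + alpha_0)) / p <> 0] as [|p| > 1]. *)

(* Every passage to the boundary rests on one uniqueness principle: two finite measures whose
   Poisson integrals become uniformly close as r tends to 1 agree on the measurable subsets of the
   open arc of angles in (0, 2 pi). One of the two always comes from an explicit Lipschitz function
   of the boundary point, so no radial limits of general functions occur. For [ln w], which changes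
   sign, both sides are first shifted to nonnegative densities; for mu^(n), a null set carrying its
   singular part is removed. The logarithm of |g|^2 is Lipschitz on the circle only if |g| is
   bounded below there, which is why zeros on the circle are excluded first, by a growth estimate
   made inside the disc. F itself has poles in |z| < Rad, but g F has none, and the recursion for
   (a_n, b_n) divides by nothing except z. Run on g F + g and g F - g it therefore stays analytic in
   the whole disc, for every n at once. The Szego condition is assumed for mu only; for mu^(n) the
   integrability of the logarithm of the weight is a consequence of the formula for that weight. *)
Require Import Defs.
From HB Require Import structures.
From mathcomp Require Import all_boot all_order all_algebra.
From mathcomp Require Import complex ring lra.
From mathcomp Require Import all_classical all_reals all_analysis measurable_realfun.
Import Order.TTheory GRing.Theory Num.Theory.
Import numFieldNormedType.Exports.
Import Normc.
Local Open Scope classical_set_scope.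
Local Open Scope ring_scope.
Set Implicit Arguments.
Unset Strict Implicit.
Unset Printing Implicit Defensive.

(** * Modulus, real and imaginary parts, complex derivatives *)

Section ComplexBasics.
Context {R : realType}.
Local Notation C := R[i].
Implicit Types (x y z : C) (f h : C -> C).

Lemma normc_ge0 z : 0 <= normc z.
Proof. by case: z => a b /=; exact: sqrtr_ge0. Qed.

Lemma normcE z : `|z| = (normc z)%:C%C. Proof. by []. Qed.

Lemma normc_eq0 z : (normc z == 0) = (z == 0).
Proof.
apply/eqP/eqP => [/eq0_normc //|->]; exact: normc0.
Qed.

Lemma normc_gt0 z : (0 < normc z) = (z != 0).
Proof. by rewrite lt_def normc_eq0 normc_ge0 andbT. Qed.

Lemma ler_normcD x y : normc (x + y) <= normc x + normc y.
Proof. exact: le_normcD. Qed.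

Lemma ler_normcB x y : normc (x - y) <= normc x + normc y.
Proof. by rewrite (le_trans (ler_normcD _ _))// normcN. Qed.

Lemma normcB x y : normc (x - y) = normc (y - x).
Proof. by rewrite -opprB normcN. Qed.

Lemma lerB_normc x y : normc x - normc y <= normc (x - y).
Proof. by rewrite lerBlDr (le_trans _ (ler_normcD _ _))// subrK. Qed.

Lemma normcX z n : normc (z ^+ n) = normc z ^+ n.
Proof. by elim: n => [|n IH]; rewrite ?expr0 ?normc1// !exprS normcM IH. Qed.

Lemma normcR (r : R) : normc r%:C%C = `|r|.
Proof. by rewrite /= expr0n addr0 sqrtr_sqr. Qed.

Lemma sqr_normcE z : normc z ^+ 2 = complex.Re z ^+ 2 + complex.Im z ^+ 2.
Proof. by case: z => a b /=; rewrite sqr_sqrtr// addr_ge0// sqr_ge0. Qed.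

Lemma normc_Re z : `|complex.Re z| <= normc z.
Proof.
case: z => a b /=; rewrite -sqrtr_sqr ler_sqrt ?addr_ge0 ?sqr_ge0//.
by rewrite lerDl sqr_ge0.
Qed.

Lemma normc_Im z : `|complex.Im z| <= normc z.
Proof.
case: z => a b /=; rewrite -sqrtr_sqr ler_sqrt ?addr_ge0 ?sqr_ge0//.
by rewrite lerDr sqr_ge0.
Qed.

Lemma normc_ReIm z : normc z <= `|complex.Re z| + `|complex.Im z|.
Proof.
rewrite -(@ler_pXn2r _ 2%N) ?nnegrE ?normc_ge0 ?addr_ge0//.
rewrite sqr_normcE -(real_normK (num_real (complex.Re z))).
rewrite -(real_normK (num_real (complex.Im z))).
have := normr_ge0 (complex.Re z); have := normr_ge0 (complex.Im z).
nra.
Qed.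

Lemma normc_conj z : normc (conjc z) = normc z.
Proof. by case: z => a b /=; rewrite sqrrN. Qed.

Lemma mulc_conj z : z * conjc z = (normc z ^+ 2)%:C%C.
Proof.
rewrite sqr_normcE; case: z => a b; simpc.
by congr Complex; ring.
Qed.

Lemma conjc_unit z : normc z = 1 -> conjc z = z^-1.
Proof.
move=> z1; have z0 : z != 0 by rewrite -normc_eq0 z1 oner_eq0.
by apply: (mulfI z0); rewrite mulc_conj z1 expr1n divff.
Qed.

Lemma ReD x y : complex.Re (x + y) = complex.Re x + complex.Re y.
Proof. by case: x y => [? ?] [? ?]. Qed.
Lemma ImD x y : complex.Im (x + y) = complex.Im x + complex.Im y.
Proof. by case: x y => [? ?] [? ?]. Qed.
Lemma ReN x : complex.Re (- x) = - complex.Re x.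
Proof. by case: x. Qed.
Lemma ImN x : complex.Im (- x) = - complex.Im x.
Proof. by case: x. Qed.
Lemma ReB x y : complex.Re (x - y) = complex.Re x - complex.Re y.
Proof. by rewrite ReD ReN. Qed.
Lemma ImB x y : complex.Im (x - y) = complex.Im x - complex.Im y.
Proof. by rewrite ImD ImN. Qed.
Lemma ReM x y : complex.Re (x * y) =
  complex.Re x * complex.Re y - complex.Im x * complex.Im y.
Proof. by case: x y => [? ?] [? ?]. Qed.
Lemma ImM x y : complex.Im (x * y) =
  complex.Re x * complex.Im y + complex.Im x * complex.Re y.
Proof. by case: x y => [? ?] [? ?]. Qed.
Lemma RconjE x : complex.Re (conjc x) = complex.Re x.
Proof. by case: x. Qed.
Lemma IconjE x : complex.Im (conjc x) = - complex.Im x.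
Proof. by case: x. Qed.
Lemma complex_eq x y :
  complex.Re x = complex.Re y -> complex.Im x = complex.Im y -> x = y.
Proof. by case: x y => [? ?] [? ?] /= -> ->. Qed.

Lemma in_cball (c : C) r z : cball c r z = (normc (z - c) < r) :> Prop.
Proof. by rewrite /cball /= normcE ltcR. Qed.

Lemma in_cball0 r z : cball 0 r z = (normc z < r) :> Prop.
Proof. by rewrite in_cball subr0. Qed.

(** Differentiability as a first-order expansion, with a real-valued modulus and no quotient, so
    that w = z is allowed and estimates stay in the ordered field [R]. [cderP] identifies it with
    the derivative of the statement. *)
Definition cder f z d := forall e : R, 0 < e -> exists2 r : R, 0 < r &
  forall w, normc (w - z) < r -> normc (f w - f z - d * (w - z)) <= e * normc (w - z).

Definition ccont f z := forall e : R, 0 < e -> exists2 r : R, 0 < r &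
  forall w, normc (w - z) < r -> normc (f w - f z) < e.

Lemma cderP f z d : is_derive (z : C^o) 1 (f : C^o -> C^o) d <-> cder f z d.
Proof.
have key : ((fun k : C^o => k^-1 *: (((f : C^o -> C^o) \o shift (z : C^o)) (k *: (1 : C^o)) - f z))
     @ 0^' --> (d : C^o)) <-> cder f z d.
  split => [/cvgrPdist_le H e e0|H].
    have /(H _) : (0 : C) < e%:C%C by rewrite ltcR.
    move=> /nbhs_ballP[r /= r0 rP].
    have r0' : 0 < complex.Re r by move: r0; rewrite ltcE => /andP[].
    have rE : r = (complex.Re r)%:C%C.
      by move: r0; rewrite ltcE => /andP[/eqP]; case: (r) => a b /= ->.
    exists (complex.Re r) => // w wr.
    have [->|wz] := eqVneq w z.
      by rewrite !subrr mulr0 subr0 normc0 mulr0.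
    have w0 : w - z != 0 by rewrite subr_eq0.
    have /(rP _) : ball (0 : C^o) r (w - z).
      by rewrite -ball_normE /ball_ /= sub0r normrN rE normcE ltcR.
    move=> /(_ w0) /=; rewrite /GRing.scale /= mulr1 subrK.
    rewrite normcE lecR => dle.
    have -> : f w - f z - d * (w - z) = - (d - (w - z)^-1 * (f w - f z)) * (w - z).
      by field.
    by rewrite normcM normcN ler_wpM2r// normc_ge0.
  apply/cvgrPdist_le => e e0.
  have e0' : 0 < complex.Re e by move: e0; rewrite ltcE => /andP[].
  have eE : e = (complex.Re e)%:C%C.
    by move: e0; rewrite ltcE => /andP[/eqP]; case: (e) => a b /= ->.
  have [r r0 rP] := H _ e0'.
  apply/nbhs_ballP; exists r%:C%C => /=; first by rewrite ltcR.
  move=> h; rewrite -ball_normE /ball_ /= sub0r normrN normcE ltcR => hr h0.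
  rewrite /GRing.scale /= mulr1 eE normcE lecR.
  have := rP (h + z); rewrite addrK => /(_ hr) le.
  have -> : d - h^-1 * (f (h + z) - f z) = - (f (h + z) - f z - d * h) * h^-1.
    by field.
  by rewrite normcM normcN normcV ler_pdivrMr// normc_gt0.
split => [[dr dv]|/key dv].
  apply/key; rewrite -dv; exact: dr.
split; first by apply/cvg_ex; exists d.
exact: (cvg_lim (@norm_hausdorff _ _) dv).
Qed.

Lemma holoP (U : set C) f : holo U f <-> forall z, U z -> exists d, cder f z d.
Proof.
split => [H z /H dz|H z /H[d /cderP []//]].
by exists ('D_1 (f : C^o -> C^o) (z : C^o)); apply/cderP; split.
Qed.

Lemma cder_cont f z d : cder f z d -> ccont f z.
Proof.
move=> H e e0; have [r r0 rP] := H 1 ltr01.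
have M0 : 0 < 1 + normc d by rewrite ltr_pwDl// normc_ge0.
exists (Num.min r (e / (1 + normc d))).
  by rewrite lt_min r0 divr_gt0.
move=> w; rewrite lt_min => /andP[/rP w1 w2].
have -> : f w - f z = (f w - f z - d * (w - z)) + d * (w - z) by ring.
rewrite (le_lt_trans (ler_normcD _ _))// normcM.
rewrite (@le_lt_trans _ _ ((1 + normc d) * normc (w - z)))//.
  by rewrite mulrDl lerD2r.
by rewrite mulrC -ltr_pdivlMr.
Qed.

Lemma cder_cst c z : cder (fun=> c) z 0.
Proof. by apply/cderP; exact: is_derive_cst. Qed.

Lemma cder_id z : cder id z 1.
Proof. by apply/cderP; exact: is_derive_id. Qed.

Lemma cderD f h z df dh : cder f z df -> cder h z dh ->
  cder (fun w => f w + h w) z (df + dh).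
Proof. by move=> /cderP F /cderP H; apply/cderP; exact: is_deriveD. Qed.

Lemma cderN f z df : cder f z df -> cder (fun w => - f w) z (- df).
Proof. by move=> /cderP F; apply/cderP; exact: is_deriveN. Qed.

Lemma cderB f h z df dh : cder f z df -> cder h z dh ->
  cder (fun w => f w - h w) z (df - dh).
Proof. by move=> F H; apply: cderD => //; exact: cderN. Qed.

Lemma cderM f h z df dh : cder f z df -> cder h z dh ->
  cder (fun w => f w * h w) z (f z * dh + h z * df).
Proof.
move=> /cderP F /cderP H; apply/cderP; exact: is_deriveM.
Qed.

Lemma cderV f z df : f z != 0 -> cder f z df ->
  cder (fun w => (f w)^-1) z (- (f z) ^- 2 * df).
Proof.
move=> f0 /cderP F; apply/cderP.
have [dF vF] := F; split; first exact: (@derivableV _ C^o).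
by rewrite (@deriveV _ C^o)// vF.
Qed.

Lemma cder_comp f h z df dh : cder f z df -> cder h (f z) dh ->
  cder (fun w => h (f w)) z (dh * df).
Proof.
move=> F H e e0.
have M0 : 0 < 1 + normc df by rewrite ltr_pwDl// normc_ge0.
have M1 : 0 < 1 + normc dh by rewrite ltr_pwDl// normc_ge0.
have e1 : 0 < e / 2 / (1 + normc df) by rewrite !divr_gt0.
have e2 : 0 < e / 2 / (1 + normc dh) by rewrite !divr_gt0.
have [r r0 rP] := H _ e1.
have [r1 r10 rP1] := F _ ltr01.
have [r2 r20 rP2] := F _ e2.
have [r3 r30 rP3] := cder_cont F r0.
exists (Num.min (Num.min r1 r2) r3); first by rewrite !lt_min r10 r20 r30.
move=> w; rewrite !lt_min => /andP[/andP[/rP1 w1 /rP2 w2] /rP3 w3].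
have fw : normc (f w - f z) <= (1 + normc df) * normc (w - z).
  have -> : f w - f z = (f w - f z - df * (w - z)) + df * (w - z) by ring.
  rewrite (le_trans (ler_normcD _ _))// normcM mulrDl lerD2r//.
have -> : h (f w) - h (f z) - dh * df * (w - z) =
  (h (f w) - h (f z) - dh * (f w - f z)) + dh * (f w - f z - df * (w - z)) by ring.
rewrite (le_trans (ler_normcD _ _))// normcM.
have -> : e = e / 2 + e / 2 by field.
rewrite mulrDl lerD//.
  rewrite (le_trans (rP _ w3))// (le_trans (ler_wpM2l (ltW e1) fw))//.
  by rewrite mulrA divfK// gt_eqF.
have := ler_wpM2l (normc_ge0 dh) w2; move/le_trans; apply.
rewrite mulrA ler_wpM2r ?normc_ge0// mulrCA ger_pMr ?divr_gt0//.
by rewrite ler_pdivrMr// mul1r ler_wpDl.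
Qed.

Lemma cder_near f h z d (r : R) : 0 < r ->
  (forall w, normc (w - z) < r -> f w = h w) -> cder f z d -> cder h z d.
Proof.
move=> r0 fh F e e0; have [s s0 sP] := F _ e0.
exists (Num.min r s); first by rewrite lt_min r0.
move=> w; rewrite lt_min => /andP[wr ws].
by rewrite -!fh ?subrr ?normc0//; exact: sP.
Qed.

End ComplexBasics.

#[global] Arguments Normc.normc {_} _ : simpl never.

(** * Integrals of complex valued functions *)

Section ComplexIntegral.
Context {R : realType}.
Local Notation C := R[i].
Local Notation Re := (@complex.Re R).
Local Notation Im := (@complex.Im R).
Variables (m : {measure set (measurableTypeR R) -> \bar R})
  (D : set (measurableTypeR R)).
Hypothesis mD : measurable D.
Implicit Types (f h : R -> C) (k : R -> R).

Definition cintegrable f :=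
  m.-integrable D (EFin \o (Re \o f)) /\ m.-integrable D (EFin \o (Im \o f)).

Definition cintg f : C := (Rintegral m D (Re \o f) +i* Rintegral m D (Im \o f))%C.

Lemma eq_cintegrable f h : {in D, f =1 h} -> cintegrable f -> cintegrable h.
Proof.
move=> fh [f1 f2]; split.
- by apply: eq_integrable f1 => // x xD /=; rewrite fh.
- by apply: eq_integrable f2 => // x xD /=; rewrite fh.
Qed.

Lemma eq_cintg f h : {in D, f =1 h} -> cintg f = cintg h.
Proof.
by move=> fh; congr Complex; apply: eq_Rintegral => x xD /=; rewrite fh.
Qed.

Lemma integrable_scale (r : R) k : m.-integrable D (EFin \o k) ->
  m.-integrable D (EFin \o (fun t => r * k t)).
Proof.
by move=> ki; have := integrableZl mD r ki; apply: eq_integrable => // x _ /=.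
Qed.

Lemma cintegrableZ (c : C) f : cintegrable f -> cintegrable (fun t => c * f t).
Proof.
move=> [f1 f2]; split.
- have := integrableB mD (integrable_scale (Re c) f1) (integrable_scale (Im c) f2).
  by apply: eq_integrable => // x _ /=; rewrite ReM.
- have := integrableD mD (integrable_scale (Re c) f2) (integrable_scale (Im c) f1).
  by apply: eq_integrable => // x _ /=; rewrite ImM.
Qed.

Lemma cintegrableN f : cintegrable f -> cintegrable (fun t => - f t).
Proof.
move=> /(cintegrableZ (-1)); apply: eq_cintegrable => t _; by rewrite mulN1r.
Qed.

Lemma cintgD f h : cintegrable f -> cintegrable h ->
  cintg (fun t => f t + h t) = cintg f + cintg h.
Proof.
move=> [f1 f2] [h1 h2]; apply: complex_eq => /=.
- rewrite -(RintegralD mD f1 h1).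
  by apply: eq_Rintegral => t _ /=; rewrite ReD.
- rewrite -(RintegralD mD f2 h2).
  by apply: eq_Rintegral => t _ /=; rewrite ImD.
Qed.

Lemma cintgZ (c : C) f : cintegrable f -> cintg (fun t => c * f t) = c * cintg f.
Proof.
move=> [f1 f2]; apply: complex_eq; rewrite ?ReM ?ImM /=.
- rewrite -(RintegralZl (Re c) mD f1) -(RintegralZl (Im c) mD f2).
  rewrite -(RintegralB mD (integrable_scale _ f1) (integrable_scale _ f2)).
  by apply: eq_Rintegral => t _ /=; rewrite ReM.
- rewrite -(RintegralZl (Re c) mD f2) -(RintegralZl (Im c) mD f1).
  rewrite -(RintegralD mD (integrable_scale _ f2) (integrable_scale _ f1)).
  by apply: eq_Rintegral => t _ /=; rewrite ImM.
Qed.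

Lemma cintgN f : cintegrable f -> cintg (fun t => - f t) = - cintg f.
Proof.
move=> fi; rewrite -mulN1r -cintgZ//.
by apply: eq_cintg => t _; rewrite mulN1r.
Qed.

Lemma cintgB f h : cintegrable f -> cintegrable h ->
  cintg (fun t => f t - h t) = cintg f - cintg h.
Proof.
by move=> fi hi; rewrite cintgD ?cintgN//; exact: cintegrableN.
Qed.

Lemma cintg_conj f : cintegrable f ->
  cintg (fun t => conjc (f t)) = conjc (cintg f).
Proof.
move=> [f1 f2]; apply: complex_eq => /=.
  by apply: eq_Rintegral => t _ /=; rewrite RconjE.
rewrite -[RHS]mulN1r -(RintegralZl (-1) mD f2).
by apply: eq_Rintegral => t _ /=; rewrite IconjE mulN1r.
Qed.

(** Multiplication by the unimodular [u] that makes the integral real and nonnegative reduces the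
    bound to one for real parts; bounding real and imaginary parts separately would lose a
    factor. *)
Lemma normc_cintg f k : cintegrable f -> m.-integrable D (EFin \o k) ->
  (forall t, D t -> normc (f t) <= k t) -> normc (cintg f) <= Rintegral m D k.
Proof.
move=> fi ki fk; have [->|w0] := eqVneq (cintg f) 0.
  rewrite normc0 Rintegral_ge0// => t Dt.
  exact: le_trans (normc_ge0 _) (fk t Dt).
set w := cintg f in w0 *; pose u := conjc w / (normc w)%:C%C.
have nw0 : normc w != 0 by rewrite normc_eq0.
have u1 : normc u = 1.
  by rewrite /u normcM normc_conj normcV normcR ger0_norm ?normc_ge0// divff.
have : u * w = (normc w)%:C%C.
  rewrite /u mulrAC [_ * w]mulrC mulc_conj rmorphXn /= expr2 mulfK//.
  by rewrite fmorph_eq0.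
rewrite /w -cintgZ// -/w => /(congr1 (@complex.Re R)) /= <-.
have [ui _] := cintegrableZ u fi.
apply: le_Rintegral => // t Dt /=.
rewrite (le_trans (ler_norm _))// (le_trans (normc_Re _))// normcM u1 mul1r.
exact: fk.
Qed.

End ComplexIntegral.

Lemma cintE {R : realType} (m : {measure set (measurableTypeR R) -> \bar R}) f :
  cint m f = cintg m circ f.
Proof.
apply: complex_eq; rewrite /cint ?ReD ?ImD ?ReM ?ImM /=; ring.
Qed.

(** * Continuous functions of the angle *)

Section ContinuousIntegrands.
Context {R : realType}.
Local Notation C := R[i].
Local Notation Re := (@complex.Re R).
Local Notation Im := (@complex.Im R).

Definition rcont (b : R -> C) := forall t : R,
  forall e : R, 0 < e -> exists2 r : R, 0 < r &
  forall s, `|s - t| < r -> normc (b s - b t) < e.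

Lemma continuousPr (k : R -> R) (t : R) :
  {for t, continuous k} <-> forall e : R, 0 < e -> exists2 r : R, 0 < r &
  forall s, `|s - t| < r -> `|k s - k t| < e.
Proof.
split=> [/cvgrPdist_lt H e e0|H].
  have /nbhs_ballP[r /= r0 rP] := H e e0.
  exists r => // s st; rewrite distrC; apply: rP.
  by rewrite /ball /= distrC.
apply/cvgrPdist_lt => e /H[r r0 rP].
apply/nbhs_ballP; exists r => //= s; rewrite /ball /= distrC => /rP.
by rewrite distrC.
Qed.

Lemma rcont_Re b : rcont b -> continuous (Re \o b).
Proof.
move=> bc t; apply/continuousPr => e /(bc t)[r r0 rP]; exists r => // s /rP.
by apply: le_lt_trans => /=; rewrite -ReB normc_Re.
Qed.

Lemma rcont_Im b : rcont b -> continuous (Im \o b).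
Proof.
move=> bc t; apply/continuousPr => e /(bc t)[r r0 rP]; exists r => // s /rP.
by apply: le_lt_trans => /=; rewrite -ImB normc_Im.
Qed.

Lemma rcont_normc b : rcont b -> continuous (fun t => normc (b t)).
Proof.
move=> bc t; apply/continuousPr => e /(bc t)[r r0 rP]; exists r => // s /rP.
apply: le_lt_trans => /=; rewrite ler_norml lerB_normc andbT.
by rewrite lerNl opprB normcB lerB_normc.
Qed.

Lemma rcont_ReIm b : continuous (Re \o b) -> continuous (Im \o b) -> rcont b.
Proof.
move=> /= rb ib t e e0.
have e2 : 0 < e / 2 by rewrite divr_gt0.
have /continuousPr/(_ _ e2)[r r0 rP] := rb t.
have /continuousPr/(_ _ e2)[s s0 sP] := ib t.
exists (Num.min r s); first by rewrite lt_min r0.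
move=> u; rewrite lt_min => /andP[/rP ur /sP us].
rewrite (le_lt_trans (normc_ReIm _))// ReB ImB.
rewrite (_ : e = e / 2 + e / 2); last by field.
exact: ltrD.
Qed.

Lemma continuous_bounded_itv (k : R -> R) (a b : R) : continuous k ->
  exists2 M : R, 0 < M & forall t, a <= t <= b -> `|k t| <= M.
Proof.
move=> kc; have [ab|ba] := leP a b; last first.
  by exists 1 => // t /andP[/le_trans H /H]; rewrite leNgt ba.
have [c _ cP] := @EVT_max R (fun t => `|k t|) a b ab
  (@continuous_subspaceT _ _ _ _ (fun t => cvg_norm (kc t))).
exists (`|k c| + 1) => [|t tab]; first by rewrite ltr_wpDl.
by rewrite (le_trans (cP t _)) ?in_itv// lerDl.
Qed.

Lemma measurable_circ : measurable (circ : set (measurableTypeR R)).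
Proof. exact: measurable_itv. Qed.

Lemma integrable_continuousM (m : {measure set (measurableTypeR R) -> \bar R})
    (k phi : R -> R) : continuous k -> m.-integrable circ (EFin \o phi) ->
  m.-integrable circ (EFin \o (fun t => k t * phi t)).
Proof.
move=> kc phii.
have [M M0 MP] := continuous_bounded_itv 0 (pi *+ 2) kc.
apply: (le_integrable measurable_circ _ _ (integrable_scale measurable_circ M phii)).
  apply/measurable_EFinP; apply: measurable_funM.
    by apply: measurable_funTS; exact: continuous_measurable_fun.
  by move/integrableP : phii => [/measurable_EFinP].
move=> t; rewrite /circ /= in_itv /= => /andP[t0 t1].
rewrite lee_fin !normrM (ger0_norm (ltW M0)) ler_wpM2r// MP// t0.
exact: ltW.
Qed.

Lemma cintegrable_contM (m : {measure set (measurableTypeR R) -> \bar R})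
    (b : R -> C) (phi : R -> R) : rcont b -> m.-integrable circ (EFin \o phi) ->
  cintegrable m circ (fun t => b t * (phi t)%:C%C).
Proof.
move=> bc phii; split.
- have := integrable_continuousM (rcont_Re bc) phii.
  apply: eq_integrable; first exact: measurable_circ.
  by move=> t _ /=; rewrite ReM /= mulr0 subr0.
- have := integrable_continuousM (rcont_Im bc) phii.
  apply: eq_integrable; first exact: measurable_circ.
  by move=> t _ /=; rewrite ImM /= mulr0 add0r.
Qed.

End ContinuousIntegrands.

(** * Integrals along the boundary of a rectangle *)

Section RectangleIntegral.
Context {R : realType}.
Local Notation C := R[i].
Local Notation leb := (@lebesgue_measure R).

Definition ci (a b : R) (g : R -> C) : C := cintg leb `[a, b]%classic g.

Definition rcont_at (b : R -> C) (t : R) :=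
  forall e : R, 0 < e -> exists2 r : R, 0 < r &
  forall s, `|s - t| < r -> normc (b s - b t) < e.

Definition cion (a b : R) (g : R -> C) := cintegrable leb `[a, b]%classic g.

Lemma ci_mitv (a b : R) : measurable (`[a, b]%classic : set (measurableTypeR R)).
Proof. exact: measurable_itv. Qed.

Lemma cion_cont a b g : (forall t, a <= t <= b -> rcont_at g t) -> cion a b g.
Proof.
move=> gc; split; apply: continuous_compact_integrable.
- exact: segment_compact.
- apply: continuous_in_subspaceT => t /set_mem /=; rewrite in_itv /= => /gc H.
  apply/continuousPr => e /H[r r0 rP]; exists r => // s /rP.
  by apply: le_lt_trans => /=; rewrite -ReB normc_Re.
- exact: segment_compact.
- apply: continuous_in_subspaceT => t /set_mem /=; rewrite in_itv /= => /gc H.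
  apply/continuousPr => e /H[r r0 rP]; exists r => // s /rP.
  by apply: le_lt_trans => /=; rewrite -ImB normc_Im.
Qed.

Lemma ci_split a x b g : a <= x -> x <= b -> cion a b g ->
  ci a b g = ci a x g + ci x b g.
Proof.
move=> ax xb [g1 g2].
have key (k : R -> R) : leb.-integrable `[a, b]%classic (EFin \o k) ->
    Rintegral leb `[a, b]%classic k =
    Rintegral leb `[a, x]%classic k + Rintegral leb `[x, b]%classic k.
  move=> ki; apply/eqP; rewrite addrC -subr_eq; apply/eqP.
  rewrite (Rintegral_itvB ki) ?bnd_simp// Rintegral_itv_obnd_cbnd//.
  apply: integrableS ki => //.
  by apply: subset_itvr; rewrite bnd_simp.
by apply: complex_eq => /=; exact: key.
Qed.

Lemma ci_pt a g : ci a a g = 0.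
Proof.
by rewrite /ci /cintg set_itv1 !Rintegral_set1.
Qed.

Lemma Rintegral_itv_cst (a b c : R) : a <= b ->
  Rintegral leb `[a, b]%classic (fun=> c) = c * (b - a).
Proof.
move=> ab; rewrite Rintegral_cst//=; have -> := (@lebesgue_measure_itv R `[a, b]); rewrite /=.
case: ifPn => //; rewrite lte_fin -leNgt => ba.
by have -> : a = b; [apply/eqP; rewrite eq_le ab|rewrite subrr].
Qed.

Lemma ci_norm a b g (M : R) : a <= b -> cion a b g ->
  (forall t, a <= t <= b -> normc (g t) <= M) -> normc (ci a b g) <= M * (b - a).
Proof.
move=> ab gi gM; rewrite -Rintegral_itv_cst//.
apply: (normc_cintg (ci_mitv a b) gi).
- apply: (@continuous_compact_integrable _ (fun=> M)); first exact: segment_compact.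
  by apply: continuous_subspaceT => t; exact: cvg_cst.
- by move=> t /=; rewrite in_itv /=; exact: gM.
Qed.

Lemma ci_affine a b (u v : C) : a <= b ->
  ci a b (fun t => u + v * t%:C%C) =
  u * (b - a)%:C%C + v * ((b ^+ 2 - a ^+ 2) / 2)%:C%C.
Proof.
move=> ab.
have idint : Rintegral leb `[a, b]%classic id = (b ^+ 2 - a ^+ 2) / 2.
  move: ab; rewrite le_eqVlt => /predU1P[->|ab].
    by rewrite set_itv1 Rintegral_set1 subrr mul0r.
  rewrite /Rintegral (@continuous_FTC2 _ id (fun t => t ^+ 2 / 2))//=.
  - by rewrite mulrBl.
  - by apply: continuous_subspaceT => t; exact: cvg_id.
  - have D t : derivable (fun t : R => t ^+ 2 / 2) t 1 by [].
    have K : continuous (fun t : R => t ^+ 2 / 2).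
      by move=> t; apply: differentiable_continuous; exact/derivable1_diffP.
    split => [t _//||]; first exact/cvg_at_right_filter/K.
    exact/cvg_at_left_filter/K.
  - move=> t _; rewrite derive1E deriveMr// exp_derive /=.
    by rewrite /GRing.scale /= expr1; field.
have cinti : cion a b (fun t => t%:C%C).
  apply: cion_cont => t _ e e0; exists e => // s.
  by rewrite -rmorphB normcR.
have csti : cion a b (fun=> u).
  by apply: cion_cont => t _ e e0; exists e => // s; rewrite subrr normc0.
rewrite /ci (cintgD (ci_mitv a b) csti); last exact: cintegrableZ (ci_mitv a b) _ _ cinti.
rewrite (cintgZ (ci_mitv a b) _ cinti); congr (_ + _ * _).
  apply: complex_eq; rewrite /= ?ReM ?ImM /= ?mulr0 ?subr0 ?add0r ?addr0.
    by rewrite (Rintegral_itv_cst _ ab).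
  by rewrite (Rintegral_itv_cst _ ab).
apply: complex_eq => /=; first exact: idint.
by rewrite (Rintegral_itv_cst _ ab) mul0r.
Qed.

Definition pt (x y : R) : C := (x +i* y)%C.

Lemma pt_dist x y x' y' : normc (pt x y - pt x' y') <= `|x - x'| + `|y - y'|.
Proof. by rewrite (le_trans (normc_ReIm _)). Qed.

(** The contour integral of f dz around the rectangle, counterclockwise: bottom minus top, and the
    factor i = dz/dy on the vertical sides, right minus left. *)
Definition rint f (x0 x1 y0 y1 : R) : C :=
  ci x0 x1 (fun x => f (pt x y0)) - ci x0 x1 (fun x => f (pt x y1))
  + 'i%C * (ci y0 y1 (fun y => f (pt x1 y)) - ci y0 y1 (fun y => f (pt x0 y))).

Definition inrect (x0 x1 y0 y1 : R) (z : C) :=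
  x0 <= complex.Re z <= x1 /\ y0 <= complex.Im z <= y1.

Lemma rcont_at_h (f : C -> C) x y : ccont f (pt x y) ->
  rcont_at (fun s => f (pt s y)) x.
Proof.
move=> fc e /fc[r r0 rP]; exists r => // s sr; apply: rP.
by rewrite (le_lt_trans (pt_dist _ _ _ _))// subrr normr0 addr0.
Qed.

Lemma rcont_at_v (f : C -> C) x y : ccont f (pt x y) ->
  rcont_at (fun s => f (pt x s)) y.
Proof.
move=> fc e /fc[r r0 rP]; exists r => // s sr; apply: rP.
by rewrite (le_lt_trans (pt_dist _ _ _ _))// subrr normr0 add0r.
Qed.

Section cont.
Variables (f : C -> C) (x0 x1 y0 y1 : R).
Hypothesis fc : forall z, inrect x0 x1 y0 y1 z -> ccont f z.

Lemma cion_h y : y0 <= y <= y1 -> cion x0 x1 (fun x => f (pt x y)).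
Proof. by move=> Hy; apply: cion_cont => t tx; apply: rcont_at_h; exact: fc. Qed.

Lemma cion_v x : x0 <= x <= x1 -> cion y0 y1 (fun y => f (pt x y)).
Proof. by move=> Hy; apply: cion_cont => t tx; apply: rcont_at_v; exact: fc. Qed.

Lemma rint_splitx x : y0 <= y1 -> x0 <= x <= x1 ->
  rint f x0 x1 y0 y1 = rint f x0 x y0 y1 + rint f x x1 y0 y1.
Proof.
move=> y01 /andP[ax xb]; rewrite /rint.
rewrite (ci_split ax xb); last by apply: cion_h; rewrite lexx.
rewrite (ci_split ax xb (g := fun x => f (pt x y1))); last first.
  by apply: cion_h; rewrite lexx andbT.
ring.
Qed.

Lemma rint_splity y : x0 <= x1 -> y0 <= y <= y1 ->
  rint f x0 x1 y0 y1 = rint f x0 x1 y0 y + rint f x0 x1 y y1.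
Proof.
move=> x01 /andP[ax xb]; rewrite /rint.
rewrite (ci_split ax xb); last by apply: cion_v; rewrite lexx andbT.
rewrite (ci_split ax xb (g := fun y => f (pt x0 y))); last first.
  by apply: cion_v; rewrite lexx.
ring.
Qed.

Lemma rint_bound (M : R) : x0 <= x1 -> y0 <= y1 ->
  (forall z, inrect x0 x1 y0 y1 z -> normc (f z) <= M) ->
  normc (rint f x0 x1 y0 y1) <= 2 * M * ((x1 - x0) + (y1 - y0)).
Proof.
move=> x01 y01 fM; rewrite /rint.
have B1 : normc (ci x0 x1 (fun x => f (pt x y0))) <= M * (x1 - x0).
  apply: ci_norm => //; first by apply: cion_h; rewrite lexx.
  by move=> t tx; apply: fM; split => //=; rewrite lexx.
have B2 : normc (ci x0 x1 (fun x => f (pt x y1))) <= M * (x1 - x0).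
  apply: ci_norm => //; first by apply: cion_h; rewrite lexx andbT.
  by move=> t tx; apply: fM; split => //=; rewrite lexx andbT.
have B3 : normc (ci y0 y1 (fun y => f (pt x1 y))) <= M * (y1 - y0).
  apply: ci_norm => //; first by apply: cion_v; rewrite lexx andbT.
  by move=> t tx; apply: fM; split => //=; rewrite lexx andbT.
have B4 : normc (ci y0 y1 (fun y => f (pt x0 y))) <= M * (y1 - y0).
  apply: ci_norm => //; first by apply: cion_v; rewrite lexx.
  by move=> t tx; apply: fM; split => //=; rewrite lexx.
rewrite (le_trans (ler_normcD _ _))//.
have i1 : normc ('i%C : C) = 1 by rewrite /normc expr0n expr1n add0r sqrtr1.
rewrite normcM i1 mul1r.
have := ler_normcB (ci x0 x1 (fun x => f (pt x y0))) (ci x0 x1 (fun x => f (pt x y1))).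
have := ler_normcB (ci y0 y1 (fun y => f (pt x1 y))) (ci y0 y1 (fun y => f (pt x0 y))).
lra.
Qed.

End cont.

Lemma rintD f h x0 x1 y0 y1 : x0 <= x1 -> y0 <= y1 ->
  (forall z, inrect x0 x1 y0 y1 z -> ccont f z) ->
  (forall z, inrect x0 x1 y0 y1 z -> ccont h z) ->
  rint (fun z => f z + h z) x0 x1 y0 y1 = rint f x0 x1 y0 y1 + rint h x0 x1 y0 y1.
Proof.
move=> x01 y01 fc hc; rewrite /rint /ci !(cintgD (ci_mitv _ _)).
- ring.
all: try by apply: (cion_h fc); rewrite lexx ?andbT.
all: try by apply: (cion_h hc); rewrite lexx ?andbT.
all: try by apply: (cion_v fc); rewrite lexx ?andbT.
all: by apply: (cion_v hc); rewrite lexx ?andbT.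
Qed.

(** In Goursat's argument this removes the first-order part of the function, leaving only the
    remainder of the expansion. *)
Lemma rint_affine (u v : C) x0 x1 y0 y1 : x0 <= x1 -> y0 <= y1 ->
  rint (fun z => u + v * z) x0 x1 y0 y1 = 0.
Proof.
move=> x01 y01; rewrite /rint.
have ptE x y : pt x y = x%:C%C + 'i%C * y%:C%C.
  by apply: complex_eq; rewrite ?ReD ?ImD ?ReM ?ImM /=; ring.
have H y : ci x0 x1 (fun x => u + v * pt x y) =
    ci x0 x1 (fun x => (u + v * 'i%C * y%:C%C) + v * x%:C%C).
  by apply: eq_cintg => t _; rewrite ptE; ring.
have V x : ci y0 y1 (fun y => u + v * pt x y) =
    ci y0 y1 (fun y => (u + v * x%:C%C) + v * 'i%C * y%:C%C).
  by apply: eq_cintg => t _; rewrite ptE; ring.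
rewrite !H !V !ci_affine// !rmorphB /=.
ring.
Qed.

End RectangleIntegral.
#[global] Arguments rint : simpl never.
#[global] Arguments ci : simpl never.

(** * Goursat's theorem for rectangles *)

Section Goursat.
Context {R : realType}.
Local Notation C := R[i].

Lemma nested_intervals (l u : nat -> R) :
  (forall n, l n <= l n.+1) -> (forall n, u n.+1 <= u n) ->
  (forall n, l n <= u n) -> exists p, forall n, l n <= p <= u n.
Proof.
move=> l1 u1 lu.
have lm n k : l n <= l (n + k)%N.
  by elim: k => [|k IH]; rewrite ?addn0// addnS (le_trans IH).
have um n k : u (n + k)%N <= u n.
  by elim: k => [|k IH]; rewrite ?addn0// addnS (le_trans _ IH).
have lun n k : l n <= u k.
  by rewrite (le_trans (lm n k))// (le_trans (lu _))// addnC.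
have ne : (range l) !=set0 by exists (l 0%N), 0%N.
exists (sup (range l)) => n; apply/andP; split.
  apply: ub_le_sup; last by exists n.
  by exists (u 0%N) => _ [k _ <-].
by apply: ge_sup => // _ [k _ <-].
Qed.

Lemma exists_pow2_lt (a e : R) : 0 < e -> exists n : nat, a / 2 ^+ n < e.
Proof.
move=> e0; exists (Num.bound (`|a| / e)).
set n := Num.bound _.
have : `|a| / e < n%:R by rewrite archi_boundP// divr_ge0// ltW.
rewrite ltr_pdivrMr// => an; rewrite ltr_pdivrMr ?exprn_gt0//.
rewrite (le_lt_trans (ler_norm a))// (lt_le_trans an)// mulrC ler_pM2l//.
by rewrite -natrX ler_nat ltnW// ltn_expl.
Qed.

Section statement.
Variables (f : C -> C) (x0 x1 y0 y1 : R).
Hypotheses (x01 : x0 <= x1) (y01 : y0 <= y1).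
Hypothesis fd : forall z, inrect x0 x1 y0 y1 z -> exists d, cder f z d.

Let fc z : inrect x0 x1 y0 y1 z -> ccont f z.
Proof. by move=> /fd[d /cder_cont]. Qed.

Let A n : R := (x1 - x0) / 2 ^+ n.
Let B n : R := (y1 - y0) / 2 ^+ n.
Let AS n : A n = A n.+1 + A n.+1.
Proof. by rewrite /A exprS; field; rewrite expf_neq0. Qed.
Let BS n : B n = B n.+1 + B n.+1.
Proof. by rewrite /B exprS; field; rewrite expf_neq0. Qed.
Let A0 n : 0 <= A n. Proof. by rewrite divr_ge0 ?exprn_ge0// subr_ge0. Qed.
Let B0 n : 0 <= B n. Proof. by rewrite divr_ge0 ?exprn_ge0// subr_ge0. Qed.
Let c := normc (rint f x0 x1 y0 y1).
Let J n (p : R * R) := rint f p.1 (p.1 + A n) p.2 (p.2 + B n).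

(** State of the quadrisection after n steps: [p] is the lower left corner of a subrectangle with
    sides [A n], [B n] that still carries a 4^(-n) share of the original integral. *)
Let Inv n (p : R * R) :=
  [/\ x0 <= p.1, p.1 + A n <= x1, y0 <= p.2, p.2 + B n <= y1
   & c / 4 ^+ n <= normc (J n p)].

(** The integral is the sum over the four quarters, so one of them has at least a quarter of the
    modulus. The four candidates for [q] are their lower left corners. *)
Let step n p : Inv n p -> exists q, Inv n.+1 q /\
  [/\ p.1 <= q.1, q.1 + A n.+1 <= p.1 + A n, p.2 <= q.2
   & q.2 + B n.+1 <= p.2 + B n].
Proof.
move=> [p1 p2 p3 p4 p5].
pose q1 := p.1 + A n.+1; pose q2 := p.2 + B n.+1.
have sub z : inrect p.1 (p.1 + A n) p.2 (p.2 + B n) z -> ccont f z.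
  move=> [/andP[z1 z2] /andP[z3 z4]]; apply: fc.
  by split; apply/andP; split; [exact: le_trans z1|exact: le_trans p2|
    exact: le_trans z3|exact: le_trans p4].
have a1 := A0 n.+1; have b1 := B0 n.+1; have an := AS n; have bn := BS n.
have JE : J n p = J n.+1 p + J n.+1 (q1, p.2) + (J n.+1 (p.1, q2) + J n.+1 (q1, q2)).
  have pa : p.1 <= p.1 + A n by rewrite lerDl.
  have q2p : p.2 <= q2 <= p.2 + B n by rewrite /q2; apply/andP; split; lra.
  have q1p : p.1 <= q1 <= p.1 + A n by rewrite /q1; apply/andP; split; lra.
  have sub1 z : inrect p.1 (p.1 + A n) p.2 q2 z -> ccont f z.
    move=> [z1 /andP[z3 z4]]; apply: sub; split => //.
    by apply/andP; split => //; rewrite (le_trans z4)//; case/andP: q2p.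
  have sub2 z : inrect p.1 (p.1 + A n) q2 (p.2 + B n) z -> ccont f z.
    move=> [z1 /andP[z3 z4]]; apply: sub; split => //.
    by apply/andP; split => //; rewrite (le_trans _ z3)//; case/andP: q2p.
  have /andP[q2a q2b] := q2p.
  rewrite /J /= (rint_splity sub pa q2p) (rint_splitx sub1 q2a q1p).
  rewrite (rint_splitx sub2 q2b q1p).
  by rewrite /q1 /q2 an bn !addrA.
have : exists2 q, q \in [:: p; (q1, p.2); (p.1, q2); (q1, q2)] & c / 4 ^+ n.+1 <= normc (J n.+1 q).
  apply: contrapT => /forall2NP H.
  have K q : q \in [:: p; (q1, p.2); (p.1, q2); (q1, q2)] -> normc (J n.+1 q) < c / 4 ^+ n.+1.
    by move=> qI; have [//|/negP] := H q; rewrite -ltNge.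
  have k1 := K p; have k2 := K (q1, p.2); have k3 := K (p.1, q2); have k4 := K (q1, q2).
  rewrite !inE !eqxx ?orbT /= in k1 k2 k3 k4.
  have {}k1 := k1 isT; have {}k2 := k2 isT; have {}k3 := k3 isT; have {}k4 := k4 isT.
  move: p5; rewrite JE leNgt => /negP; apply.
  have t1 := ler_normcD (J n.+1 p + J n.+1 (q1, p.2)) (J n.+1 (p.1, q2) + J n.+1 (q1, q2)).
  have t2 := ler_normcD (J n.+1 p) (J n.+1 (q1, p.2)).
  have t3 := ler_normcD (J n.+1 (p.1, q2)) (J n.+1 (q1, q2)).
  have -> : c / 4 ^+ n = 4 * (c / 4 ^+ n.+1).
    by rewrite exprS; field; rewrite expf_neq0.
  lra.
move=> [q qI cq]; exists q; split.
  by move: qI; rewrite !inE => /or4P[] /eqP qE; split => //;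
    rewrite qE /= /q1 /q2; lra.
by move: qI; rewrite !inE => /or4P[] /eqP ->; rewrite /= /q1 /q2; split; lra.
Qed.

Lemma goursat : rint f x0 x1 y0 y1 = 0.
Proof.
have /choice[F FP] : forall np : nat * (R * R), exists q, Inv np.1 np.2 ->
    Inv np.1.+1 q /\ [/\ np.2.1 <= q.1, q.1 + A np.1.+1 <= np.2.1 + A np.1,
      np.2.2 <= q.2 & q.2 + B np.1.+1 <= np.2.2 + B np.1].
  move=> [n p]; have [/step[q qP]|nI] := pselect (Inv n p); first by exists q.
  by exists p.
pose s := fix s n := if n is k.+1 then F (k, s k) else (x0, y0).
have sI n : Inv n (s n).
  elim: n => [|n IH]; last by have [] := FP (n, s n) IH.
  have hx : x0 + A 0%N = x1 by rewrite /A expr0 divr1 addrC subrK.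
  have hy : y0 + B 0%N = y1 by rewrite /B expr0 divr1 addrC subrK.
  by rewrite /Inv /J /= hx hy expr0 divr1.
have sS n : [/\ (s n).1 <= (s n.+1).1, (s n.+1).1 + A n.+1 <= (s n).1 + A n,
    (s n).2 <= (s n.+1).2 & (s n.+1).2 + B n.+1 <= (s n).2 + B n].
  by have [] := FP (n, s n) (sI n).
have [px pxP] : exists px, forall n, (s n).1 <= px <= (s n).1 + A n.
  apply: nested_intervals => n; [by have [] := sS n|by have [] := sS n|].
  by rewrite lerDl.
have [py pyP] : exists py, forall n, (s n).2 <= py <= (s n).2 + B n.
  apply: nested_intervals => n; [by have [] := sS n|by have [] := sS n|].
  by rewrite lerDl.
pose p := pt px py.
have pin : inrect x0 x1 y0 y1 p.
  have [h1 h2 h3 h4 _] := sI 0%N.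
  have /andP[a1 a2] := pxP 0%N; have /andP[b1 b2] := pyP 0%N.
  by split; apply/andP; split => /=; lra.
have [d dP] := fd pin.
apply/eqP; rewrite -normc_eq0 -/c; apply/negPn/negP => c0.
have {}c0 : 0 < c by rewrite lt_def c0 normc_ge0.
pose L := (x1 - x0) + (y1 - y0).
have L0 : 0 <= L by rewrite addr_ge0 ?subr_ge0.
(* At step n the remainder is at most e L/2^n on a rectangle of perimeter 2L/2^n, so the integral is
   at most 2 e L^2/4^n. This [e] makes 2 e L^2 smaller than c, against the lower bound c/4^n; the
   added 1 covers L = 0. *)
pose e := c / (4 * (L ^+ 2 + 1)).
have e0 : 0 < e by rewrite divr_gt0// mulr_gt0// ltr_wpDl// sqr_ge0.
have [r r0 rP] := dP e e0.
have [n nr] := exists_pow2_lt L r0.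
have LE : A n + B n = L / 2 ^+ n by rewrite /L mulrDl.
pose E z := f z - f p - d * (z - p).
have [h1 h2 h3 h4 h5] := sI n.
have sub z : inrect (s n).1 ((s n).1 + A n) (s n).2 ((s n).2 + B n) z ->
    inrect x0 x1 y0 y1 z.
  by move=> [/andP[z1 z2] /andP[z3 z4]]; split; apply/andP; split; lra.
have Ec z : inrect (s n).1 ((s n).1 + A n) (s n).2 ((s n).2 + B n) z -> ccont E z.
  move=> /sub/fd[d' d'P].
  apply: cder_cont (cderB (cderB d'P (cder_cst _ _))
    (cderM (cder_cst d z) (cderB (cder_id z) (cder_cst p z)))).
have EM z : inrect (s n).1 ((s n).1 + A n) (s n).2 ((s n).2 + B n) z ->
    normc (E z) <= e * (L / 2 ^+ n).
  move=> [/andP[z1 z2] /andP[z3 z4]].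
  have /andP[a1 a2] := pxP n; have /andP[b1 b2] := pyP n.
  have zp : normc (z - p) <= L / 2 ^+ n.
    rewrite -LE (le_trans (normc_ReIm _))// ReB ImB /= lerD// ler_norml; lra.
  rewrite (le_trans (rP z _))//; first exact: le_lt_trans nr.
  by rewrite ler_pM2l.
have JE : J n (s n) = rint E (s n).1 ((s n).1 + A n) (s n).2 ((s n).2 + B n).
  rewrite /J (_ : f = fun z => ((f p - d * p) + d * z) + E z); last first.
    by apply/funext => z; rewrite /E; ring.
  rewrite rintD ?lerDl//; last first.
    move=> z _; apply: cder_cont (cderD (cder_cst _ _)
      (cderM (cder_cst d z) (cder_id z))).
  by rewrite rint_affine ?lerDl// add0r.
have := rint_bound Ec _ _ EM; rewrite !lerDl => /(_ (A0 n) (B0 n)).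
have cancel (a b : R) : a + b - a = b by ring.
rewrite -JE !cancel LE => JM.
have := le_trans h5 JM.
have -> : 4 ^+ n = 2 ^+ n * 2 ^+ n :> R by rewrite -exprMn; congr (_ ^+ _); lra.
have p2 : 0 < 2 ^+ n :> R by rewrite exprn_gt0.
have -> : 2 * (e * (L / 2 ^+ n)) * (L / 2 ^+ n) = (2 * e * L ^+ 2) / (2 ^+ n * 2 ^+ n).
  by field; rewrite gt_eqF.
rewrite ler_pM2r ?invr_gt0 ?mulr_gt0//.
have : 4 * e * (L ^+ 2 + 1) = c.
  by rewrite /e; field; rewrite gt_eqF// ltr_wpDl// sqr_ge0.
have := sqr_ge0 L.
nra.
Qed.

End statement.

End Goursat.

(** * Goursat's theorem with one exceptional point *)

Section ExceptionalPoint.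
Context {R : realType}.
Local Notation C := R[i].

Lemma rint_degx (f : C -> C) x y0 y1 : rint f x x y0 y1 = 0.
Proof. by rewrite /rint !ci_pt !subrr mulr0 addr0. Qed.

Lemma rint_degy (f : C -> C) x0 x1 y : rint f x0 x1 y y = 0.
Proof. by rewrite /rint !ci_pt !subrr mulr0 addr0. Qed.

(** Intended for difference quotients, which at their base point are at first only continuous. The
    four rectangles around a small clipped square at [p] contribute nothing, and the square
    contributes an amount proportional to its side. *)
Lemma goursat_except (f : C -> C) (x0 x1 y0 y1 : R) (p : C) :
  x0 <= x1 -> y0 <= y1 ->
  (forall z, inrect x0 x1 y0 y1 z -> ccont f z) ->
  (forall z, inrect x0 x1 y0 y1 z -> z != p -> exists d, cder f z d) ->
  rint f x0 x1 y0 y1 = 0.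
Proof.
move=> x01 y01 fc fd.
have [[/andP[p1 p2] /andP[p3 p4]]|np] := pselect (inrect x0 x1 y0 y1 p); last first.
  apply: goursat => // z zin; apply: fd => //.
  by apply/eqP => zp; rewrite zp in zin.
have [r r0 rP] := fc p (conj (introT andP (conj p1 p2)) (introT andP (conj p3 p4)))
  _ ltr01.
set px := complex.Re p in p1 p2; set py := complex.Im p in p3 p4.
set M := normc (f p) + 1.
have M0 : 0 < M by rewrite ltr_wpDl// normc_ge0.
(* The clipped square has sides at most 2n, hence perimeter at most 8n, and |f| is at most M on it.
   Cuts that fall outside the rectangle give degenerate pieces. *)
have key n : 0 < n -> n < r / 2 -> normc (rint f x0 x1 y0 y1) <= 8 * M * n.
  move=> n0 nr.
  pose a := Num.max x0 (px - n); pose b := Num.min x1 (px + n).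
  pose c := Num.max y0 (py - n); pose d := Num.min y1 (py + n).
  have a1 : x0 <= a by rewrite /a le_max lexx.
  have a2 : px - n <= a by rewrite /a le_max lexx orbT.
  have a3 : a <= px by rewrite /a ge_max p1 /=; lra.
  have b1 : b <= x1 by rewrite /b ge_min lexx.
  have b2 : b <= px + n by rewrite /b ge_min lexx orbT.
  have b3 : px <= b by rewrite /b le_min p2 /=; lra.
  have c1 : y0 <= c by rewrite /c le_max lexx.
  have c2 : py - n <= c by rewrite /c le_max lexx orbT.
  have c3 : c <= py by rewrite /c ge_max p3 /=; lra.
  have d1 : d <= y1 by rewrite /d ge_min lexx.
  have d2 : d <= py + n by rewrite /d ge_min lexx orbT.
  have d3 : py <= d by rewrite /d le_min p4 /=; lra.
  have S u1 u2 v1 v2 : x0 <= u1 -> u2 <= x1 -> y0 <= v1 -> v2 <= y1 ->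
      forall z, inrect u1 u2 v1 v2 z -> inrect x0 x1 y0 y1 z.
    move=> h1 h2 h3 h4 z [/andP[z1 z2] /andP[z3 z4]].
    by split; apply/andP; split; lra.
  have left0 : rint f x0 a y0 y1 = 0.
    have [ax|ax] := leP (px - n) x0.
      by rewrite /a max_l// rint_degx.
    apply: goursat => // z zin; apply: fd; first by apply: S zin => //; lra.
    apply/eqP => zp; move: zin; rewrite zp => -[/andP[_]].
    by rewrite -/px /a max_r; lra.
  have right0 : rint f b x1 y0 y1 = 0.
    have [ax|ax] := leP x1 (px + n).
      by rewrite /b min_l// rint_degx.
    apply: goursat => // z zin; apply: fd; first by apply: S zin => //; lra.
    apply/eqP => zp; move: zin; rewrite zp => -[/andP[+ _] _].
    by rewrite -/px /b min_r; lra.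
  have ab : a <= b by lra.
  have cd : c <= d by lra.
  have bot0 : rint f a b y0 c = 0.
    have [ax|ax] := leP (py - n) y0.
      by rewrite /c max_l// rint_degy.
    apply: goursat => // z zin; apply: fd; first by apply: S zin => //; lra.
    apply/eqP => zp; move: zin; rewrite zp => -[_ /andP[_]].
    by rewrite -/py /c max_r; lra.
  have top0 : rint f a b d y1 = 0.
    have [ax|ax] := leP y1 (py + n).
      by rewrite /d min_l// rint_degy.
    apply: goursat => // z zin; apply: fd; first by apply: S zin => //; lra.
    apply/eqP => zp; move: zin; rewrite zp => -[_ /andP[+ _]].
    by rewrite -/py /d min_r; lra.
  have sub u1 u2 v1 v2 : x0 <= u1 -> u2 <= x1 -> y0 <= v1 -> v2 <= y1 ->
      forall z, inrect u1 u2 v1 v2 z -> ccont f z.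
    by move=> h1 h2 h3 h4 z /(S _ _ _ _ h1 h2 h3 h4); exact: fc.
  rewrite (@rint_splitx _ f x0 x1 y0 y1 fc a)//; last by apply/andP; split; lra.
  rewrite left0 add0r (@rint_splitx _ f a x1 y0 y1 _ b)//; last 2 first.
  - by apply: sub => //; lra.
  - by apply/andP; split; lra.
  rewrite right0 addr0 (@rint_splity _ f a b y0 y1 _ c)//; last 2 first.
  - by apply: sub => //; lra.
  - by apply/andP; split; lra.
  rewrite bot0 add0r (@rint_splity _ f a b c y1 _ d)//; last 2 first.
  - by apply: sub => //; lra.
  - by apply/andP; split; lra.
  rewrite top0 addr0.
  have fM z : inrect a b c d z -> normc (f z) <= M.
    move=> [/andP[z1 z2] /andP[z3 z4]].
    have : normc (f z - f p) < 1.
      apply: rP; rewrite (le_lt_trans (normc_ReIm _))// ReB ImB -/px -/py.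
      have : `|complex.Re z - px| <= n by rewrite ler_norml; lra.
      have : `|complex.Im z - py| <= n by rewrite ler_norml; lra.
      lra.
    have := ler_normcD (f z - f p) (f p); rewrite subrK /M.
    lra.
  have := rint_bound (sub _ _ _ _ a1 b1 c1 d1) ab cd fM.
  move/le_trans; apply.
  have : b - a + (d - c) <= 4 * n by lra.
  nra.
apply/eqP; rewrite -normc_eq0; apply/negPn/negP => J0.
have {}J0 : 0 < normc (rint f x0 x1 y0 y1) by rewrite lt_def J0 normc_ge0.
set j := normc _ in J0 key.
pose n := Num.min (r / 4) (j / (16 * M)).
have M16 : 0 < 16 * M by lra.
have n0 : 0 < n by rewrite lt_min !divr_gt0.
have nr : n < r / 2.
  by apply: (@le_lt_trans _ _ (r / 4)); [rewrite ge_min lexx|lra].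
have nj : n <= j / (16 * M) by rewrite ge_min lexx orbT.
have := key n n0 nr; move: nj; rewrite ler_pdivlMr//.
nra.
Qed.

End ExceptionalPoint.

(** * The complex exponential *)

Section ComplexExponential.
Context {R : realType}.
Local Notation C := R[i].

Lemma is_derive_eps (k : R -> R) (x d : R) : is_derive x 1 k d ->
  forall e : R, 0 < e -> exists2 r : R, 0 < r &
  forall s, `|s - x| < r -> `|k s - k x - d * (s - x)| <= e * `|s - x|.
Proof.
move=> [dr dv] e e0.
have : (fun h : R => h^-1 *: ((k \o shift x) (h *: 1) - k x)) @ 0^' --> d.
  by rewrite -dv; exact: dr.
move=> /cvgrPdist_le/(_ _ e0) /nbhs_ballP[r /= r0 rP].
exists r => // w wr.
have [->|wz] := eqVneq w x; first by rewrite !subrr mulr0 subr0 normr0 mulr0.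
have w0 : w - x != 0 by rewrite subr_eq0.
have /(rP _) : ball (0 : R) r (w - x).
  by rewrite /ball /= sub0r normrN.
move=> /(_ w0) /=; rewrite /GRing.scale /= mulr1 subrK => dle.
have -> : k w - k x - d * (w - x) = - (d - (w - x)^-1 * (k w - k x)) * (w - x).
  by field.
by rewrite normrM normrN ler_wpM2r.
Qed.

Lemma cexpE (z : C) :
  cexp z = (expR (complex.Re z))%:C%C * eit (complex.Im z).
Proof. by []. Qed.

Lemma normc_eit (t : R) : normc (eit t) = 1.
Proof. by rewrite /eit /normc cos2Dsin2 sqrtr1. Qed.

Lemma eit_neq0 (t : R) : eit t != 0.
Proof. by rewrite -normc_eq0 normc_eit oner_eq0. Qed.

Lemma eitD (s t : R) : eit (s + t) = eit s * eit t.
Proof.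
by apply: complex_eq; rewrite ?ReM ?ImM /= ?cosD ?sinD// addrC mulrC [X in X + _]mulrC.
Qed.

Lemma eit0 : eit (0 : R) = 1.
Proof. by rewrite /eit cos0 sin0. Qed.

Lemma eit2pi : eit (pi *+ 2 : R) = 1.
Proof. by rewrite /eit cos2pi sin2pi. Qed.

Lemma cexpD (z w : C) : cexp (z + w) = cexp z * cexp w.
Proof. by rewrite !cexpE ReD ImD expRD eitD rmorphM /=; ring. Qed.

Lemma cexp0 : cexp (0 : C) = 1.
Proof. by rewrite cexpE /= expR0 eit0 mul1r. Qed.

Lemma normc_cexp (z : C) : normc (cexp z) = expR (complex.Re z).
Proof. by rewrite cexpE normcM normc_eit normcR mulr1 ger0_norm// expR_ge0. Qed.

Lemma cexp_neq0 (z : C) : cexp z != 0.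
Proof. by rewrite -normc_gt0 normc_cexp expR_gt0. Qed.

Lemma cder_cexp0 : cder (@cexp R) 0 1.
Proof.
move=> e e0.
have e1 : 0 < e / 10 by rewrite divr_gt0.
have [r1 r10 P1] := is_derive_eps (is_derive_expR (0 : R)) e1.
have [r2 r20 P2] := is_derive_eps (is_derive_cos (0 : R)) e1.
have [r3 r30 P3] := is_derive_eps (is_derive_sin (0 : R)) e1.
have [r4 r40 P4] := is_derive_eps (is_derive_expR (0 : R)) ltr01.
exists (Num.min (Num.min (Num.min r1 r2) (Num.min r3 r4)) (Num.min (1 / 2) (e / 10))).
  by rewrite !lt_min r10 r20 r30 r40 e1 divr_gt0.
move=> w; rewrite !subr0 !lt_min => /andP[/andP[/andP[w1 w2] /andP[w3 w4]] /andP[w5 w6]].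
have aw := normc_Re w; have bw := normc_Im w.
set a := complex.Re w in aw *; set b := complex.Im w in bw *.
have := P1 a; rewrite subr0 expR0 mul1r => /(_ (le_lt_trans aw w1)) q1.
have := P2 b; rewrite subr0 cos0 sin0 oppr0 mul0r subr0 => /(_ (le_lt_trans bw w2)) q2.
have := P3 b; rewrite subr0 sin0 cos0 mul1r subr0 => /(_ (le_lt_trans bw w3)) q3.
have := P4 a; rewrite subr0 expR0 !mul1r => /(_ (le_lt_trans aw w4)) q4.
have a0 := normr_ge0 a; have b0 := normr_ge0 b.
have E1 : `|expR a - 1| <= 2 * `|a|.
  have -> : expR a - 1 = (expR a - 1 - a) + a by ring.
  by rewrite (le_trans (ler_normD _ _))//; lra.
have E0 : `|expR a| <= 2.
  have -> : expR a = (expR a - 1) + 1 by ring.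
  by rewrite (le_trans (ler_normD _ _))// normr1; lra.
have Re1 : `|complex.Re (cexp w - cexp 0 - w)| <= e / 10 * `|a| + 2 * (e / 10 * `|b|).
  rewrite cexp0 !ReB cexpE ReM /= -/a -/b mul0r subr0.
  have -> : expR a * cos b - 1 - a = (expR a - 1 - a) + expR a * (cos b - 1) by ring.
  rewrite (le_trans (ler_normD _ _))// lerD// normrM ler_pM//.
have Im1 : `|complex.Im (cexp w - cexp 0 - w)| <= 2 * (e / 10 * `|b|) + 2 * `|a| * `|b|.
  rewrite cexp0 !ImB cexpE ImM /= -/a -/b mul0r addr0 subr0.
  have -> : expR a * sin b - b = expR a * (sin b - b) + (expR a - 1) * b by ring.
  rewrite (le_trans (ler_normD _ _))// !normrM lerD// ler_pM//.
apply: le_trans (normc_ReIm _) _; apply: le_trans (lerD Re1 Im1) _.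
have : `|a| * `|b| <= e / 10 * `|b| by rewrite ler_wpM2r//; lra.
nra.
Qed.

(** The functional equation carries the derivative at 0 to every point. *)
Lemma cder_cexp (z : C) : cder (@cexp R) z (cexp z).
Proof.
have H := cder_comp (cderB (cder_id z) (cder_cst z z)) (_ : cder (@cexp R) (z - z) 1).
rewrite subrr in H; have {}H := cderM (cder_cst (cexp z) z) (H cder_cexp0).
move: H; rewrite mulr0 addr0 subr0 !mulr1.
rewrite (_ : (fun _ => _) = @cexp R)//; apply/funext => w.
by rewrite -cexpD addrC subrK.
Qed.

Lemma ccont_comp (f h : C -> C) z : ccont f z -> ccont h (f z) ->
  ccont (fun w => h (f w)) z.
Proof.
by move=> fc hc e /hc[r r0 rP]; have [s s0 sP] := fc r r0; exists s => // w /sP/rP.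
Qed.

Lemma rcont_eit : rcont (@eit R).
Proof.
apply: rcont_ReIm.
  rewrite (_ : _ \o _ = cos); last exact/funext.
  by have := @continuous_cos R.
rewrite (_ : _ \o _ = sin); last exact/funext.
by have := @continuous_sin R.
Qed.

Lemma rcont_comp (f : C -> C) b : rcont b -> (forall t, ccont f (b t)) ->
  rcont (fun t => f (b t)).
Proof.
by move=> bc fc t e /(fc t e)[r r0 rP]; have [s s0 sP] := bc t r r0; exists s => // u /sP/rP.
Qed.

End ComplexExponential.

(** * Rules for differentiable functions and difference quotients *)

Section Cdiff.
Context {R : realType}.
Local Notation C := R[i].
Implicit Types (f h : C -> C) (z : C).

Definition cdiff f z := exists d, cder f z d.

Lemma cdiff_cont f z : cdiff f z -> ccont f z.
Proof. by move=> [d /cder_cont]. Qed.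

Lemma cdiff_cst c z : cdiff (fun=> c) z.
Proof. by exists 0; exact: cder_cst. Qed.

Lemma cdiff_id z : cdiff (fun w => w) z.
Proof. by exists 1; exact: cder_id. Qed.

Lemma cdiffD f h z : cdiff f z -> cdiff h z -> cdiff (fun w => f w + h w) z.
Proof. by move=> [a fa] [b hb]; exists (a + b); exact: cderD. Qed.

Lemma cdiffB f h z : cdiff f z -> cdiff h z -> cdiff (fun w => f w - h w) z.
Proof. by move=> [a fa] [b hb]; exists (a - b); exact: cderB. Qed.

Lemma cdiffM f h z : cdiff f z -> cdiff h z -> cdiff (fun w => f w * h w) z.
Proof. by move=> [a fa] [b hb]; eexists; exact: (cderM fa hb). Qed.

Lemma cdiffV f z : f z != 0 -> cdiff f z -> cdiff (fun w => (f w)^-1) z.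
Proof. by move=> f0 [a fa]; eexists; exact: (cderV f0 fa). Qed.

Lemma cdiff_div f h z : h z != 0 -> cdiff f z -> cdiff h z ->
  cdiff (fun w => f w / h w) z.
Proof. by move=> h0 fd hd; apply: cdiffM => //; exact: cdiffV. Qed.

Lemma cdiff_comp f h z : cdiff f z -> cdiff h (f z) -> cdiff (fun w => h (f w)) z.
Proof. by move=> [a fa] [b hb]; eexists; exact: (cder_comp fa hb). Qed.

Lemma cdiff_near f h z (r : R) : 0 < r ->
  (forall w, normc (w - z) < r -> f w = h w) -> cdiff f z -> cdiff h z.
Proof. by move=> r0 fh [a fa]; exists a; exact: (cder_near r0 fh fa). Qed.

(** With d the derivative of f at p this is continuous at p, which is all that [goursat_except]
    asks; [dquot_holo] later upgrades continuity to differentiability. *)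
Definition dquot f p d z := if z == p then d else (f z - f p) / (z - p).

Lemma dquot_cont f p d : cder f p d -> ccont (dquot f p d) p.
Proof.
move=> fd e e0; have e2 : 0 < e / 2 by rewrite divr_gt0.
have [r r0 rP] := fd (e / 2) e2; exists r => // w /rP wr.
rewrite /dquot eqxx; case: eqVneq => [_|wp].
  by rewrite subrr normc0.
have wp0 : w - p != 0 by rewrite subr_eq0.
have -> : (f w - f p) / (w - p) - d = (f w - f p - d * (w - p)) / (w - p) by field.
rewrite normcM normcV; apply: (@le_lt_trans _ _ (e / 2)); last lra.
by rewrite ler_pdivrMr// normc_gt0.
Qed.

Lemma dquot_diff f p d z : z != p -> cdiff f z -> cdiff (dquot f p d) z.
Proof.
move=> zp fz; have zp0 : 0 < normc (z - p) by rewrite normc_gt0 subr_eq0.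
apply: (@cdiff_near (fun w => (f w - f p) / (w - p)) _ _ _ zp0).
  move=> w wz; rewrite /dquot; case: eqVneq => // wp.
  by move: wz; rewrite wp normcB ltxx.
apply: cdiff_div; first by rewrite subr_eq0.
  by apply: cdiffB => //; exact: cdiff_cst.
by apply: cdiffB; [exact: cdiff_id|exact: cdiff_cst].
Qed.

Lemma cdiff_exp z : cdiff (@cexp R) z.
Proof. by eexists; exact: cder_cexp. Qed.

Lemma ccontM f h z : ccont f z -> ccont h z -> ccont (fun w => f w * h w) z.
Proof.
move=> fc hc e e0.
pose M := normc (f z) + normc (h z) + 1.
have M0 : 0 < M by rewrite ltr_wpDl// addr_ge0 ?normc_ge0.
pose e' := Num.min 1 (e / M / 2).
have e'0 : 0 < e' by rewrite lt_min ltr01 !divr_gt0.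
have [r r0 rP] := fc _ e'0; have [s s0 sP] := hc _ e'0.
exists (Num.min r s); first by rewrite lt_min r0.
move=> w; rewrite lt_min => /andP[/rP w1 /sP w2].
have -> : f w * h w - f z * h z =
  (f w - f z) * (h w - h z) + f z * (h w - h z) + h z * (f w - f z) by ring.
have t1 := ler_normcD ((f w - f z) * (h w - h z) + f z * (h w - h z)) (h z * (f w - f z)).
have t2 := ler_normcD ((f w - f z) * (h w - h z)) (f z * (h w - h z)).
rewrite !normcM in t1 t2.
have h1 : e' <= 1 by rewrite ge_min lexx.
have h2 : e' * M <= e / 2.
  have : e' <= e / M / 2 by rewrite ge_min lexx orbT.
  rewrite -(ler_pM2r M0) => /le_trans; apply.
  by rewrite le_eqVlt; apply/orP; left; apply/eqP; field; rewrite gt_eqF.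
have n1 := normc_ge0 (f w - f z); have n2 := normc_ge0 (h w - h z).
have n3 := normc_ge0 (f z); have n4 := normc_ge0 (h z).
rewrite /M in h2.
have : normc (f w - f z) * normc (h w - h z) <= e' by nra.
have : normc (f z) * normc (h w - h z) <= normc (f z) * e' by nra.
have : normc (h z) * normc (f w - f z) <= normc (h z) * e' by nra.
nra.
Qed.

Lemma ccont_cst c z : ccont (fun=> c) z.
Proof. by apply: cdiff_cont; exact: cdiff_cst. Qed.

Lemma ccont_id z : ccont (fun w => w) z.
Proof. by apply: cdiff_cont; exact: cdiff_id. Qed.

End Cdiff.

(** * Weighted integrals over the circle *)

Section CircleFunctional.
Context {R : realType}.
Local Notation C := R[i].
Local Notation leb := (@lebesgue_measure R).
Variables (m : {measure set (measurableTypeR R) -> \bar R}) (phi : R -> R).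
Hypothesis phii : m.-integrable circ (EFin \o phi).
Implicit Types b : R -> C.

(** A single functional for all circle integrals: a measure with [phi] = 1, Lebesgue measure with
    [phi] = 1/(2 pi), or Lebesgue measure with a logarithmic weight. Kernel computations are thus
    made once. *)
Definition cI b : C := cintg m circ (fun t => b t * (phi t)%:C%C).

Lemma eq_cI b c : b =1 c -> cI b = cI c.
Proof. by move=> bc; apply: eq_cintg => t _; rewrite bc. Qed.

Lemma cID b c : rcont b -> rcont c -> cI (fun t => b t + c t) = cI b + cI c.
Proof.
move=> bc cc; rewrite /cI -(cintgD measurable_circ (cintegrable_contM bc phii)
  (cintegrable_contM cc phii)).
by apply: eq_cintg => t _; rewrite mulrDl.
Qed.

Lemma cIZ k b : rcont b -> cI (fun t => k * b t) = k * cI b.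
Proof.
move=> bc; rewrite /cI -(cintgZ measurable_circ _ (cintegrable_contM bc phii)).
by apply: eq_cintg => t _; rewrite mulrA.
Qed.

Lemma cIB b c : rcont b -> rcont c -> cI (fun t => b t - c t) = cI b - cI c.
Proof.
move=> bc cc; rewrite /cI -(cintgB measurable_circ (cintegrable_contM bc phii)
  (cintegrable_contM cc phii)).
by apply: eq_cintg => t _; rewrite mulrBl.
Qed.

Lemma cI_conj b : rcont b -> cI (fun t => conjc (b t)) = conjc (cI b).
Proof.
move=> bc; rewrite /cI -(cintg_conj measurable_circ (cintegrable_contM bc phii)).
by apply: eq_cintg => t _; rewrite rmorphM /= oppr0.
Qed.

Lemma cI_norm b (M : R) : rcont b -> (forall t, circ t -> normc (b t) <= M) ->
  normc (cI b) <= M * Rintegral m circ (fun t => `|phi t|).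
Proof.
move=> bc bM.
have absi : m.-integrable circ (EFin \o (fun t => `|phi t|)).
  by have := integrable_norm phii; apply: eq_integrable => //; exact: measurable_circ.
rewrite -(RintegralZl M measurable_circ absi).
apply: (normc_cintg measurable_circ (cintegrable_contM bc phii)
  (integrable_scale measurable_circ M absi)).
by move=> t ct; rewrite normcM normcR ler_wpM2r// bM.
Qed.

End CircleFunctional.

(** * Means over circles and their independence of the radius *)

Section CircleMean.
Context {R : realType}.
Local Notation C := R[i].
Local Notation leb := (@lebesgue_measure R).
Implicit Types (b : R -> C) (G : C -> C).

Lemma pi2_gt0 : 0 < pi *+ 2 :> R.
Proof. by rewrite mulrn_wgt0// pi_gt0. Qed.

Lemma integrable_circ_cst (c : R) : leb.-integrable circ (EFin \o (fun=> c)).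
Proof.
have H : leb.-integrable `[0, pi *+ 2]%classic (EFin \o (fun=> c)).
  apply: (@continuous_compact_integrable _ (fun=> c)); first exact: segment_compact.
  by apply: continuous_subspaceT => t; exact: cvg_cst.
apply: (integrableS _ _ _ H); [exact: measurable_itv|exact: measurable_itv|].
by apply: subset_itvl; rewrite bnd_simp.
Qed.

Definition cmean b : C := cI leb (fun=> (pi *+ 2)^-1) b.

Definition inv2pi_int := integrable_circ_cst ((pi *+ 2)^-1).

Lemma cintegrable_circ b : rcont b -> cintegrable leb circ b.
Proof.
move=> bc; have := cintegrable_contM bc (integrable_circ_cst 1).
by apply: (eq_cintegrable measurable_circ) => t _; rewrite mulr1.
Qed.

Lemma cmeanE b : rcont b -> cmean b = ((pi *+ 2)^-1)%:C%C * ci 0 (pi *+ 2) b.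
Proof.
move=> bc; have [b1 b2] := cintegrable_circ bc.
have -> : ci 0 (pi *+ 2) b = cintg leb circ b.
  by apply: complex_eq; rewrite /cintg /= Rintegral_itv_bndo_bndc.
rewrite -(cintgZ measurable_circ _ (cintegrable_circ bc)).
by apply: eq_cintg => t _; rewrite mulrC.
Qed.

Lemma Rintegral_inv2pi : Rintegral leb circ (fun=> (pi *+ 2)^-1) = 1.
Proof.
rewrite Rintegral_itv_bndo_bndc ?Rintegral_itv_cst ?(ltW pi2_gt0)//.
  by rewrite subr0 mulVf// gt_eqF// pi2_gt0.
exact: inv2pi_int.
Qed.

Lemma rcont_cst c : rcont (fun=> c : C).
Proof. by move=> t e e0; exists 1 => // s _; rewrite subrr normc0. Qed.

Lemma rcontD b c : rcont b -> rcont c -> rcont (fun t => b t + c t).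
Proof.
move=> bc cc; apply: rcont_ReIm => t.
  rewrite (_ : _ \o _ = fun t => complex.Re (b t) + complex.Re (c t)); last first.
    by apply/funext => s /=; rewrite ReD.
  by apply: cvgD; [exact: rcont_Re bc t|exact: rcont_Re cc t].
rewrite (_ : _ \o _ = fun t => complex.Im (b t) + complex.Im (c t)); last first.
  by apply/funext => s /=; rewrite ImD.
by apply: cvgD; [exact: rcont_Im bc t|exact: rcont_Im cc t].
Qed.

Lemma rcontM b c : rcont b -> rcont c -> rcont (fun t => b t * c t).
Proof.
move=> bc cc; have [rb ib rd id] : [/\ continuous (@complex.Re R \o b),
  continuous (@complex.Im R \o b), continuous (@complex.Re R \o c)
  & continuous (@complex.Im R \o c)].
  by split; [exact: rcont_Re|exact: rcont_Im|exact: rcont_Re|exact: rcont_Im].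
apply: rcont_ReIm => t.
  rewrite (_ : _ \o _ = fun t => complex.Re (b t) * complex.Re (c t)
    - complex.Im (b t) * complex.Im (c t)); last first.
    by apply/funext => s /=; rewrite ReM.
  by apply: cvgB; apply: cvgM; [exact: rb|exact: rd|exact: ib|exact: id].
rewrite (_ : _ \o _ = fun t => complex.Re (b t) * complex.Im (c t)
  + complex.Im (b t) * complex.Re (c t)); last first.
  by apply/funext => s /=; rewrite ImM.
by apply: cvgD; apply: cvgM; [exact: rb|exact: id|exact: ib|exact: rd].
Qed.

Lemma rcontB b c : rcont b -> rcont c -> rcont (fun t => b t - c t).
Proof.
move=> bc cc; rewrite (_ : (fun t => _) = fun t => b t + (-1) * c t); last first.
  by apply/funext => t; rewrite mulN1r.
by apply: rcontD => //; apply: rcontM => //; exact: rcont_cst.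
Qed.

Lemma rcont_conj b : rcont b -> rcont (fun t => conjc (b t)).
Proof.
move=> bc t e e0; have [r r0 rP] := bc t e e0; exists r => // s /rP.
by rewrite -rmorphB normc_conj.
Qed.

Lemma rcontV b : rcont b -> (forall t, b t != 0) -> rcont (fun t => (b t)^-1).
Proof.
move=> bc b0; apply: (rcont_comp bc) => t.
by apply: cdiff_cont; apply: cdiffV (b0 t) _; exact: cdiff_id.
Qed.

Lemma cmean1 : cmean (fun=> 1) = 1.
Proof.
apply: complex_eq; rewrite /cmean /cI /cintg /=.
  rewrite -[RHS]Rintegral_inv2pi; apply: eq_Rintegral => t _ /=.
  by rewrite mul1r mul0r subr0.
rewrite (_ : Rintegral _ _ _ = Rintegral leb circ (fun=> 0)).
  by rewrite Rintegral_cst ?mul0r//; exact: measurable_circ.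
by apply: eq_Rintegral => t _ /=; rewrite mulr0 mul0r addr0.
Qed.

Lemma cmeanB b c : rcont b -> rcont c -> cmean (fun t => b t - c t) = cmean b - cmean c.
Proof. by move=> bc cc; rewrite /cmean (cIB inv2pi_int bc cc). Qed.

Lemma cmeanZ k b : rcont b -> cmean (fun t => k * b t) = k * cmean b.
Proof. by move=> bc; rewrite /cmean (cIZ inv2pi_int _ bc). Qed.

Lemma cmean_conj b : rcont b -> cmean (fun t => conjc (b t)) = conjc (cmean b).
Proof. by move=> bc; rewrite /cmean (cI_conj inv2pi_int bc). Qed.

Lemma cmean_cst c : cmean (fun=> c) = c.
Proof.
rewrite -[RHS]mulr1 -cmean1 -(cmeanZ _ (@rcont_cst 1)).
by apply: eq_cI => t; rewrite mulr1.
Qed.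

Lemma cmean_norm b (M : R) : rcont b -> (forall t, circ t -> normc (b t) <= M) ->
  normc (cmean b) <= M.
Proof.
move=> bc bM; have := cI_norm inv2pi_int bc bM.
have -> : Rintegral leb circ (fun=> `|(pi *+ 2)^-1|) = 1.
  rewrite -[RHS]Rintegral_inv2pi; apply: eq_Rintegral => t _.
  by rewrite ger0_norm// invr_ge0 ltW// pi2_gt0.
by rewrite mulr1.
Qed.

Definition cpt (r t : R) : C := r%:C%C * eit t.

Lemma normc_cpt r t : normc (cpt r t) = `|r|.
Proof. by rewrite normcM normcR normc_eit mulr1. Qed.

Lemma rcont_cpt r : rcont (cpt r).
Proof.
move=> t; apply: (rcont_comp rcont_eit) => {}t.
by apply: ccontM; [exact: ccont_cst|exact: ccont_id].
Qed.

(** On the closed strip of height 2 pi the exponential identifies the two edges; on each closed half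
    it is injective. An exceptional point therefore has at most one logarithm in each of the two
    rectangles of [cmean_annulus]. *)
Lemma cexp_inj_lower (w w' : C) : 0 <= complex.Im w <= pi ->
  0 <= complex.Im w' <= pi -> cexp w = cexp w' -> w = w'.
Proof.
move=> w1 w2 E; have RE : complex.Re w = complex.Re w'.
  by apply: expR_inj; rewrite -!normc_cexp E.
apply: complex_eq => //.
have : eit (complex.Im w) = eit (complex.Im w').
  move: E; rewrite !cexpE RE => /mulfI; apply.
  by rewrite -normc_eq0 normcR normr_eq0 gt_eqF// expR_gt0.
by move=> [/cos_inj + _]; apply; rewrite in_itv.
Qed.

Lemma cexp_inj_upper (w w' : C) : pi <= complex.Im w <= pi *+ 2 ->
  pi <= complex.Im w' <= pi *+ 2 -> cexp w = cexp w' -> w = w'.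
Proof.
move=> w1 w2 E; have RE : complex.Re w = complex.Re w'.
  by apply: expR_inj; rewrite -!normc_cexp E.
apply: complex_eq => //.
have : eit (complex.Im w) = eit (complex.Im w').
  move: E; rewrite !cexpE RE => /mulfI; apply.
  by rewrite -normc_eq0 normcR normr_eq0 gt_eqF// expR_gt0.
have cosE (x : R) : cos (pi *+ 2 - x) = cos x.
  by rewrite addrC cosD2pi cosN.
move=> [+ _]; rewrite -cosE -(cosE (complex.Im w')) => /cos_inj H.
have : pi *+ 2 - complex.Im w = pi *+ 2 - complex.Im w'.
  by apply: H; rewrite in_itv /=; move: w1 w2; rewrite mulr2n; lra.
lra.
Qed.

(** Composition with the exponential turns the annulus into the rectangle [ln r1, ln r2] x
    [0, 2 pi]. Its horizontal sides cancel by periodicity and its vertical sides are the two means.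
    The mean of G is the contour integral of G(z) dz/(2 pi i z), so no factor has to be carried
    along. *)
Lemma cmean_annulus G z (r1 r2 : R) : 0 < r1 -> r1 <= r2 ->
  (forall x, r1 <= normc x <= r2 -> ccont G x) ->
  (forall x, r1 <= normc x <= r2 -> x != z -> cdiff G x) ->
  cmean (fun t => G (cpt r1 t)) = cmean (fun t => G (cpt r2 t)).
Proof.
move=> r10 r12 Gc Gd.
have r20 : 0 < r2 by exact: lt_le_trans r12.
have rc r : r1 <= r <= r2 -> rcont (fun t => G (cpt r t)).
  move=> /andP[ra rb]; apply: rcont_comp; first exact: rcont_cpt.
  by move=> t; apply: Gc; rewrite normc_cpt ger0_norm ?ra// (le_trans (ltW r10)).
pose f w := G (cexp w).
pose l1 := ln r1; pose l2 := ln r2.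
have l12 : l1 <= l2 by rewrite ler_ln// posrE.
have annu w : l1 <= complex.Re w <= l2 -> r1 <= normc (cexp w) <= r2.
  move=> /andP[h1 h2]; rewrite normc_cexp -[r1]lnK ?posrE// -[r2]lnK ?posrE//.
  by rewrite !ler_expR h1.
have fc y0 y1 w : inrect l1 l2 y0 y1 w -> ccont f w.
  move=> [/annu/Gc wc _]; apply: ccont_comp => //.
  by apply: cdiff_cont; exact: cdiff_exp.
have half y0 y1 : y0 <= y1 -> (forall w w' : C, y0 <= complex.Im w <= y1 ->
    y0 <= complex.Im w' <= y1 -> cexp w = cexp w' -> w = w') ->
    rint f l1 l2 y0 y1 = 0.
  move=> y01 inj.
  have [[p [pin pz]]|np] := pselect (exists p, inrect l1 l2 y0 y1 p /\ cexp p = z).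
    apply: (@goursat_except _ f _ _ _ _ p) => // [w|w win wp]; first exact: fc.
    apply: cdiff_comp; first exact: cdiff_exp.
    apply: Gd; first by case: win => /annu.
    by apply: contraNneq wp; rewrite -pz => /inj -> //; [case: win|case: pin].
  apply: goursat => // w win; apply: cdiff_comp; first exact: cdiff_exp.
  apply: Gd; first by case: win => /annu.
  by apply/eqP => wz; apply: np; exists w.
have pi0 : 0 <= pi :> R := pi_ge0 R.
have pi12 : pi <= pi *+ 2 :> R by rewrite mulr2n lerDl.
have J0 : rint f l1 l2 0 (pi *+ 2) = 0.
  rewrite (@rint_splity _ f l1 l2 0 (pi *+ 2) _ pi)//; last 2 first.
  - exact: fc.
  - by rewrite pi0.
  rewrite (half _ _ pi0 cexp_inj_lower) (half _ _ pi12 cexp_inj_upper).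
  by rewrite addr0.
have cE x t : cexp (pt x t) = cpt (expR x) t by [].
have : ci 0 (pi *+ 2) (fun t => G (cpt r2 t)) = ci 0 (pi *+ 2) (fun t => G (cpt r1 t)).
  move: J0; rewrite /rint.
  have -> : ci l1 l2 (fun x => f (pt x 0)) = ci l1 l2 (fun x => f (pt x (pi *+ 2))).
    by apply: eq_cintg => x _; rewrite /f !cE /cpt eit0 eit2pi.
  rewrite subrr add0r => /eqP; rewrite mulf_eq0 => /orP[|].
    by rewrite eq_complex /= oner_eq0 andbF.
  rewrite subr_eq0 => /eqP.
  have fE l r : 0 < r -> l = ln r -> (fun y => f (pt l y)) = (fun t => G (cpt r t)).
    by move=> r0 ->; apply/funext => t; rewrite /f cE lnK.
  by rewrite (fE l1 r1)// (fE l2 r2).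
move=> E; rewrite !cmeanE ?E//; apply: rc; by rewrite lexx ?andbT.
Qed.

(** The mean does not depend on the radius, and as the radius shrinks it tends to G(0) by
    continuity. *)
Lemma cmean_center G z (r : R) : 0 < r ->
  (forall x, normc x <= r -> ccont G x) ->
  (forall x, normc x <= r -> x != z -> cdiff G x) ->
  cmean (fun t => G (cpt r t)) = G 0.
Proof.
move=> r0 Gc Gd; apply/eqP; rewrite -subr_eq0 -normc_eq0.
apply/negPn/negP => D0.
set D := normc _ in D0; have {}D0 : 0 < D by rewrite lt_def D0 normc_ge0.
have D2 : 0 < D / 2 by rewrite divr_gt0.
have G0c : ccont G 0 by apply: Gc; rewrite normc0 ltW.
have [s s0 sP] := G0c _ D2.
pose q := Num.min (s / 2) r.
have q0 : 0 < q by rewrite lt_min r0 divr_gt0.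
have qs : q < s by apply: (@le_lt_trans _ _ (s / 2)); [rewrite ge_min lexx|lra].
have qr : q <= r by rewrite ge_min lexx orbT.
have E : cmean (fun t => G (cpt q t)) = cmean (fun t => G (cpt r t)).
  by apply: (@cmean_annulus G z) => // x /andP[_ xr]; [exact: Gc|exact: Gd].
have rq : rcont (fun t => G (cpt q t)).
  apply: rcont_comp; first exact: rcont_cpt.
  by move=> t; apply: Gc; rewrite normc_cpt gtr0_norm.
have : normc (cmean (fun t => G (cpt r t)) - G 0) <= D / 2; last by rewrite -/D; lra.
rewrite -E -[X in _ - X]cmean_cst -cmeanB//; last exact: rcont_cst.
apply: cmean_norm => [|t _].
  by apply: rcontB => //; exact: rcont_cst.
by apply: ltW; apply: sP; rewrite subr0 normc_cpt gtr0_norm.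
Qed.

End CircleMean.

(** * Cauchy's formula and its consequences *)

Section Cauchy.
Context {R : realType}.
Local Notation C := R[i].
Local Notation leb := (@lebesgue_measure R).
Implicit Types (G f h : C -> C) (z w p : C).

Lemma conjcM z w : conjc (z * w) = conjc z * conjc w.
Proof. exact: rmorphM. Qed.

Lemma conjcB z w : conjc (z - w) = conjc z - conjc w.
Proof. exact: rmorphB. Qed.

Lemma conjcD z w : conjc (z + w) = conjc z + conjc w.
Proof. exact: rmorphD. Qed.

Lemma conjcV z : conjc z^-1 = (conjc z)^-1.
Proof. exact: fmorphV. Qed.

Lemma cder_unique f z d d' : cder f z d -> cder f z d' -> d = d'.
Proof. by move=> /cderP[_ <-] /cderP[_ <-]. Qed.

Lemma circ_itv (t : R) : circ t -> 0 <= t <= pi *+ 2.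
Proof. by rewrite /circ /= in_itv /= => /andP[-> /ltW]. Qed.

Lemma rcont_bounded b : rcont b ->
  exists2 M : R, 0 < M & forall t : R, circ t -> normc (b t : C) <= M.
Proof.
move=> bc; have [M M0 MP] := continuous_bounded_itv 0 (pi *+ 2) (rcont_normc bc).
by exists M => // t /circ_itv /MP; rewrite ger0_norm ?normc_ge0.
Qed.

Lemma cpt_neq r t z : normc z < r -> cpt r t - z != 0.
Proof.
move=> zr; rewrite subr_eq0; apply: contraTneq zr => <-.
by rewrite normc_cpt -leNgt ler_norm.
Qed.

Lemma cpt_sub_ge r t z : r - normc z <= normc (cpt r t - z).
Proof.
by apply: le_trans (lerB_normc _ _); rewrite normc_cpt lerD2r ler_norm.
Qed.

Lemma rcont_cptB r z : rcont (fun t => cpt r t - z).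
Proof. by apply: rcontB; [exact: rcont_cpt|exact: rcont_cst]. Qed.

Lemma rcont_circ G r : (forall t, ccont G (cpt r t)) -> rcont (fun t => G (cpt r t)).
Proof. by move=> Gc; apply: rcont_comp => //; exact: rcont_cpt. Qed.

(** On |x| = r the conjugate of x/(x - z) equals 1/(1 - conj(z) x/r^2), which is analytic in |x| <=
    r with value 1 at the centre. *)
Lemma cmean_kernel r z : normc z < r -> cmean (fun t => cpt r t / (cpt r t - z)) = 1.
Proof.
move=> zr; have r0 : 0 < r := le_lt_trans (normc_ge0 z) zr.
have r0c : r%:C%C != 0 :> C by rewrite -normc_eq0 normcR normr_eq0 gt_eqF.
pose c := conjc z / (r%:C%C) ^+ 2.
have cz x : normc x <= r -> normc (c * x) < 1.
  move=> xr; rewrite /c normcM normcM normcV normc_conj normcX normcR gtr0_norm//.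
  rewrite mulrAC ltr_pdivrMr ?exprn_gt0// mul1r expr2.
  by rewrite (@le_lt_trans _ _ (normc z * r))// ?ler_wpM2l ?normc_ge0// ltr_pM2r.
have K0 x : normc x <= r -> 1 - c * x != 0.
  move=> /cz cx; rewrite subr_eq0; apply: contraTneq cx => <-.
  by rewrite normc1 ltxx.
have Kd x : normc x <= r -> cdiff (fun w => (1 - c * w)^-1) x.
  move=> xr; apply: (@cdiffV _ (fun w => 1 - c * w)); first exact: K0.
  apply: cdiffB; first exact: cdiff_cst.
  by apply: cdiffM; [exact: cdiff_cst|exact: cdiff_id].
have := @cmean_center R (fun w => (1 - c * w)^-1) 0 r r0
  (fun x xr => cdiff_cont (Kd x xr)) (fun x xr _ => Kd x xr).
rewrite mulr0 subr0 invr1 => /(congr1 (fun x => conjc x)); rewrite -cmean_conj; last first.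
  apply: (@rcont_circ (fun w => (1 - c * w)^-1)) => t; apply: cdiff_cont; apply: Kd.
  by rewrite normc_cpt gtr0_norm.
rewrite rmorph1 => <-; apply: eq_cI => t.
have := K0 (cpt r t); rewrite normc_cpt gtr0_norm// lexx => /(_ isT).
rewrite -conjc_eq0 conjcV; set k := conjc (1 - _).
have -> : k = 1 - z / r%:C%C / eit t.
  rewrite /k /c conjcB conjc1 !conjcM conjcV conjcK expr2 conjcM conjc_real.
  by rewrite conjc_unit ?normc_eit//; field; rewrite r0c eit_neq0.
have := cpt_neq t zr; rewrite /cpt => k0 k1.
by field; rewrite r0c eit_neq0 k0 /=.
Qed.

(** Differentiation under the integral by algebra: the first-order remainder of 1/(e - w) at z is
    exactly (w - z)^2/((e - w)(e - z)^2), and the distance [dl] bounds it. The curve [e] is left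
    arbitrary to cover both the unit circle and circles of radius r. *)
Lemma cder_cI (m : {measure set (measurableTypeR R) -> \bar R}) (phi : R -> R)
    (e b : R -> C) z (dl : R) :
  m.-integrable circ (EFin \o phi) -> rcont e -> rcont b -> 0 < dl ->
  (forall t, dl <= normc (e t - z)) ->
  cder (fun w => cI m phi (fun t => b t / (e t - w))) z
       (cI m phi (fun t => b t / (e t - z) ^+ 2)).
Proof.
move=> phii ec bc d0 ez eps eps0.
have [M M0 MP] := rcont_bounded bc.
have far w : normc (w - z) < dl / 2 -> forall t, dl / 2 <= normc (e t - w).
  move=> wz t; have := ez t; have := lerB_normc (e t - z) (w - z).
  by rewrite opprB addrA subrK; lra.
pose I := Rintegral m circ (fun t => `|phi t|).
have I0 : 0 <= I by exact: Rintegral_ge0.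
pose K := M * (dl / 2)^-1 * (dl ^+ 2)^-1 * I.
have d2 : 0 < dl / 2 by rewrite divr_gt0.
have K0 : 0 <= K.
  by rewrite /K !mulr_ge0// ?invr_ge0 ?sqr_ge0// ltW.
exists (Num.min (dl / 2) (eps / (K + 1))).
  by rewrite lt_min d2 divr_gt0// ltr_wpDl.
move=> w; rewrite lt_min => /andP[w1 w2].
have n0 t : e t - z != 0.
  by rewrite -normc_gt0 (lt_le_trans d0).
have nw t : e t - w != 0.
  by rewrite -normc_gt0 (lt_le_trans d2)// far.
have rz : rcont (fun t => e t - z) by apply: rcontB => //; exact: rcont_cst.
have rw : rcont (fun t => e t - w) by apply: rcontB => //; exact: rcont_cst.
have rz1 := rcontV rz n0. have rw1 := rcontV rw nw.
have r2 : rcont (fun t => b t / (e t - z) ^+ 2).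
  rewrite (_ : (fun t => _) = fun t => b t * ((e t - z)^-1 * (e t - z)^-1)); last first.
    by apply/funext => t; rewrite expr2 invfM.
  by apply: rcontM => //; exact: rcontM.
have r3 : rcont (fun t => b t * ((e t - w)^-1 * ((e t - z)^-1 * (e t - z)^-1))).
  by apply: rcontM => //; apply: rcontM => //; exact: rcontM.
rewrite -(cIB phii); [|exact: rcontM|exact: rcontM].
rewrite mulrC -(cIZ phii)// -(cIB phii); last 2 first.
- by apply: rcontB; exact: rcontM.
- by apply: rcontM => //; exact: rcont_cst.
rewrite (@eq_cI _ _ _ _ (fun t => (w - z) ^+ 2 *
    (b t * ((e t - w)^-1 * ((e t - z)^-1 * (e t - z)^-1))))); last first.
  by move=> t; field; rewrite n0 nw.
rewrite (cIZ phii)// normcM normcX.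
have B : normc (cI m phi (fun t => b t * ((e t - w)^-1 * ((e t - z)^-1 * (e t - z)^-1)))) <= K.
  apply: (cI_norm phii r3) => t ct; rewrite !normcM !normcV.
  have h1 : (normc (e t - z))^-1 <= dl^-1 by rewrite lef_pV2 ?posrE ?normc_gt0.
  have h2 : (normc (e t - w))^-1 <= (dl / 2)^-1.
    by rewrite lef_pV2 ?posrE ?normc_gt0//; exact: far.
  have n1 : 0 <= (normc (e t - z))^-1 by rewrite invr_ge0 normc_ge0.
  have n2 : 0 <= (normc (e t - w))^-1 by rewrite invr_ge0 normc_ge0.
  rewrite -mulrA expr2 [(dl * dl)^-1]invfM.
  apply: ler_pM; [exact: normc_ge0|by rewrite !mulr_ge0|exact: MP|].
  apply: ler_pM => //; first by rewrite mulr_ge0.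
  exact: ler_pM.
have wz0 := normc_ge0 (w - z).
rewrite expr2 -mulrA mulrC ler_wpM2r//.
move: w2; rewrite ltr_pdivlMr ?ltr_wpDl// => w2.
have := ler_wpM2l wz0 B.
nra.
Qed.

Lemma cdiff_cI (m : {measure set (measurableTypeR R) -> \bar R}) (phi : R -> R)
    (e b : R -> C) z (dl : R) :
  m.-integrable circ (EFin \o phi) -> rcont e -> rcont b -> 0 < dl ->
  (forall t, dl <= normc (e t - z)) ->
  cdiff (fun w => cI m phi (fun t => b t / (e t - w))) z.
Proof. by move=> a1 a2 a3 a4 a5; eexists; exact: (cder_cI a1 a2 a3 a4 a5). Qed.

Section formula.
Variables (G : C -> C) (r : R).
Hypothesis Gd : forall x, normc x <= r -> cdiff G x.

Lemma rcont_on_circle : 0 <= r -> rcont (fun t => G (cpt r t)).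
Proof.
move=> r0; apply: rcont_circ => t; apply: cdiff_cont; apply: Gd.
by rewrite normc_cpt ger0_norm.
Qed.

Lemma cauchy_formula z : normc z < r ->
  cmean (fun t => cpt r t * G (cpt r t) / (cpt r t - z)) = G z.
Proof.
move=> zr; have r0 : 0 < r := le_lt_trans (normc_ge0 z) zr.
have [d Gz] := Gd (ltW zr).
(* The factor w makes the value at the centre 0, so the mean of x (G(x) - G(z))/(x - z) vanishes;
   [cmean_kernel] then turns the term with G(z) into G(z) itself. *)
pose q w := w * dquot G z d w.
have qc x : normc x <= r -> ccont q x.
  move=> xr; apply: ccontM; first exact: ccont_id.
  have [->|xz] := eqVneq x z; first exact: dquot_cont.
  by apply: cdiff_cont; apply: dquot_diff => //; exact: Gd.
have qd x : normc x <= r -> x != z -> cdiff q x.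
  move=> xr xz; apply: cdiffM; first exact: cdiff_id.
  by apply: dquot_diff => //; exact: Gd.
have := cmean_center r0 qc qd; rewrite /q mul0r => E.
have r1 : rcont (fun t => (cpt r t - z)^-1).
  by apply: rcontV => [|t]; [exact: rcont_cptB|exact: cpt_neq].
have r2 : rcont (fun t => cpt r t / (cpt r t - z)).
  by apply: rcontM => //; exact: rcont_cpt.
have r3 : rcont (fun t => cpt r t * G (cpt r t) / (cpt r t - z)).
  apply: rcontM => //; apply: rcontM; first exact: rcont_cpt.
  exact/rcont_on_circle/ltW.
apply/eqP; rewrite -subr_eq0 -E -[X in _ - X]mulr1 -(cmean_kernel zr) -cmeanZ//.
rewrite -cmeanB//; last by apply: rcontM => //; exact: rcont_cst.
apply/eqP; apply: eq_cI => t; rewrite /dquot -subr_eq0 (negbTE (cpt_neq t zr)).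
by field; exact: cpt_neq.
Qed.

End formula.

Lemma cauchy_bound G r z (M : R) : (forall x, normc x <= r -> cdiff G x) ->
  normc z < r -> (forall t, circ t -> normc (G (cpt r t)) <= M) ->
  normc (G z) <= r * M / (r - normc z).
Proof.
move=> Gd zr GM; have r0 : 0 < r := le_lt_trans (normc_ge0 z) zr.
rewrite -(cauchy_formula Gd zr); apply: cmean_norm.
  apply: rcontM; first by apply: rcontM; [exact: rcont_cpt|exact: rcont_on_circle (ltW r0)].
  by apply: rcontV => [|t]; [exact: rcont_cptB|exact: cpt_neq].
move=> t ct; rewrite 2!normcM normcV normc_cpt gtr0_norm//.
have dz : 0 < r - normc z by rewrite subr_gt0.
apply: ler_pM.
- by rewrite mulr_ge0// ?normc_ge0// ltW.
- by rewrite invr_ge0 normc_ge0.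
- by rewrite ler_pM2l// GM.
- rewrite lef_pV2 ?posrE//; first exact: cpt_sub_ge.
  by rewrite normc_gt0 cpt_neq.
Qed.

(** Removable singularity: near p the quotient is the Cauchy integral of x f(x)/(x - p), which is
    differentiable in w at p too. The derivative of Cauchy's formula shows that the value there is
    the right one. *)
Lemma dquot_holo f (Rad : R) p d : (forall x, normc x < Rad -> cdiff f x) ->
  normc p < Rad -> cder f p d ->
  forall z, normc z < Rad -> cdiff (dquot f p d) z.
Proof.
move=> fd pR fp z zR; have [zp|zp] := eqVneq z p; last by apply: dquot_diff => //; exact: fd.
rewrite {}zp {z zR}.
have [r pr rR] : exists2 r, normc p < r & r < Rad.
  by exists ((normc p + Rad) / 2); lra.
have fdr x : normc x <= r -> cdiff f x by move=> xr; apply: fd; lra.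
have r0 : 0 < r := le_lt_trans (normc_ge0 p) pr.
pose dl := r - normc p; have dl0 : 0 < dl by rewrite /dl subr_gt0.
have ez t : dl <= normc (cpt r t - p) by exact: cpt_sub_ge.
have rf : rcont (fun t => cpt r t * f (cpt r t)).
  by apply: rcontM; [exact: rcont_cpt|exact: rcont_on_circle (ltW r0)].
have rp : rcont (fun t => (cpt r t - p)^-1).
  by apply: rcontV => [|t]; [exact: rcont_cptB|exact: cpt_neq].
have K : cdiff (fun w => cmean (fun t => (cpt r t * f (cpt r t) / (cpt r t - p)) / (cpt r t - w))) p.
  by apply: (cdiff_cI inv2pi_int (rcont_cpt r) _ dl0 ez); exact: rcontM.
apply: (cdiff_near dl0 _ K) => w wp.
have wr : normc w < r.
  by move: wp; have := lerB_normc w p; rewrite /dl; lra.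
have rw : rcont (fun t => (cpt r t - w)^-1).
  by apply: rcontV => [|t]; [exact: rcont_cptB|exact: cpt_neq].
rewrite /dquot; case: eqVneq => [->|wp'].
  have D := cder_cI inv2pi_int (rcont_cpt r) rf dl0 ez.
  have D' : cder f p (cmean (fun t => cpt r t * f (cpt r t) / (cpt r t - p) ^+ 2)).
    apply: (cder_near dl0 _ D) => x xp; apply: (cauchy_formula fdr).
    by move: xp; have := lerB_normc x p; rewrite /dl; lra.
  rewrite (cder_unique fp D'); apply: eq_cI => t.
  by rewrite expr2 invfM mulrA.
have wp0 : w - p != 0 by rewrite subr_eq0.
rewrite -(cauchy_formula fdr wr) -(cauchy_formula fdr pr) -cmeanB; [|exact: rcontM|exact: rcontM].
apply: (mulIf wp0); rewrite divfK// mulrC -cmeanZ; last by do !apply: rcontM => //.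
apply: eq_cI => t; field.
by rewrite !cpt_neq.
Qed.

(** Subtracting two Cauchy integrals produces the factor z - w. This is the regularity later used
    for boundary values. *)
Lemma holo_lipschitz G (r s : R) : 0 <= s -> s < r ->
  (forall x, normc x <= r -> cdiff G x) ->
  exists2 L : R, 0 < L & forall z w, normc z <= s -> normc w <= s ->
    normc (G z - G w) <= L * normc (z - w).
Proof.
move=> s0 sr Gd; have r0 : 0 < r := le_lt_trans s0 sr.
have rG := rcont_on_circle Gd (ltW r0).
have [M M0 MP] := rcont_bounded rG.
have rs0 : 0 < r - s by rewrite subr_gt0.
exists (r * M / (r - s) / (r - s)); first by rewrite !divr_gt0// mulr_gt0.
move=> z w zs ws.
have zr : normc z < r := le_lt_trans zs sr.
have wr : normc w < r := le_lt_trans ws sr.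
have rz : rcont (fun t => (cpt r t - z)^-1).
  by apply: rcontV => [|t]; [exact: rcont_cptB|exact: cpt_neq].
have rw : rcont (fun t => (cpt r t - w)^-1).
  by apply: rcontV => [|t]; [exact: rcont_cptB|exact: cpt_neq].
have rf : rcont (fun t => cpt r t * G (cpt r t)) by apply: rcontM => //; exact: rcont_cpt.
rewrite -(cauchy_formula Gd zr) -(cauchy_formula Gd wr) -cmeanB; [|exact: rcontM|exact: rcontM].
rewrite /cmean (@eq_cI _ _ _ _ (fun t => (z - w) *
  (cpt r t * G (cpt r t) * ((cpt r t - z)^-1 * (cpt r t - w)^-1)))); last first.
  by move=> t; field; rewrite !cpt_neq.
have rr : rcont (fun t => cpt r t * G (cpt r t) * ((cpt r t - z)^-1 * (cpt r t - w)^-1)).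
  by apply: rcontM => //; exact: rcontM.
rewrite -/(cmean _) cmeanZ// normcM mulrC ler_wpM2r ?normc_ge0//.
apply: cmean_norm => // t ct; rewrite normcM (normcM (cpt r t)) (normcM (_^-1)) !normcV normc_cpt gtr0_norm//.
have hz : (normc (cpt r t - z))^-1 <= (r - s)^-1.
  rewrite lef_pV2 ?posrE ?normc_gt0 ?cpt_neq//.
  by rewrite (le_trans _ (cpt_sub_ge _ _ _))// lerB.
have hw : (normc (cpt r t - w))^-1 <= (r - s)^-1.
  rewrite lef_pV2 ?posrE ?normc_gt0 ?cpt_neq//.
  by rewrite (le_trans _ (cpt_sub_ge _ _ _))// lerB.
rewrite -[X in _ <= X]mulrA; apply: ler_pM; rewrite ?mulr_ge0 ?invr_ge0 ?normc_ge0 ?(ltW r0)//.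
  by rewrite ler_pM2l// MP.
by apply: ler_pM; rewrite ?invr_ge0 ?normc_ge0.
Qed.

Lemma geometric_small (q B e : R) : 0 <= q -> q < 1 -> 0 < e ->
  exists k, B * q ^+ k < e.
Proof.
move=> q0 q1 e0; pose B' := `|B| + 1.
have B0 : 0 < B' by rewrite ltr_wpDl.
have /cvgrPdist_lt/(_ _ (divr_gt0 e0 B0)) : (q ^+ n @[n --> \oo] --> 0)%R.
  by apply: cvg_expr; rewrite ger0_norm.
move=> [k _ /(_ k (leqnn k))] /=; rewrite sub0r normrN ger0_norm ?exprn_ge0// => H.
exists k; move: H; rewrite ltr_pdivlMr// mulrC; apply: le_lt_trans.
by rewrite ler_wpM2r ?exprn_ge0// (le_trans (ler_norm _))// lerDl.
Qed.

(** If M bounds f on |x| = r, then M/r^k bounds f/x^k there, so [cauchy_bound] gives |f(z)| <= const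
    (|z|/r)^k for every k. *)
Lemma vanish_all_orders f (Rad : R) : (forall x, normc x < Rad -> cdiff f x) ->
  (forall k, exists h, (forall x, normc x < Rad -> cdiff h x) /\
    forall z, normc z < Rad -> f z = z ^+ k * h z) ->
  forall z, normc z < Rad -> f z = 0.
Proof.
move=> fd fk z zR; apply/eqP; rewrite -normc_eq0; apply/negPn/negP => f0.
have {}f0 : 0 < normc (f z) by rewrite lt_def f0 normc_ge0.
have [r zr rR] : exists2 r, normc z < r & r < Rad.
  by exists ((normc z + Rad) / 2); lra.
have r0 : 0 < r := le_lt_trans (normc_ge0 z) zr.
have fdr x : normc x <= r -> cdiff f x by move=> xr; apply: fd; lra.
have [M M0 MP] := rcont_bounded (rcont_on_circle fdr (ltW r0)).
pose q := normc z / r.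
have q0 : 0 <= q by rewrite divr_ge0 ?normc_ge0// ltW.
have q1 : q < 1 by rewrite ltr_pdivrMr// mul1r.
have [k kP] := geometric_small (r * M / (r - normc z)) q0 q1 f0.
have [h [hd hf]] := fk k.
have hdr x : normc x <= r -> cdiff h x by move=> xr; apply: hd; lra.
have hM t : circ t -> normc (h (cpt r t)) <= M / r ^+ k.
  move=> ct; rewrite ler_pdivlMr ?exprn_gt0//.
  have -> : normc (h (cpt r t)) * r ^+ k = normc (f (cpt r t)).
    by rewrite hf ?normc_cpt ?gtr0_norm// normcM normcX normc_cpt gtr0_norm// mulrC.
  exact: MP.
have := cauchy_bound hdr zr hM => hz.
move: kP; rewrite ltNge => /negP; apply.
rewrite hf// normcM normcX.
rewrite (le_trans (ler_wpM2l (exprn_ge0 k (normc_ge0 z)) hz))//.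
rewrite /q expr_div_n le_eqVlt; apply/orP; left; apply/eqP; field.
by rewrite expf_neq0 ?gt_eqF// subr_gt0.
Qed.

(** A direct substitute for the identity theorem: if f = (z - p)^k h with h analytic for every k,
    then h B^k has modulus |f| on |z| = r, and the mean value property at 0 gives |f(0)| <= M
    (|p|/r)^k, which contradicts f(0) != 0. *)
Lemma finite_order_zero f (Rad : R) p : (forall x, normc x < Rad -> cdiff f x) ->
  f 0 != 0 -> normc p < Rad ->
  exists k h, [/\ forall x, normc x < Rad -> cdiff h x, h p != 0
    & forall z, normc z < Rad -> f z = (z - p) ^+ k * h z].
Proof.
move=> fd f0 pR; apply: contrapT => H.
have fk k : exists h, (forall x, normc x < Rad -> cdiff h x) /\
    forall z, normc z < Rad -> f z = (z - p) ^+ k * h z.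
  elim: k => [|k [h [hd hf]]].
    by exists f; split => // z _; rewrite expr0 mul1r.
  have hp : h p = 0.
    by apply/eqP/negPn/negP => hp; apply: H; exists k, h.
  have [d dP] := hd p pR.
  exists (dquot h p d); split; first by move=> x xR; exact: dquot_holo xR.
  move=> z zR; rewrite hf// /dquot; case: eqVneq => [->|zp].
    by rewrite subrr exprS mul0r mul0r hp mulr0.
  by rewrite hp subr0 exprS; field; rewrite subr_eq0.
have [r pr rR] : exists2 r, normc p < r & r < Rad.
  by exists ((normc p + Rad) / 2); lra.
have r0 : 0 < r := le_lt_trans (normc_ge0 p) pr.
have fdr x : normc x <= r -> cdiff f x by move=> xr; apply: fd; lra.
have [M M0 MP] := rcont_bounded (rcont_on_circle fdr (ltW r0)).
pose q := normc p / r.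
have q0 : 0 <= q by rewrite divr_ge0 ?normc_ge0// ltW.
have q1 : q < 1 by rewrite ltr_pdivrMr// mul1r.
have f0' : 0 < normc (f 0) by rewrite normc_gt0.
have [k kP] := geometric_small M q0 q1 f0'.
have [h [hd hf]] := fk k.
have r0c : r%:C%C != 0 :> C by rewrite -normc_eq0 normcR normr_eq0 gt_eqF.
(* the Blaschke-type factor (r^2 - conj(p) z)/r has modulus |z - p| on |z| = r *)
pose B w := (r%:C%C ^+ 2 - conjc p * w) / r%:C%C.
have Bd x : cdiff B x.
  apply: cdiffM; last exact: cdiff_cst.
  apply: cdiffB; first exact: cdiff_cst.
  by apply: cdiffM; [exact: cdiff_cst|exact: cdiff_id].
have Bkd j x : cdiff (fun w => B w ^+ j) x.
  elim: j => [|j IH].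
    by rewrite (_ : (fun w => _) = fun=> 1); [exact: cdiff_cst|exact/funext].
  rewrite (_ : (fun w => _) = fun w => B w * B w ^+ j).
    exact: cdiffM.
  by apply/funext => w; rewrite exprS.
have Hd x : normc x <= r -> cdiff (fun w => h w * B w ^+ k) x.
  by move=> xr; apply: cdiffM => //; apply: hd; lra.
have := @cmean_center R _ 0 r r0 (fun x xr => cdiff_cont (Hd x xr)) (fun x xr _ => Hd x xr).
move=> /(congr1 (@normc R)) E.
have : normc (h 0 * B 0 ^+ k) <= M.
  rewrite -E; apply: cmean_norm.
    by apply: (rcont_on_circle (G := fun w => h w * B w ^+ k)) => //; exact: ltW.
  move=> t ct; rewrite normcM normcX.
  have -> : normc (B (cpt r t)) = normc (cpt r t - p).
    have -> : B (cpt r t) = conjc (cpt r t - p) * eit t.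
      have := mulc_conj (cpt r t); rewrite normc_cpt gtr0_norm// rmorphXn => rE.
      rewrite /B -rE conjcB {1 3}/cpt; field; exact: r0c.
    by rewrite normcM normc_conj normc_eit mulr1.
  rewrite -normcX -normcM mulrC -hf ?normc_cpt ?gtr0_norm//.
  exact: MP.
rewrite normcM normcX /B mulr0 subr0 expr2 mulfK// normcR gtr0_norm// => hM.
move: kP; rewrite ltNge => /negP; apply.
rewrite hf ?normc0 ?(lt_trans r0)// sub0r normcM normcX normcN.
rewrite /q expr_div_n mulrA ler_pdivlMr ?exprn_gt0// -mulrA [leRHS]mulrC.
by rewrite ler_wpM2l// exprn_ge0// normc_ge0.
Qed.

End Cauchy.

(** * Measures given by a density on the circle *)

Section DensityMeasures.
Context {R : realType}.
Local Notation leb := (@lebesgue_measure R).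
Local Notation T := (measurableTypeR R).

(** The same measure with its finiteness recorded in the type, as the Radon-Nikodym and Tonelli
    theorems demand. *)
Definition finmeas (m : {measure set T -> \bar R}) (mT : (m setT < +oo)%E) :
  {finite_measure set T -> \bar R} := mfrestr measurableT mT.

Lemma finmeasE (m : {measure set T -> \bar R}) (mT : (m setT < +oo)%E) A :
  finmeas mT A = m A.
Proof. by rewrite /finmeas /= /mfrestr /mrestr setIT. Qed.

Lemma finmeas_integral (m : {measure set T -> \bar R}) (mT : (m setT < +oo)%E)
    (D : set T) (f : T -> \bar R) :
  (\int[finmeas mT]_(x in D) f x = \int[m]_(x in D) f x)%E.
Proof. by apply: eq_measure_integral => A mA _; exact: finmeasE. Qed.

(* The side conditions are arguments, so that the measure structure of
   [mdens k0 mk] can be inferred from the term. *)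
Definition mdens (k : R -> R) (k0 : forall t, 0 <= k t)
    (mk : measurable_fun (circ : set T) k) (A : set T) : \bar R :=
  (\int[leb]_(t in A `&` circ) (k t)%:E)%E.

Section mdens.
Variables (k : R -> R) (k0 : forall t, 0 <= k t)
  (mk : measurable_fun (circ : set T) k).
Local Notation mdens := (mdens k0 mk).

Let mdens0 : mdens set0 = 0%E.
Proof. by rewrite /mdens set0I integral_set0. Qed.

Let mdens_ge0 A : (0 <= mdens A)%E.
Proof. by apply: integral_ge0 => t _; rewrite lee_fin. Qed.

Let mdens_sigma_additive : semi_sigma_additive mdens.
Proof.
move=> F mF tF mUF; rewrite /mdens setI_bigcupl.
rewrite ge0_integral_bigcup//=.
- apply: is_cvg_nneseries => n _ _; exact: mdens_ge0.
- by move=> n; apply: measurableI => //; exact: measurable_circ.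
- apply/measurable_EFinP; apply: measurable_funS mk; first exact: measurable_circ.
  by move=> t [n _ []].
- by move=> t _; rewrite lee_fin.
- exact: trivIset_setIr.
Qed.

HB.instance Definition _ := isMeasure.Build _ _ _ mdens
  mdens0 mdens_ge0 mdens_sigma_additive.

End mdens.

(** The Radon-Nikodym derivative and [k] have equal integrals over all measurable subsets of the
    circle, hence agree almost everywhere. *)
Lemma density_integral (m : {measure set T -> \bar R}) (k : R -> R)
    (f : R -> \bar R) : (m setT < +oo)%E -> (forall t, 0 <= k t) ->
  measurable_fun (circ : set T) k ->
  (forall A, measurable A -> m A = \int[leb]_(t in A `&` circ) (k t)%:E)%E ->
  m.-integrable circ f ->
  (\int[m]_(t in circ) f t = \int[leb]_(t in circ) (f t * (k t)%:E))%E.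
Proof.
move=> mT k0 mk mE /integrableP[mf intf].
have mc : measurable (circ : set T) := measurable_circ.
pose nu := finmeas mT.
have nuE A : nu A = m A := finmeasE mT A.
have dom : nu `<< leb.
  apply/null_content_dominatesP => A mA A0; rewrite nuE mE//.
  have mAc : measurable (A `&` circ : set T) by exact: measurableI.
  apply: null_set_integral => //.
    by apply/measurable_EFinP; apply: measurable_funS mk.
  by apply/eqP; rewrite eq_le measure_ge0 andbT -A0 le_measure ?inE.
rewrite -(finmeas_integral mT) -(Radon_Nikodym_change_of_variables dom mc); last first.
  by apply/integrableP; split => //; rewrite finmeas_integral.
have RN : leb.-integrable circ (Radon_Nikodym (charge_of_finite_measure nu) leb).
  by apply: (integrableS measurableT) => //; exact: Radon_Nikodym_integrable.
apply: ae_eq_integral => //.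
- by apply: emeasurable_funM => //; exact: measurable_int RN.
- by apply: emeasurable_funM => //; exact/measurable_EFinP.
- apply: ae_eqe_mul2l; apply: integral_ae_eq => //.
    exact/measurable_EFinP.
  move=> A AD mA; rewrite -Radon_Nikodym_integral//=.
  by rewrite [LHS]nuE mE// setIidl.
Qed.

End DensityMeasures.

(** * The Herglotz and Poisson kernels *)

Section Poisson.
Context {R : realType}.
Local Notation C := R[i].
Local Notation leb := (@lebesgue_measure R).
Implicit Types (k b : R -> R) (z : C).

Definition rmean k : R := Rintegral leb circ (fun t => k t * (pi *+ 2)^-1).

Lemma rmean_int k : continuous k ->
  leb.-integrable circ (EFin \o (fun t => k t * (pi *+ 2)^-1)).
Proof. by move=> kc; exact: (integrable_continuousM kc inv2pi_int). Qed.

Lemma Re_cmean (b : R -> C) : complex.Re (cmean b) = rmean (fun t => complex.Re (b t)).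
Proof.
rewrite /cmean /cI /cintg /=; apply: eq_Rintegral => t _ /=.
by rewrite ReM /= mulr0 subr0.
Qed.

Lemma rmeanD k b : continuous k -> continuous b ->
  rmean (fun t => k t + b t) = rmean k + rmean b.
Proof.
move=> kc bc; rewrite /rmean -(RintegralD measurable_circ (rmean_int kc) (rmean_int bc)).
by apply: eq_Rintegral => t _; rewrite mulrDl.
Qed.

Lemma rmeanZ c k : continuous k -> rmean (fun t => c * k t) = c * rmean k.
Proof.
move=> kc; rewrite /rmean -(RintegralZl c measurable_circ (rmean_int kc)).
by apply: eq_Rintegral => t _; rewrite mulrA.
Qed.

Lemma le_rmean k b : continuous k -> continuous b ->
  (forall t, circ t -> k t <= b t) -> rmean k <= rmean b.
Proof.
move=> kc bc kb; apply: (le_Rintegral measurable_circ (rmean_int kc) (rmean_int bc)).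
by move=> t /kb; rewrite ler_pM2r// invr_gt0 pi2_gt0.
Qed.

Lemma rmean_cst c : rmean (fun=> c) = c.
Proof.
rewrite /rmean (RintegralZl c measurable_circ inv2pi_int) Rintegral_inv2pi.
by rewrite mulr1.
Qed.

Lemma normr_rmean k : continuous k -> `|rmean k| <= rmean (fun t => `|k t|).
Proof.
move=> kc; have ac : continuous (fun t => `|k t|) by move=> t; exact: cvg_norm (kc t).
rewrite ler_norml; apply/andP; split.
  rewrite -mulN1r -rmeanZ//; apply: le_rmean => // [t|t _].
    by apply: cvgM; [exact: cvg_cst|exact: ac].
  by rewrite mulN1r lerNl -normrN ler_norm.
by apply: le_rmean => // t _; exact: ler_norm.
Qed.

Definition herg z (s : R) : C := (eit s + z) / (eit s - z).

Lemma eit_neq z s : normc z < 1 -> eit s - z != 0.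
Proof.
move=> z1; rewrite subr_eq0; apply: contraTneq z1 => <-.
by rewrite normc_eit ltxx.
Qed.

Lemma rcont_herg z : normc z < 1 -> rcont (herg z).
Proof.
move=> z1; apply: rcontM.
  by apply: rcontD; [exact: rcont_eit|exact: rcont_cst].
apply: rcontV => [|t]; last exact: eit_neq.
by apply: rcontB; [exact: rcont_eit|exact: rcont_cst].
Qed.

Lemma Re_herg z s : normc z < 1 ->
  complex.Re (herg z s) = (1 - normc z ^+ 2) / normc (eit s - z) ^+ 2.
Proof.
move=> z1; have e0 := eit_neq s z1.
have n0 : normc (eit s - z) ^+ 2 != 0 by rewrite expf_neq0// normc_eq0.
apply: (mulIf n0); rewrite divfK//.
have : herg z s * (normc (eit s - z) ^+ 2)%:C%C = (eit s + z) * conjc (eit s - z).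
  by rewrite -mulc_conj /herg mulrA divfK.
move=> /(congr1 (@complex.Re R)); rewrite ReM /= mulr0 subr0 => ->.
rewrite sqr_normcE ReM RconjE IconjE ReD ImD ReB ImB /=.
have := cos2Dsin2 s; rewrite !expr2; lra.
Qed.

(** Poisson kernel with evaluation point r e^(it) and boundary variable s; it depends on t - s only
    through the cosine, whence the symmetry used in [poisson_fubini]. *)
Definition pker (r t s : R) : R := complex.Re (herg (cpt r t) s).

Lemma normc_cpt_lt1 (r t : R) : 0 <= r -> r < 1 -> normc (cpt r t) < 1.
Proof. by move=> r0 r1; rewrite normc_cpt ger0_norm. Qed.

Lemma normc_eit_sub (r t s : R) :
  normc (eit s - cpt r t) ^+ 2 = 1 + r ^+ 2 - 2 * r * cos (t - s).
Proof.
rewrite sqr_normcE ReB ImB /cpt ReM ImM /= cosB.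
have := cos2Dsin2 s; have := cos2Dsin2 t; rewrite !expr2 => h1 h2.
have h3 : r * r * (cos t * cos t + sin t * sin t) = r * r by rewrite h1 mulr1.
lra.
Qed.

Lemma pkerE (r t s : R) : 0 <= r -> r < 1 ->
  pker r t s = (1 - r ^+ 2) / (1 + r ^+ 2 - 2 * r * cos (t - s)).
Proof.
move=> r0 r1; rewrite /pker Re_herg ?normc_cpt_lt1// normc_eit_sub normc_cpt.
by rewrite ger0_norm.
Qed.

Lemma pker_sym (r t s : R) : 0 <= r -> r < 1 -> pker r t s = pker r s t.
Proof. by move=> r0 r1; rewrite !pkerE// -[t - s]opprB cosN. Qed.

Lemma pker_gt0 (r t s : R) : 0 <= r -> r < 1 -> 0 < pker r t s.
Proof.
move=> r0 r1; rewrite /pker Re_herg ?normc_cpt_lt1// divr_gt0//.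
  by rewrite normc_cpt ger0_norm// subr_gt0 expr2; nra.
by rewrite exprn_gt0// normc_gt0 eit_neq// normc_cpt_lt1.
Qed.

Lemma continuous_pker (r t : R) : 0 <= r -> r < 1 -> continuous (pker r t).
Proof. by move=> r0 r1; apply: rcont_Re; apply: rcont_herg; exact: normc_cpt_lt1. Qed.

Lemma cmean_herg z : normc z < 1 -> cmean (herg z) = 1.
Proof.
move=> z1; have cE t : cpt 1 t = eit t by rewrite /cpt mul1r.
have rz : rcont (fun t => eit t - z).
  by apply: rcontB; [exact: rcont_eit|exact: rcont_cst].
have rk : rcont (fun t => eit t / (eit t - z)).
  apply: rcontM; first exact: rcont_eit.
  by apply: rcontV => [//|t]; exact: eit_neq.
transitivity (cmean (fun t => 2 * (eit t / (eit t - z)) - 1)).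
  by apply: eq_cI => t; rewrite /herg; field; exact: eit_neq.
rewrite cmeanB; [|by apply: rcontM => //; exact: rcont_cst|exact: rcont_cst].
rewrite cmean1 cmeanZ// (_ : cmean _ = 1); first by ring.
by rewrite -[RHS](cmean_kernel z1); apply: eq_cI => t; rewrite cE.
Qed.

Lemma rmean_pker (r t : R) : 0 <= r -> r < 1 -> rmean (pker r t) = 1.
Proof.
by move=> r0 r1; rewrite -[RHS]/(complex.Re 1) -(@cmean_herg (cpt r t)) ?normc_cpt_lt1// Re_cmean.
Qed.

Lemma continuous_normc_sub z : continuous (fun s : R => normc (eit s - z) ^+ 2).
Proof.
move=> s; rewrite (_ : (fun s : R => _) = fun s : R => normc (eit s - z) * normc (eit s - z)).
  by apply: cvgM; apply: rcont_normc; apply: rcontB;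
    (exact: rcont_eit || exact: rcont_cst).
by apply/funext => u; rewrite expr2.
Qed.

(** A quadratic modulus of continuity suits the kernel: [pker r t s] times |e^(is) - r e^(it)|^2 is
    exactly 1 - r^2, so the error is obtained without separating near and far points. The 6 collects
    2 (1 - r)^2 + 2 (1 - r^2) <= 6 (1 - r). *)
Lemma poisson_approx b (eps K r t : R) : continuous b -> 0 <= r -> r < 1 ->
  0 <= K -> (forall s, `|b s - b t| <= eps + K * normc (eit s - eit t) ^+ 2) ->
  `|rmean (fun s => pker r t s * b s) - b t| <= eps + 6 * K * (1 - r).
Proof.
move=> bc r0 r1 K0 bK; have pc := @continuous_pker r t r0 r1.
have nc := @continuous_normc_sub (cpt r t).
have pb : continuous (fun s => pker r t s * b s).
  by move=> s; apply: cvgM; [exact: pc|exact: bc].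
have pm : continuous (fun s => pker r t s * (b s - b t)).
  move=> s; apply: cvgM; first exact: pc.
  by apply: cvgB; [exact: bc|exact: cvg_cst].
have -> : rmean (fun s => pker r t s * b s) - b t =
    rmean (fun s => pker r t s * (b s - b t)).
  rewrite -[X in _ - X]mulr1 -(rmean_pker t r0 r1) -mulNr -rmeanZ// -rmeanD//; last first.
    by move=> s; apply: cvgM; [exact: cvg_cst|exact: pc].
  by congr rmean; apply/funext => s; ring.
apply: le_trans (normr_rmean pm) _.
(* From |e^(is) - e^(it)|^2 <= 2 |e^(is) - r e^(it)|^2 + 2 (1 - r)^2: the last term and [eps] stay
   multiplied by the kernel, and the first becomes the constant [d]. *)
pose c := eps + 2 * K * (1 - r) ^+ 2.
pose d := 2 * K * (1 - r ^+ 2).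
have dc : continuous (fun s => c * pker r t s).
  by move=> s; apply: cvgM; [exact: cvg_cst|exact: pc].
have : rmean (fun s => `|pker r t s * (b s - b t)|) <=
    rmean (fun s => c * pker r t s + d).
  apply: le_rmean => [s|s|s _].
  - by apply: cvg_norm; exact: pm.
  - by apply: cvgD; [exact: dc|exact: cvg_cst].
  - have p0 := @pker_gt0 r t s r0 r1.
    rewrite normrM (gtr0_norm p0).
    have n0 : normc (eit s - cpt r t) ^+ 2 != 0.
      by rewrite expf_neq0// normc_eq0 eit_neq// normc_cpt_lt1.
    have pn : pker r t s * normc (eit s - cpt r t) ^+ 2 = 1 - r ^+ 2.
      by rewrite /pker Re_herg ?normc_cpt_lt1// divfK// normc_cpt ger0_norm.
    have nn : normc (eit s - eit t) <= normc (eit s - cpt r t) + (1 - r).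
      have -> : eit s - eit t = (eit s - cpt r t) - (1 - r)%:C%C * eit t.
        by rewrite /cpt rmorphB /= ; ring.
      rewrite (le_trans (ler_normcB _ _))// normcM normcR normc_eit mulr1.
      by rewrite ger0_norm// subr_ge0 ltW.
    have a0 := normc_ge0 (eit s - eit t); have a1 := normc_ge0 (eit s - cpt r t).
    have n2 : normc (eit s - eit t) ^+ 2 <=
        2 * normc (eit s - cpt r t) ^+ 2 + 2 * (1 - r) ^+ 2.
      rewrite (@le_trans _ _ ((normc (eit s - cpt r t) + (1 - r)) ^+ 2))//.
        by rewrite ler_pXn2r ?nnegrE// addr_ge0// subr_ge0 ltW.
      have := sqr_ge0 (normc (eit s - cpt r t) - (1 - r)); rewrite !expr2; lra.
    have B := le_trans (bK s) (lerD (lexx eps) (ler_wpM2l K0 n2)).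
    apply: le_trans (ler_wpM2l (ltW p0) B) _.
    rewrite /c /d -pn; rewrite le_eqVlt; apply/orP; left; apply/eqP; ring.
move/le_trans; apply.
rewrite rmeanD//; last by move=> s; exact: cvg_cst.
rewrite rmeanZ// rmean_pker// rmean_cst /c /d mulr1.
have h : 0 <= 1 - r by rewrite subr_ge0 ltW.
have e1 : (1 - r) ^+ 2 <= 1 - r by rewrite expr2; nra.
have e2 : 1 - r ^+ 2 <= 2 * (1 - r) by rewrite expr2; nra.
nra.
Qed.

End Poisson.

(** * Herglotz and Poisson integrals of measures *)

Section HerglotzTransforms.
Context {R : realType}.
Local Notation C := R[i].
Local Notation leb := (@lebesgue_measure R).
Local Notation T := (measurableTypeR R).

Lemma cdiff_cI_herg (m : {measure set T -> \bar R}) (phi : R -> R) z :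
  m.-integrable circ (EFin \o phi) -> normc z < 1 ->
  cdiff (fun w => cI m phi (herg w)) z.
Proof.
move=> phii z1; pose dl := 1 - normc z.
have dl0 : 0 < dl by rewrite subr_gt0.
have ez t : dl <= normc (eit t - z).
  by apply: le_trans (lerB_normc _ _); rewrite normc_eit.
have D := cdiff_cI phii (@rcont_eit R) (@rcont_eit R) dl0 ez.
apply: (@cdiff_near _ (fun w => 2 * cI m phi (fun t => eit t / (eit t - w)) -
  cI m phi (fun=> 1)) _ _ _ dl0); last first.
  apply: cdiffB; last exact: cdiff_cst.
  by apply: cdiffM => //; exact: cdiff_cst.
move=> w wz; have w1 : normc w < 1.
  by move: wz; have := lerB_normc w z; rewrite /dl; lra.
have rw : rcont (fun t => eit t / (eit t - w)).
  apply: rcontM; first exact: rcont_eit.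
  apply: rcontV => [|t]; last exact: eit_neq.
  by apply: rcontB; [exact: rcont_eit|exact: rcont_cst].
rewrite -(cIZ phii)// -(cIB phii); last 2 first.
- by apply: rcontM => //; exact: rcont_cst.
- exact: rcont_cst.
by apply: eq_cI => t; rewrite /herg; field; exact: eit_neq.
Qed.

Lemma Re_cI (m : {measure set T -> \bar R}) (phi : R -> R) (b : R -> C) :
  complex.Re (cI m phi b) = Rintegral m circ (fun t => complex.Re (b t) * phi t).
Proof.
by rewrite /cI /cintg /=; apply: eq_Rintegral => t _ /=; rewrite ReM /= mulr0 subr0.
Qed.

Lemma integrable_cst_fin (m : {measure set T -> \bar R}) (c : R) :
  (m setT < +oo)%E -> m.-integrable circ (EFin \o (fun=> c)).
Proof.
move=> mT; apply/integrableP; split; first exact/measurable_EFinP.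
rewrite /comp /= integral_cst ?lte_mul_pinfty//; last exact: measurable_circ.
by apply: le_lt_trans mT; rewrite le_measure ?inE//; exact: measurable_circ.
Qed.

Definition pois (m : {measure set T -> \bar R}) (z : C) : R :=
  Rintegral m circ (fun s => complex.Re (herg z s)).

Lemma poisE (m : {measure set T -> \bar R}) z : pois m z = complex.Re (cI m (fun=> 1) (herg z)).
Proof. by rewrite Re_cI; apply: eq_Rintegral => s _; rewrite mulr1. Qed.

Lemma continuous_Re_circle (f : C -> C) (r : R) : 0 <= r -> r < 1 ->
  (forall z, normc z < 1 -> cdiff f z) ->
  continuous (fun t => complex.Re (f (cpt r t))).
Proof.
move=> r0 r1 fd; apply: rcont_Re; apply: rcont_circ => t.
by apply: cdiff_cont; apply: fd; exact: normc_cpt_lt1.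
Qed.

Lemma continuous_pois (m : {measure set T -> \bar R}) (r : R) : (m setT < +oo)%E -> 0 <= r -> r < 1 ->
  continuous (fun t => pois m (cpt r t)).
Proof.
move=> mT r0 r1; rewrite (_ : (fun t => _) = fun t =>
  complex.Re (cI m (fun=> 1) (herg (cpt r t)))); last first.
  by apply/funext => t; exact: poisE.
apply: (@continuous_Re_circle (fun z => cI m (fun=> 1) (herg z)) r r0 r1) => z z1.
by apply: cdiff_cI_herg => //; exact: integrable_cst_fin.
Qed.

Lemma continuous_rmean_pker (b : R -> R) (r : R) : continuous b -> 0 <= r -> r < 1 ->
  continuous (fun s => rmean (fun t => pker r s t * b t)).
Proof.
move=> bc r0 r1.
rewrite (_ : (fun s => _) = fun s => complex.Re (cI leb (fun t => b t * (pi *+ 2)^-1)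
  (herg (cpt r s)))); last first.
  by apply/funext => s; rewrite Re_cI; apply: eq_Rintegral => t _; rewrite mulrA.
apply: (@continuous_Re_circle (fun z => cI leb (fun t => b t * (pi *+ 2)^-1)
  (herg z)) r r0 r1) => z z1.
by apply: cdiff_cI_herg => //; exact: rmean_int.
Qed.

Lemma integrable_cont_fin (m : {measure set T -> \bar R}) (b : R -> R) :
  (m setT < +oo)%E -> continuous b -> m.-integrable circ (EFin \o b).
Proof.
move=> mT bc; have := integrable_continuousM bc (integrable_cst_fin 1 mT).
by apply: eq_integrable => [|t _ /=]; [exact: measurable_circ|rewrite mulr1].
Qed.

Lemma Rintegral_EFin (m : {measure set T -> \bar R}) (b : R -> R) :
  m.-integrable circ (EFin \o b) ->
  ((Rintegral m circ b)%:E = \int[m]_(t in circ) (b t)%:E)%E.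
Proof. by move=> bi; rewrite fineK//; exact: (integrable_fin_num measurable_circ bi). Qed.

Lemma measurable_pker2 (r : R) : 0 <= r -> r < 1 ->
  measurable_fun [set: T * T] (fun x => pker r x.1 x.2).
Proof.
move=> r0 r1.
have p0 (t s : R) : 0 < 1 + r ^+ 2 - 2 * r * cos (t - s).
  by rewrite -normc_eit_sub exprn_gt0// normc_gt0 eit_neq// normc_cpt_lt1.
(* The reciprocal of the positive denominator is written as exp(-ln), so that joint measurability
   follows by composition. *)
rewrite (_ : (fun x => _) = fun x : T * T => (1 - r ^+ 2) *
    expR (- ln (1 + r ^+ 2 - 2 * r * cos (x.1 - x.2)))); last first.
  by apply/funext => x; rewrite pkerE// expRN lnK// posrE p0.
apply: measurable_funM => //; apply: measurableT_comp; first exact: measurable_expR.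
apply: measurableT_comp => //; apply: measurableT_comp; first exact: measurable_ln.
apply: measurable_funB => //; apply: measurable_funM => //.
apply: (measurableT_comp (f := @cos R)).
  by apply: continuous_measurable_fun; have := @continuous_cos R.
by apply: measurable_funB; [exact: measurable_fst|exact: measurable_snd].
Qed.

(** Tonelli together with the symmetry of the kernel moves the Poisson smoothing from the measure
    onto the test function. *)
Lemma poisson_fubini (m : {measure set T -> \bar R}) (b : R -> R) (r : R) :
  (m setT < +oo)%E -> continuous b -> (forall t, 0 <= b t) -> 0 <= r -> r < 1 ->
  rmean (fun t => b t * pois m (cpt r t)) =
  Rintegral m circ (fun s => rmean (fun t => pker r s t * b t)).
Proof.
move=> mT bc b0 r0 r1.
set c : R := (pi *+ 2)^-1.
have c0 : 0 <= c by rewrite invr_ge0 ltW// pi2_gt0.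
(* The indicators extend the integrand by zero, since Tonelli's theorem is applied on the whole
   plane. *)
pose f (x : T * T) : \bar R :=
  ((pker r x.1 x.2 * (b x.1 * c)) * (\1_circ x.1 * \1_circ x.2))%:E.
have mI : measurable_fun setT (\1_circ : T -> R).
  by apply: measurable_indic; exact: measurable_circ.
have mf : measurable_fun setT f.
  apply/measurable_EFinP; apply: measurable_funM.
    apply: measurable_funM; first exact: measurable_pker2.
    apply: measurable_funM => //.
    apply: (measurableT_comp (f := b)); last exact: measurable_fst.
    exact: continuous_measurable_fun.
  apply: measurable_funM.
    exact: (measurableT_comp mI measurable_fst).
  exact: (measurableT_comp mI measurable_snd).
have f0 x : (0 <= f x)%E.
  rewrite lee_fin !mulr_ge0//; first exact/ltW/pker_gt0.
have := @fubini_tonelli _ _ _ _ _ leb (finmeas mT) f mf f0.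
have restrE (u : R -> R) (mm : {measure set T -> \bar R}) :
    (\int[mm]_t (u t * \1_circ t)%:E = \int[mm]_(t in circ) (u t)%:E)%E.
  rewrite [RHS]integral_mkcond; apply: eq_integral => t _.
  by rewrite patchE indicE; case: ifP => _; rewrite ?mulr1 ?mulr0.
have pcon t : continuous (pker r t) by exact: continuous_pker.
have H1 : (\int[leb]_t \int[finmeas mT]_s f (t, s) =
    (rmean (fun t => b t * pois m (cpt r t)))%:E)%E.
  rewrite Rintegral_EFin; last first.
    apply: rmean_int => t; apply: cvgM; first exact: bc.
    exact: continuous_pois.
  rewrite -restrE; apply: eq_integral => t _.
  transitivity (\int[m]_s ((b t * c * \1_circ t * pker r t s) * \1_circ s)%:E)%E.
    rewrite finmeas_integral; apply: eq_integral => s _; rewrite /f /=.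
    by congr EFin; ring.
  rewrite restrE -Rintegral_EFin; last first.
    by apply: integrable_cont_fin => // s; apply: cvgM; [exact: cvg_cst|exact: pcon].
  congr EFin; rewrite (RintegralZl _ measurable_circ); last exact: integrable_cont_fin.
  by rewrite -[Rintegral _ _ _]/(pois m (cpt r t)) -/c; ring.
have H2 : (\int[finmeas mT]_s \int[leb]_t f (t, s) =
    (Rintegral m circ (fun s => rmean (fun t => pker r s t * b t)))%:E)%E.
  rewrite Rintegral_EFin; last first.
    by apply: integrable_cont_fin => //; exact: continuous_rmean_pker.
  rewrite finmeas_integral -restrE; apply: eq_integral => s _.
  transitivity (\int[leb]_t ((\1_circ s * (pker r s t * b t * c)) * \1_circ t)%:E)%E.
    apply: eq_integral => t _; rewrite /f /= (@pker_sym _ r s t)//.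
    by congr EFin; ring.
  have bi : leb.-integrable circ (EFin \o (fun t => pker r s t * b t * c)).
    by apply: rmean_int => t; apply: cvgM; [exact: pcon|exact: bc].
  rewrite restrE -Rintegral_EFin; last exact: (integrable_scale measurable_circ).
  by congr EFin; rewrite (RintegralZl _ measurable_circ)// mulrC.
by rewrite H1 H2 => -[].
Qed.

End HerglotzTransforms.

(** * Poisson integrals determine the measure *)

Section Uniqueness.
Context {R : realType}.
Local Notation C := R[i].
Local Notation leb := (@lebesgue_measure R).
Local Notation T := (measurableTypeR R).

(** The modulus of continuity required by [poisson_approx]. It is measured by the chord |e^(is) -
    e^(it)|, so it contains periodicity, and a Lipschitz bound L x yields it through L x <= eps +
    (L^2/eps) x^2. *)
Definition nearly_lipschitz (b : R -> R) := forall eps : R, 0 < eps ->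
  exists2 K : R, 0 <= K &
  forall t s : R, `|b s - b t| <= eps + K * normc (eit s - eit t) ^+ 2.

Lemma lipschitz_nearly (b : R -> R) (L : R) : 0 <= L ->
  (forall t s, `|b s - b t| <= L * normc (eit s - eit t)) -> nearly_lipschitz b.
Proof.
move=> L0 bL eps eps0; exists (L ^+ 2 / eps); first by rewrite divr_ge0 ?sqr_ge0// ltW.
move=> t s; apply: le_trans (bL t s) _.
set x := normc _; have x0 : 0 <= x by exact: normc_ge0.
rewrite -(ler_pM2r eps0) mulrDl.
have -> : L ^+ 2 / eps * x ^+ 2 * eps = (L * x) ^+ 2 by field; rewrite gt_eqF.
have := sqr_ge0 (L * x - eps); rewrite !expr2; have : 0 <= L * x by rewrite mulr_ge0.
nra.
Qed.

Section two_measures.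
Variables (m1 m2 : {measure set T -> \bar R}).
Hypotheses (fin1 : (m1 setT < +oo)%E) (fin2 : (m2 setT < +oo)%E).
Hypothesis same_pois : forall e : R, 0 < e -> exists2 r0 : R, r0 < 1 &
  forall r t, 0 <= r -> r0 < r -> r < 1 ->
    `|pois m1 (cpt r t) - pois m2 (cpt r t)| <= e.

Lemma poisson_approx_int (m : {measure set T -> \bar R}) (b : R -> R) (eps K r : R) :
  (m setT < +oo)%E -> continuous b -> 0 <= r -> r < 1 -> 0 <= K ->
  (forall t s, `|b s - b t| <= eps + K * normc (eit s - eit t) ^+ 2) ->
  `|Rintegral m circ (fun s => rmean (fun t => pker r s t * b t)) - Rintegral m circ b|
    <= (eps + 6 * K * (1 - r)) * fine (m circ).
Proof.
move=> mT bc r0 r1 K0 bK.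
have qc := continuous_rmean_pker bc r0 r1.
rewrite -(RintegralB measurable_circ); [|exact: integrable_cont_fin..].
have dc : continuous (fun s => rmean (fun t => pker r s t * b t) - b s).
  by move=> s; apply: cvgB; [exact: qc|exact: bc].
have adc : continuous (fun s => `|rmean (fun t => pker r s t * b t) - b s|).
  by move=> s; apply: cvg_norm; exact: dc.
apply: le_trans (le_normr_Rintegral measurable_circ (integrable_cont_fin mT dc)) _.
rewrite -Rintegral_cst; last exact: measurable_circ.
apply: (le_Rintegral measurable_circ (integrable_cont_fin mT adc)
  (integrable_cst_fin _ mT)) => s _.
by apply: poisson_approx => // s'; exact: bK.
Qed.

(** Replacing each integral of b by the mean of b against the Poisson integral of the measure costs
    at most D/4, and the closeness of the two Poisson integrals costs D/8; the total 5D/8 is below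
    the assumed gap D. *)
Lemma same_integrals (b : R -> R) : continuous b -> (forall t, 0 <= b t) ->
  (forall t, b t <= 1) -> nearly_lipschitz b ->
  Rintegral m1 circ b = Rintegral m2 circ b.
Proof.
move=> bc b0 b1 bL; apply/eqP; rewrite -subr_eq0 -normr_eq0.
apply/negPn/negP => D0; set D := `|_| in D0.
have {}D0 : 0 < D by rewrite lt_def D0 normr_ge0.
pose M := fine (m1 circ) + fine (m2 circ) + 1.
have f1 : 0 <= fine (m1 circ) by exact: fine_ge0.
have f2 : 0 <= fine (m2 circ) by exact: fine_ge0.
have M1 : 0 < M by rewrite ltr_wpDl// addr_ge0.
have eps0 : 0 < D / 8 / M by rewrite !divr_gt0.
have [K K0 bK] := bL _ eps0.
have D8 : 0 < D / 8 by rewrite divr_gt0.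
have [r0 r01 rP] := same_pois D8.
pose d := D / 8 / M / (6 * K + 1).
have K1 : 0 < 6 * K + 1 by lra.
have d0 : 0 < d by rewrite divr_gt0.
pose r := Num.max (Num.max 0 ((1 + r0) / 2)) (1 - d).
have r1 : r < 1 by rewrite !gt_max ltr01 /=; apply/andP; split; lra.
have rge0 : 0 <= r by rewrite !le_max lexx.
have rgt : r0 < r.
  by rewrite (@lt_le_trans _ _ ((1 + r0) / 2))//; [lra|rewrite !le_max lexx orbT].
have rd : 1 - r <= d.
  have : 1 - d <= r by rewrite le_max lexx orbT.
  lra.
have small : D / 8 / M + 6 * K * (1 - r) <= D / 4 / M.
  have : 6 * K * (1 - r) <= (6 * K + 1) * d by nra.
  rewrite /d [_ * (_ / _)]mulrC divfK ?gt_eqF//.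
  have -> : D / 4 / M = D / 8 / M + D / 8 / M by field; rewrite gt_eqF.
  lra.
have A1 := poisson_approx_int fin1 bc rge0 r1 K0 bK.
have A2 := poisson_approx_int fin2 bc rge0 r1 K0 bK.
rewrite -(poisson_fubini fin1)// in A1; rewrite -(poisson_fubini fin2)// in A2.
have pc1 := continuous_pois fin1 rge0 r1; have pc2 := continuous_pois fin2 rge0 r1.
have A3 : `|rmean (fun t => b t * pois m1 (cpt r t)) -
    rmean (fun t => b t * pois m2 (cpt r t))| <= D / 8.
  have c1 : continuous (fun t => b t * pois m1 (cpt r t)).
    by move=> t; apply: cvgM; [exact: bc|exact: pc1].
  have c2 : continuous (fun t => b t * pois m2 (cpt r t)).
    by move=> t; apply: cvgM; [exact: bc|exact: pc2].
  have c3 : continuous (fun t => -1 * (b t * pois m2 (cpt r t))).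
    by move=> t; apply: cvgM; [exact: cvg_cst|exact: c2].
  rewrite -mulN1r -rmeanZ// -rmeanD//.
  have c4 : continuous (fun t => b t * pois m1 (cpt r t) + -1 * (b t * pois m2 (cpt r t))).
    by move=> t; apply: cvgD; [exact: c1|exact: c3].
  apply: le_trans (normr_rmean c4) _; rewrite -[leRHS]rmean_cst.
  apply: le_rmean => [t|t|t _]; [by apply: cvg_norm; exact: c4|exact: cvg_cst|].
  have -> : b t * pois m1 (cpt r t) + -1 * (b t * pois m2 (cpt r t)) =
    b t * (pois m1 (cpt r t) - pois m2 (cpt r t)) by ring.
  rewrite normrM (ger0_norm (b0 t)).
  have := rP r t rge0 rgt r1; have := normr_ge0 (pois m1 (cpt r t) - pois m2 (cpt r t)).
  by have := b0 t; have := b1 t; nra.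
have B1 : (D / 8 / M + 6 * K * (1 - r)) * fine (m1 circ) <= D / 4.
  apply: le_trans (ler_wpM2r f1 small) _.
  rewrite mulrAC ler_pdivrMr// ler_pM2l ?divr_gt0//; rewrite /M; lra.
have B2 : (D / 8 / M + 6 * K * (1 - r)) * fine (m2 circ) <= D / 4.
  apply: le_trans (ler_wpM2r f2 small) _.
  rewrite mulrAC ler_pdivrMr// ler_pM2l ?divr_gt0//; rewrite /M; lra.
move: A1 A2 A3 B1 B2 D0; rewrite /D.
set x1 := Rintegral m1 _ b; set x2 := Rintegral m2 _ b.
set y1 := rmean _; set y2 := rmean _ => A1 A2 A3 B1 B2.
have : `|x1 - x2| <= `|y1 - x1| + `|y1 - y2| + `|y2 - x2|.
  have -> : x1 - x2 = (x1 - y1) + (y1 - y2) + (y2 - x2) by ring.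
  rewrite (le_trans (ler_normD _ _))// lerD2r (le_trans (ler_normD _ _))//.
  by rewrite lerD2r distrC.
move: A1 A2 A3 B1 B2; set q1 := _ * fine _; set q2 := _ * fine _.
lra.
Qed.

(** A trigonometric polynomial with zeros exactly at the angles 0 and a: it is positive precisely on
    the arc from a to 2 pi, and it is Lipschitz in e^(it). *)
Definition arcfun (a t : R) : R := cos (a / 2) - cos (t - a / 2).

Lemma arcfunE a t : arcfun a t = 2 * sin (t / 2) * sin ((t - a) / 2).
Proof.
rewrite /arcfun.
have {1}-> : a / 2 = t / 2 - (t - a) / 2 by field.
have -> : t - a / 2 = t / 2 + (t - a) / 2 by field.
by rewrite cosB cosD; ring.
Qed.

Lemma arcfun_gt0 a t : 0 <= a -> a < pi *+ 2 -> circ t -> (0 < arcfun a t) = (a < t).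
Proof.
move=> a0 a1; rewrite /circ /= in_itv /= => /andP[t0 t1].
have pi2 : pi *+ 2 = 2 * pi :> R by rewrite mulr2n; ring.
rewrite pi2 in a1 t1; rewrite arcfunE.
have [->|tn] := eqVneq t 0.
  by rewrite mul0r sin0 mulr0 mul0r ltxx ltNge a0.
have tp : 0 < t by rewrite lt_def tn.
have s1 : 0 < sin (t / 2) by apply: sin_gt0_pi; apply/andP; split; lra.
rewrite pmulr_rgt0; last lra.
have [ta|ta|ta] := ltgtP a t.
- by apply: sin_gt0_pi; apply/andP; split; lra.
- apply/negbTE; rewrite -leNgt.
  have -> : (t - a) / 2 = - ((a - t) / 2) by field.
  rewrite sinN oppr_le0 ltW//; apply: sin_gt0_pi; apply/andP; split; lra.
- by rewrite ta subrr mul0r sin0 ltxx.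
Qed.

Lemma arcfun_lip a t s : `|arcfun a s - arcfun a t| <= normc (eit s - eit t).
Proof.
have E u : cos (u - a / 2) = complex.Re (eit u * conjc (eit (a / 2))).
  by rewrite ReM /= cosB; ring.
rewrite /arcfun !E.
have -> : cos (a / 2) - complex.Re (eit s * conjc (eit (a / 2))) -
   (cos (a / 2) - complex.Re (eit t * conjc (eit (a / 2)))) =
   complex.Re ((eit t - eit s) * conjc (eit (a / 2))).
  by rewrite mulrBl ReB; ring.
by rewrite (le_trans (normc_Re _))// normcM normc_conj normc_eit mulr1 normcB.
Qed.

Lemma continuous_arcfun a : continuous (arcfun a).
Proof.
move=> t; apply: cvgB; first exact: cvg_cst.
apply: (@continuous_comp _ _ _ (fun t => t - a / 2) cos).
  by apply: cvgB; [exact: cvg_id|exact: cvg_cst].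
exact: continuous_cos.
Qed.

(** Lipschitz functions on the circle increasing with n to the indicator of the arc where [arcfun]
    is positive, so that monotone convergence passes from functions to arcs. *)
Definition cutoff (a : R) (n : nat) (t : R) : R :=
  Num.min 1 (n%:R * Num.max 0 (arcfun a t)).

Lemma cutoff_lip a n t s :
  `|cutoff a n s - cutoff a n t| <= n%:R * normc (eit s - eit t).
Proof.
have n0 : 0 <= n%:R :> R by exact: ler0n.
have min1 x y : `|Num.min 1 x - Num.min 1 y| <= `|x - y| :> R.
  by rewrite /Num.min; do 2 case: ifPn; rewrite -?leNgt => *; rewrite ler_norml;
     have := ler_norm (x - y); have := ler_normr x y;
     have := ler_norm (y - x); rewrite [ `|y - x|]distrC; lra.
have max0 x y : `|Num.max 0 x - Num.max 0 y| <= `|x - y| :> R.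
  by rewrite /Num.max; do 2 case: ifPn; rewrite -?leNgt => *; rewrite ler_norml;
     have := ler_norm (x - y); have := ler_norm (y - x); rewrite [ `|y - x|]distrC; lra.
apply: le_trans (min1 _ _) _; rewrite -mulrBr normrM (ger0_norm n0).
by rewrite ler_wpM2l// (le_trans (max0 _ _))// arcfun_lip.
Qed.

Lemma continuous_cutoff a n : continuous (cutoff a n).
Proof.
move=> t; apply/continuousPr => e e0.
have n1 : 0 < n%:R + 1 :> R by rewrite ltr_wpDl// ler0n.
have [r r0 rP] := rcont_eit t (divr_gt0 e0 n1).
exists r => // s /rP; rewrite ltr_pdivlMr// => H.
apply: le_lt_trans (cutoff_lip _ _ _ _) _; rewrite mulrC; apply: le_lt_trans H.
by rewrite ler_wpM2l ?normc_ge0// lerDl.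
Qed.

Lemma cutoff_ge0 a n t : 0 <= cutoff a n t.
Proof. by rewrite /cutoff le_min ler01 /= mulr_ge0// ?ler0n// le_max lexx. Qed.

Lemma cutoff_le1 a n t : cutoff a n t <= 1.
Proof. by rewrite /cutoff ge_min lexx. Qed.

Lemma cutoff_nd a t : {homo (cutoff a)^~ t : n k / (n <= k)%N >-> n <= k}.
Proof.
move=> n k nk; rewrite /cutoff le_min ge_min lexx /= ge_min; apply/orP; right.
by rewrite ler_wpM2r ?ler_nat// le_max lexx.
Qed.

Definition arc (a : R) : set T := [set u | 0 < arcfun a u].

Lemma cutoff_lim a t :
  limn (fun n => (cutoff a n t)%:E) = (\1_(arc a) t)%:E.
Proof.
apply: cvg_lim => //; apply: cvg_near_cst; rewrite indicE.
have [tA|tA] := boolP (t \in _).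
  move: tA; rewrite inE /= => x0.
  exists (Num.bound (arcfun a t)^-1) => // n /= Nn.
  rewrite /cutoff max_r ?ltW// min_l//.
  rewrite -ler_pdivrMr// mul1r ltW//.
  apply: lt_le_trans (archi_boundP _) _; first by rewrite invr_ge0 ltW.
  by rewrite ler_nat.
move: tA; rewrite notin_setE /= => /negP; rewrite -leNgt => x0.
exists 0%N => // n _; rewrite /cutoff max_l// mulr0 min_r// ler01.
Qed.

Lemma arc_set a : 0 <= a -> a < pi *+ 2 ->
  arc a `&` circ = `]a, pi *+ 2[%classic.
Proof.
move=> a0 a1; apply/seteqP; split => t.
  move=> [h tc]; rewrite /= in_itv /=; move: h; rewrite /arc /= arcfun_gt0// => -> /=.
  by move: tc; rewrite /circ /= in_itv /= => /andP[].
rewrite /= in_itv /= => /andP[ta t2]; have tc : circ t.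
  by rewrite /circ /= in_itv /= t2 (le_trans a0 (ltW ta)).
by split => //; rewrite /arc /= arcfun_gt0.
Qed.

Lemma measurable_arc a : measurable (arc a).
Proof.
rewrite (_ : arc a = arcfun a @^-1` `]0, +oo[%classic); last first.
  by apply/seteqP; split => t /=; rewrite in_itv /= andbT.
rewrite -[X in measurable X]setTI.
have mc : measurable_fun setT (arcfun a).
  by apply: continuous_measurable_fun; exact: continuous_arcfun.
by apply: mc => //; exact: measurable_itv.
Qed.

Lemma cutoff_cvg (m : {measure set T -> \bar R}) a :
  (\int[m]_(t in circ) (cutoff a n t)%:E @[n --> \oo] -->
   m (arc a `&` circ))%E.
Proof.
have mA := measurable_arc a.
have -> : m (arc a `&` circ) =
    (\int[m]_(t in circ) limn (fun n => (cutoff a n t)%:E))%E.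
  under eq_integral do rewrite cutoff_lim.
  by rewrite integral_indic//; exact: measurable_circ.
apply: cvg_monotone_convergence.
- exact: measurable_circ.
- move=> n; apply/measurable_EFinP; apply: measurable_funTS.
  by apply: continuous_measurable_fun; exact: continuous_cutoff.
- by move=> n t _; rewrite lee_fin cutoff_ge0.
- by move=> t _ n k nk; rewrite lee_fin cutoff_nd.
Qed.

Lemma eq_measure_arc a : 0 <= a -> a < pi *+ 2 ->
  m1 `]a, pi *+ 2[%classic = m2 `]a, pi *+ 2[%classic.
Proof.
move=> a0 a1; rewrite -arc_set//.
have c1 := @cutoff_cvg m1 a; have c2 := @cutoff_cvg m2 a.
apply: cvg_unique c1 _ => //.
rewrite (_ : (fun n => _) = fun n => \int[m2]_(t in circ) (cutoff a n t)%:E)%E//.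
apply/funext => n; rewrite -!Rintegral_EFin; last 2 first.
- by apply: integrable_cont_fin => //; exact: continuous_cutoff.
- by apply: integrable_cont_fin => //; exact: continuous_cutoff.
congr EFin; apply: same_integrals.
- exact: continuous_cutoff.
- exact: cutoff_ge0.
- exact: cutoff_le1.
- by apply: (lipschitz_nearly (ler0n R n)) => t s; exact: cutoff_lip.
Qed.

(** After restriction to the open arc, the measures agree on all rays to the right, a generating
    class closed under intersection. The angle 0 is left out because every [cutoff] vanishes there;
    it is Lebesgue null. *)
Lemma eq_measure_circle (A : set T) : measurable A ->
  A `<=` `]0, pi *+ 2[%classic -> m1 A = m2 A.
Proof.
move=> mA AI; have mI : measurable (`]0, pi *+ 2[%classic : set T) by exact: measurable_itv.
pose n1 : {measure set T -> \bar R} := mrestr m1 mI.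
pose n2 : {measure set T -> \bar R} := mrestr m2 mI.
have : n1 A = n2 A.
  apply: (@measure_unique _ R T (@RGenOInfty.G R) (fun n => `]- n%:R, +oo[%classic)) => //.
  - exact: RGenOInfty.measurableE.
  - move=> _ _ [x ->] [y ->]; exists (Num.max x y).
    apply/seteqP; split => t /=; rewrite !in_itv /= !andbT gt_max.
      by move=> [-> ->].
    by move=> /andP[].
  - by move=> n; exists (- n%:R).
  - apply/seteqP; split => // t _; exists (Num.bound `|t|) => //=.
    rewrite in_itv /= andbT ltrNl.
    by rewrite (le_lt_trans _ (archi_boundP (normr_ge0 t)))// -normrN ler_norm.
  - move=> _ [x ->]; rewrite /n1 /n2 /= /mrestr /=.
    have [xp|xp] := leP (pi *+ 2) x.
      rewrite (_ : _ `&` _ = set0) ?measure0//.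
      apply/seteqP; split => // t /=; rewrite !in_itv /= andbT => -[xt /andP[_ t2]].
      by move: (lt_trans (le_lt_trans xp xt) t2); rewrite ltxx.
    have -> : `]x, +oo[%classic `&` `]0, pi *+ 2[%classic =
        (`]Num.max x 0, pi *+ 2[%classic : set R).
      apply/seteqP; split => t /=; rewrite !in_itv /= ?andbT gt_max.
        by move=> [-> /andP[-> ->]].
      by move=> /andP[/andP[-> ->] ->].
    by apply: eq_measure_arc; rewrite ?le_max ?lexx ?orbT// gt_max xp pi2_gt0.
  - move=> n; rewrite /n1 /n2 /= /mrestr /=; apply: le_lt_trans fin1.
    by apply: le_measure; rewrite ?inE//; apply: measurableI => //; exact: measurable_itv.
by rewrite /n1 /n2 /= /mrestr setIidl.
Qed.

End two_measures.

End Uniqueness.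

(** * Recovering a density from its Poisson integral *)

Section BoundaryValues.
Context {R : realType}.
Local Notation C := R[i].
Local Notation leb := (@lebesgue_measure R).
Local Notation T := (measurableTypeR R).
Local Notation c := ((pi *+ 2)^-1 : R).

Lemma inv2pi_ge0 : 0 <= c.
Proof. by rewrite invr_ge0 ltW// pi2_gt0. Qed.

Definition open_arc : set T := `]0, pi *+ 2[%classic.

Lemma measurable_open_arc : measurable open_arc.
Proof. exact: measurable_itv. Qed.

Lemma open_arc_circ : open_arc `<=` circ.
Proof. by apply: subset_itvr; rewrite bnd_simp. Qed.

Lemma ae_eq_circ (D : set T) (f g : R -> \bar R) : measurable D ->
  leb (circ `\` D) = 0%E -> ae_eq leb D f g -> ae_eq leb (circ : set T) f g.
Proof.
move=> mD D0 fg.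
have neg : {ae leb, forall t, ~ (circ `\` D) t}.
  exists (circ `\` D); split => //.
    by apply: measurableD => //; exact: measurable_circ.
  by move=> t /=; rewrite notK.
apply: filterS2 fg neg => t fgt nt ct; apply: fgt.
by apply: contrapT => nD; exact: nt.
Qed.

Lemma lebesgue_circ_open_arc : leb (circ `\` open_arc) = 0%E.
Proof.
rewrite (_ : _ `\` _ = [set 0]) ?lebesgue_measure_set1//.
apply/seteqP; split => t; rewrite /circ /open_arc /= !in_itv /=.
  move=> [/andP[t0 t1] /negP]; rewrite t1 andbT -leNgt => t0'.
  by apply/eqP; rewrite eq_le t0' t0.
by move=> ->; rewrite lexx pi2_gt0 ltxx.
Qed.

Lemma Rintegral_density (m : {measure set T -> \bar R}) (k b : R -> R) :
  (m setT < +oo)%E -> (forall t, 0 <= k t) -> measurable_fun (circ : set T) k ->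
  (forall A, measurable A -> m A = \int[leb]_(t in A `&` circ) (k t)%:E)%E ->
  continuous b -> Rintegral m circ b = Rintegral leb circ (fun t => b t * k t).
Proof.
move=> mT k0 mk mE bc; rewrite /Rintegral; congr fine.
by rewrite (density_integral mT k0 mk mE)//; exact: integrable_cont_fin.
Qed.

Lemma pois_density (m : {measure set T -> \bar R}) (k : R -> R) z :
  (m setT < +oo)%E -> (forall t, 0 <= k t) -> measurable_fun (circ : set T) k ->
  (forall A, measurable A -> m A = \int[leb]_(t in A `&` circ) (k t)%:E)%E ->
  normc z < 1 -> pois m z = Rintegral leb circ (fun t => complex.Re (herg z t) * k t).
Proof.
move=> mT k0 mk mE z1; apply: Rintegral_density => //.
exact: rcont_Re (rcont_herg z1).
Qed.

Lemma mdens_fin (k : R -> R) (k0 : forall t, 0 <= k t)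
    (mk : measurable_fun (circ : set T) k) :
  leb.-integrable circ (EFin \o k) -> (mdens k0 mk setT < +oo)%E.
Proof.
move=> /integrableP[_]; rewrite /mdens setTI; congr (_ < _)%E.
by apply: eq_integral => t _ /=; rewrite ger0_norm.
Qed.

Lemma poisson_mean_cvg (H : R -> R) (e : R) : continuous H -> nearly_lipschitz H ->
  0 < e -> exists2 r0 : R, r0 < 1 & forall r t, 0 <= r -> r0 < r -> r < 1 ->
    `|rmean (fun s => pker r t s * H s) - H t| <= e.
Proof.
move=> Hc HL e0; have e2 : 0 < e / 2 by rewrite divr_gt0.
have [K K0 HK] := HL _ e2.
have K1 : 0 < 6 * K + 1 by lra.
exists (1 - e / 2 / (6 * K + 1)); first by rewrite ltrBlDr ltrDl divr_gt0.
move=> r t r0 rr r1; have := poisson_approx Hc r0 r1 K0 (HK t).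
move/le_trans; apply.
have : 1 - r <= e / 2 / (6 * K + 1) by lra.
rewrite ler_pdivlMr// => h.
have : 0 <= 1 - r by lra.
lra.
Qed.

Lemma integrable_nonneg_part (h : R -> R) : leb.-integrable circ (EFin \o h) ->
  leb.-integrable circ (EFin \o (fun t => Num.max (h t) 0)).
Proof.
move=> hi; have := integrable_funepos measurable_circ hi.
by apply: eq_integrable => [|t _]; [exact: measurable_circ|rewrite funeposE /= -EFin_max].
Qed.

(** Since h may change sign, h dt is not a measure and the uniqueness principle cannot be applied to
    it directly; it is applied to two nonnegative densities whose difference is (h - H)/(2 pi). *)
Lemma log_boundary_value (h H : R -> R) :
  leb.-integrable circ (EFin \o h) -> continuous H -> nearly_lipschitz H ->
  (forall e : R, 0 < e -> exists2 r0 : R, r0 < 1 & forall r t, 0 <= r -> r0 < r -> r < 1 ->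
    `|Rintegral leb circ (fun s => pker r t s * (h s * c)) - H t| <= e) ->
  ae_eq leb (circ : set T) (EFin \o h) (EFin \o H).
Proof.
move=> hi Hc HL hH.
have c0 := inv2pi_ge0.
have [B B0 BP] := continuous_bounded_itv 0 (pi *+ 2) Hc.
(* The positive part of h plus B is set against the negative part of h plus H + B. On the circle H +
   B >= 0 by the choice of B; the maximum with 0 in [k2] gives nonnegativity at all other t. *)
pose k1 t := (Num.max (h t) 0 + B) * c.
pose k2 t := (Num.max (- h t) 0 + Num.max (H t + B) 0) * c.
have k10 t : 0 <= k1 t by rewrite mulr_ge0// addr_ge0 ?(ltW B0)// le_max lexx orbT.
have k20 t : 0 <= k2 t by rewrite mulr_ge0// addr_ge0// le_max lexx orbT.
have scale (u : R -> R) : leb.-integrable circ (EFin \o u) ->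
    leb.-integrable circ (EFin \o (fun t => u t * c)).
  move=> ui; have := integrable_scale measurable_circ c ui.
  apply: eq_integrable => [|t _ /=]; [exact: measurable_circ|by rewrite mulrC].
have add (u v : R -> R) : leb.-integrable circ (EFin \o u) ->
    leb.-integrable circ (EFin \o v) -> leb.-integrable circ (EFin \o (fun t => u t + v t)).
  move=> ui vi; have := integrableD measurable_circ ui vi.
  by apply: eq_integrable => [|t _ /=]; [exact: measurable_circ|rewrite EFinD].
have Hi : leb.-integrable circ (EFin \o H).
  have := integrable_continuousM Hc (integrable_circ_cst 1).
  by apply: eq_integrable => [|t _ /=]; [exact: measurable_circ|rewrite mulr1].
have hN : leb.-integrable circ (EFin \o (fun t => - h t)).
  have := integrable_scale measurable_circ (-1) hi.
  by apply: eq_integrable => [|t _ /=]; [exact: measurable_circ|rewrite mulN1r].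
have k1i : leb.-integrable circ (EFin \o k1).
  apply: (scale (fun t => Num.max (h t) 0 + B)); apply: add.
    exact: integrable_nonneg_part.
  exact: integrable_circ_cst.
have k2i : leb.-integrable circ (EFin \o k2).
  have HBi := integrable_nonneg_part (add _ _ Hi (integrable_circ_cst B)).
  exact: (scale _ (add _ _ (integrable_nonneg_part hN) HBi)).
have mk1 : measurable_fun (circ : set T) k1 by exact/measurable_EFinP/measurable_int/k1i.
have mk2 : measurable_fun (circ : set T) k2 by exact/measurable_EFinP/measurable_int/k2i.
pose m1 : {measure set T -> \bar R} := mdens k10 mk1.
pose m2 : {measure set T -> \bar R} := mdens k20 mk2.
have fin1 : (m1 setT < +oo)%E := mdens_fin k10 mk1 k1i.
have fin2 : (m2 setT < +oo)%E := mdens_fin k20 mk2 k2i.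
have k12 t : circ t -> k1 t - k2 t = h t * c - H t * c.
  move=> /circ_itv/BP; rewrite ler_norml => /andP[BH _].
  rewrite /k1 /k2 [Num.max (H t + B) 0]max_l; last lra.
  rewrite -!mulrBl; congr (_ * _).
  by rewrite /Num.max; do 2 case: ifPn; rewrite -?leNgt; lra.
have pk z (u : R -> R) : normc z < 1 -> leb.-integrable circ (EFin \o u) ->
    leb.-integrable circ (EFin \o (fun t => complex.Re (herg z t) * u t)).
  by move=> z1 ui; apply: integrable_continuousM => //; exact: rcont_Re (rcont_herg z1).
have same e : 0 < e -> exists2 r0 : R, r0 < 1 & forall r t, 0 <= r -> r0 < r -> r < 1 ->
    `|pois m1 (cpt r t) - pois m2 (cpt r t)| <= e.
  move=> e0; have e2 : 0 < e / 2 by rewrite divr_gt0.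
  have [r1 r11 P1] := hH _ e2.
  have [r2 r21 P2] := poisson_mean_cvg Hc HL e2.
  exists (Num.max r1 r2); first by rewrite gt_max r11.
  move=> r t r0; rewrite gt_max => /andP[q1 q2] rl.
  have z1 := @normc_cpt_lt1 R r t r0 rl.
  rewrite (pois_density fin1 k10 mk1)// (pois_density fin2 k20 mk2)//.
  rewrite -(RintegralB measurable_circ (pk _ _ z1 k1i) (pk _ _ z1 k2i)).
  rewrite (@eq_Rintegral _ _ _ leb circ (fun s => pker r t s * (h s * c) -
    pker r t s * H s * c)); last first.
    move=> s /set_mem sc; rewrite -mulrBr (k12 s sc) mulrBr mulrA; congr (_ - _).
    by rewrite mulrA.
  have pH : leb.-integrable circ (EFin \o (fun s => pker r t s * H s * c)).
    by apply: rmean_int => s; apply: cvgM; [exact: continuous_pker|exact: Hc].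
  rewrite (RintegralB measurable_circ (pk _ _ z1 (scale _ hi)) pH).
  rewrite -/(rmean (fun s => pker r t s * H s)).
  have := P1 r t r0 q1 rl; have := P2 r t r0 q2 rl.
  set x := Rintegral _ _ _; set y := rmean _; rewrite !ler_norml; lra.
apply: (ae_eq_circ measurable_open_arc lebesgue_circ_open_arc).
have : ae_eq leb open_arc (EFin \o k1) (EFin \o k2).
  apply: integral_ae_eq.
  - exact: measurable_open_arc.
  - exact: (integrableS measurable_circ measurable_open_arc open_arc_circ k1i).
  - apply/measurable_EFinP; apply: (measurable_funS measurable_circ open_arc_circ mk2).
  - move=> A AI mA; have := eq_measure_circle fin1 fin2 same mA AI.
    by rewrite /m1 /m2 /= /mdens setIidl//; exact: subset_trans AI open_arc_circ.
apply: filterS => t E ta; have [E'] := E ta.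
have := k12 t (open_arc_circ ta); rewrite E' subrr => /esym/eqP.
rewrite subr_eq0 => /eqP/mulIf /=; move=> -> //.
by rewrite invr_neq0// gt_eqF// pi2_gt0.
Qed.

(** A singular part is allowed: [nu] agrees with H dt/(2 pi) on the open arc, and off a null set
    carrying [nus] only the density remains on the side of [nu]. *)
Lemma density_boundary_value (nu : {measure set T -> \bar R}) (wn : R -> R)
    (nus : {measure set T -> \bar R}) (H : R -> R) :
  circle_prob nu -> lebesgue_decomp nu wn nus ->
  continuous H -> nearly_lipschitz H -> (forall t, 0 <= H t) ->
  (forall e : R, 0 < e -> exists2 r0 : R, r0 < 1 & forall r t, 0 <= r -> r0 < r -> r < 1 ->
    `|pois nu (cpt r t) - H t| <= e) ->
  ae_eq leb (circ : set T) (EFin \o wn) (EFin \o H).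
Proof.
move=> [nu1 _] [wn0 [mwn [[N [mN [Nc [N0 nusN]]]] nuE]]] Hc HL H0 hH.
have c0 := inv2pi_ge0.
pose k t := H t * c.
have k0 t : 0 <= k t by rewrite mulr_ge0.
have ki : leb.-integrable circ (EFin \o k) by exact: rmean_int.
have mk : measurable_fun (circ : set T) k by exact/measurable_EFinP/measurable_int/ki.
pose m2 : {measure set T -> \bar R} := mdens k0 mk.
have fin1 : (nu setT < +oo)%E by rewrite nu1 ltry.
have fin2 : (m2 setT < +oo)%E := mdens_fin k0 mk ki.
have same e : 0 < e -> exists2 r0 : R, r0 < 1 & forall r t, 0 <= r -> r0 < r -> r < 1 ->
    `|pois nu (cpt r t) - pois m2 (cpt r t)| <= e.
  move=> e0; have e2 : 0 < e / 2 by rewrite divr_gt0.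
  have [r1 r11 P1] := hH _ e2.
  have [r2 r21 P2] := poisson_mean_cvg Hc HL e2.
  exists (Num.max r1 r2); first by rewrite gt_max r11.
  move=> r t r0; rewrite gt_max => /andP[q1 q2] rl.
  have z1 := @normc_cpt_lt1 R r t r0 rl.
  rewrite (pois_density fin2 k0 mk)//.
  have -> : Rintegral leb circ (fun s => complex.Re (herg (cpt r t) s) * k s) =
      rmean (fun s => pker r t s * H s).
    by apply: eq_Rintegral => s _; rewrite mulrA.
  have := P1 r t r0 q1 rl; have := P2 r t r0 q2 rl.
  set x := pois _ _; set y := rmean _; rewrite !ler_norml; lra.
(* On subsets of [D] the singular part vanishes, and the rest of the circle, the angle 0 together
   with [N], is Lebesgue null. *)
pose D := open_arc `\` N.
have mD : measurable D by apply: measurableD => //; exact: measurable_open_arc.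
have Dc : D `<=` circ by move=> t [/open_arc_circ].
apply: (ae_eq_circ mD).
  rewrite (_ : _ `\` _ = (circ `\` open_arc) `|` N).
    have mca : measurable (circ `\` open_arc : set T).
      by apply: measurableD; [exact: measurable_circ|exact: measurable_open_arc].
    by rewrite measureU0//; exact: lebesgue_circ_open_arc.
  apply/seteqP; split => t.
    move=> [tc nD]; have [tN|tN] := pselect (N t); [by right|left; split => // ta].
    exact: nD.
  by move=> [[tc ta]|tN]; split => //; [move=> [/ta]|exact: Nc|move=> [_ /(_ tN)]].
have : ae_eq leb D (EFin \o k) (fun t => (wn t / (pi *+ 2))%:E).
  apply: integral_ae_eq => //.
  - exact: (integrableS measurable_circ mD Dc ki).
  - apply/measurable_EFinP; apply: measurable_funM => //.
    exact: (measurable_funS measurable_circ Dc mwn).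
  - move=> A AD mA.
    have Ao : A `<=` open_arc by move=> t /AD[].
    have Ac : A `<=` circ by exact: subset_trans Ao open_arc_circ.
    have := eq_measure_circle fin1 fin2 same mA Ao.
    rewrite /m2 /= /mdens nuE// setIidl//.
    have -> : nus A = 0%E.
      apply/eqP; rewrite eq_le measure_ge0 andbT -nusN le_measure ?inE//.
        exact: measurableC.
      by move=> t /AD[].
    by rewrite adde0 => <-.
apply: filterS => t E tD; have [E'] := E tD.
rewrite /=; congr EFin; apply: (@mulIf _ c); last by rewrite -E'.
by rewrite invr_neq0// gt_eqF// pi2_gt0.
Qed.

End BoundaryValues.

(** * Lipschitz and lower bounds near the unit circle *)

Section CircleBounds.
Context {R : realType}.
Local Notation C := R[i].

Lemma circle_polar (z : C) : normc z = 1 -> exists2 t : R, 0 <= t <= pi *+ 2 & eit t = z.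
Proof.
case: z => a b z1; have ab : a ^+ 2 + b ^+ 2 = 1.
  by have := sqr_normcE (a +i* b)%C; rewrite z1 expr1n.
have a1 : -1 <= a <= 1.
  have : a ^+ 2 <= 1 by have := sqr_ge0 b; lra.
  by rewrite expr2 => a2; apply/andP; split; rewrite leNgt; apply/negP => h; nra.
have sE : sin (acos a) = `|b|.
  by rewrite sin_acos// -sqrtr_sqr; congr Num.sqrt; lra.
have p0 := acos_ge0 a1; have p1 := acos_lepi a1.
have pi0 := pi_gt0 R.
have [b0|b0] := leP 0 b.
  exists (acos a); first by rewrite p0 mulr2n; lra.
  by rewrite /eit sE ger0_norm// acosK.
exists (pi *+ 2 - acos a); first by rewrite mulr2n; apply/andP; split; lra.
rewrite /eit [pi *+ 2 - _]addrC cosD2pi sinD2pi cosN sinN sE acosK//.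
by rewrite ltr0_norm// opprK.
Qed.

Lemma circle_min (V : C -> C) : (forall z, normc z = 1 -> ccont V z) ->
  (forall z, normc z = 1 -> V z != 0) ->
  exists2 m : R, 0 < m & forall z, normc z = 1 -> m <= normc (V z).
Proof.
move=> Vc V0.
have rV : rcont (fun t => V (eit t)).
  by apply: (rcont_comp rcont_eit) => t; apply: Vc; exact: normc_eit.
have [t0 _ t0P] := EVT_min (ltW pi2_gt0) (continuous_subspaceT (rcont_normc rV)).
exists (normc (V (eit t0))); first by rewrite normc_gt0 V0// normc_eit.
by move=> z /circle_polar[t tI <-]; apply: t0P; rewrite in_itv.
Qed.

Lemma ln_lip (m x y : R) : 0 < m -> m <= x -> m <= y -> `|ln x - ln y| <= `|x - y| / m.
Proof.
move=> m0; wlog xy : x y / y <= x => [H mx my|mx my].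
  have [/H|/ltW/H] := leP y x; first exact.
  by rewrite distrC [X in _ <= X / _]distrC; exact.
have y0 : 0 < y := lt_le_trans m0 my; have x0 : 0 < x := lt_le_trans m0 mx.
rewrite !ger0_norm ?subr_ge0// ?ler_ln ?posrE//.
rewrite -ln_div ?posrE//.
have := expR_ge1Dx (ln (x / y)); rewrite lnK ?posrE ?divr_gt0// => H.
apply: (@le_trans _ _ (x / y - 1)); first lra.
have -> : x / y - 1 = (x - y) / y by rewrite mulrBl divff// gt_eqF.
by rewrite ler_wpM2l ?subr_ge0// lef_pV2 ?posrE.
Qed.

Section holo.
Variables (V : C -> C) (R0 : R).
Hypotheses (R01 : 1 < R0) (Vd : forall z, normc z < R0 -> cdiff V z).

Lemma lipschitz_near_disc : exists s L : R, [/\ 1 < s, s < R0, 0 < L &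
  forall z w, normc z <= s -> normc w <= s -> normc (V z - V w) <= L * normc (z - w)].
Proof.
pose s := (2 + R0) / 3; pose r := (1 + 2 * R0) / 3.
have s1 : 1 < s by rewrite /s; move: R01; lra.
have sr : s < r by rewrite /s /r; move: R01; lra.
have rR : r < R0 by rewrite /r; move: R01; lra.
have s0 : 0 <= s by rewrite (le_trans _ (ltW s1)).
have [L L0 LP] := holo_lipschitz s0 sr (fun x xr => Vd (le_lt_trans xr rR)).
by exists s, L; split => //; exact: lt_trans rR.
Qed.

Lemma lipschitz_disc : exists2 L : R, 0 < L & forall z w, normc z <= 1 -> normc w <= 1 ->
  normc (V z - V w) <= L * normc (z - w).
Proof.
have [s [L [s1 _ L0 LP]]] := lipschitz_near_disc.
by exists L => // z w z1 w1; apply: LP; exact: le_trans (ltW s1).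
Qed.

Lemma cptB_eit (r t : R) : normc (cpt r t - eit t) = `|r - 1|.
Proof.
have -> : cpt r t - eit t = (r - 1)%:C%C * eit t by rewrite /cpt rmorphB /=; ring.
by rewrite normcM normcR normc_eit mulr1.
Qed.

Lemma nearly_lipschitz_cont (b : R -> R) : nearly_lipschitz b -> continuous b.
Proof.
move=> bL t; apply/continuousPr => e e0.
have e2 : 0 < e / 2 by rewrite divr_gt0.
have [K K0 KP] := bL _ e2.
have K1 : 0 < K + 1 by lra.
have d0 : 0 < Num.min 1 (e / 2 / (K + 1)) by rewrite lt_min ltr01 !divr_gt0.
have [r r0 rP] := rcont_eit t d0.
exists r => // s /rP; rewrite lt_min => /andP[h1 h2].
apply: le_lt_trans (KP t s) _.
have n0 := normc_ge0 (eit s - eit t).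
move: h2; rewrite ltr_pdivlMr// => h2.
have : K * normc (eit s - eit t) ^+ 2 <= normc (eit s - eit t) * (K + 1).
  set n := normc _ in n0 h1 h2 *; have nn : n ^+ 2 <= n by rewrite expr2; nra.
  by have := ler_wpM2l K0 nn; nra.
lra.
Qed.

Lemma re_boundary : nearly_lipschitz (fun t => complex.Re (V (eit t))) /\
  (forall e : R, 0 < e -> exists2 r0 : R, r0 < 1 & forall r t, 0 <= r -> r0 < r -> r < 1 ->
    `|complex.Re (V (cpt r t)) - complex.Re (V (eit t))| <= e).
Proof.
have [L L0 LP] := lipschitz_disc.
have e1 t : normc (eit t : C) <= 1 by rewrite normc_eit.
split.
  apply: (lipschitz_nearly (ltW L0)) => t s.
  by rewrite -ReB (le_trans (normc_Re _))// LP.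
move=> e e0; exists (1 - e / L); first by rewrite ltrBlDr ltrDl divr_gt0.
move=> r t r0 rr r1; rewrite -ReB (le_trans (normc_Re _))//.
have c1 : normc (cpt r t) <= 1 by rewrite normc_cpt ger0_norm// ltW.
apply: le_trans (LP _ _ c1 (e1 t)) _.
rewrite cptB_eit distrC ger0_norm; last lra.
have : 1 - r <= e / L by lra.
by rewrite ler_pdivlMr// mulrC.
Qed.

(** For |z| > 1 compare with the radial projection u = z/|z|: |V(z) - V(u)| <= L (|z| - 1), which
    stays below the minimum m of |V| on the circle as long as |z| < 1 + m/L. *)
Lemma nonvanish_extend : (forall z, normc z <= 1 -> V z != 0) ->
  exists r2 : R, [/\ 1 < r2, r2 < R0 & forall z, normc z < r2 -> V z != 0].
Proof.
move=> V0.
have [s [L [s1 sR L0 LP]]] := lipschitz_near_disc.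
have [m m0 mP] : exists2 m : R, 0 < m & forall z, normc z = 1 -> m <= normc (V z).
  apply: circle_min => z z1; last by rewrite V0// z1.
  by apply: cdiff_cont; apply: Vd; rewrite z1.
pose r2 := Num.min s (1 + m / L).
have r21 : 1 < r2 by rewrite lt_min s1 ltrDl divr_gt0.
exists r2; split => //; first by rewrite gt_min sR.
move=> z; rewrite lt_min => /andP[zs zm].
have [z1|z1] := leP (normc z) 1; first exact: V0.
have nz0 : 0 < normc z by exact: lt_trans z1.
pose u := z / (normc z)%:C%C.
have nzc : (normc z)%:C%C != 0 :> C by rewrite -normc_eq0 normcR normr_eq0 gt_eqF.
have u1 : normc u = 1 by rewrite /u normcM normcV normcR gtr0_norm// divff// gt_eqF.
have zu : normc (z - u) = normc z - 1.
  have -> : z - u = (normc z - 1)%:C%C * u.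
    by rewrite /u rmorphB /= rmorph1; field.
  by rewrite normcM u1 mulr1 normcR ger0_norm// subr_ge0 ltW.
have us : normc u <= s by rewrite u1 ltW.
have := LP _ _ (ltW zs) us; rewrite zu => H.
rewrite -normc_gt0.
have := lerB_normc (V u) (V u - V z); rewrite opprB addrCA subrr addr0 normcB => H2.
have := mP _ u1.
have : L * (normc z - 1) < m by rewrite mulrC -ltr_pdivlMr//; lra.
lra.
Qed.

(** The logarithm is Lipschitz where |V| >= m/2, and this bound persists at radii close to 1. *)
Lemma log_boundary : (forall z, normc z = 1 -> V z != 0) ->
  nearly_lipschitz (fun t => 2 * ln (normc (V (eit t)))) /\
  (forall e : R, 0 < e -> exists2 r0 : R, r0 < 1 & forall r t, 0 <= r -> r0 < r -> r < 1 ->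
    `|2 * ln (normc (V (cpt r t))) - 2 * ln (normc (V (eit t)))| <= e).
Proof.
move=> V0; have [L L0 LP] := lipschitz_disc.
have e1 t : normc (eit t : C) <= 1 by rewrite normc_eit.
have [m m0 mP] : exists2 m : R, 0 < m & forall z, normc z = 1 -> m <= normc (V z).
  apply: circle_min => z z1; last by rewrite V0// z1.
  by apply: cdiff_cont; apply: Vd; rewrite z1.
have dist (x y : C) : `|normc x - normc y| <= normc (x - y).
  by rewrite ler_norml lerB_normc andbT lerNl opprB normcB lerB_normc.
have m2 : 0 < m / 2 by rewrite divr_gt0.
have K0 : 0 < 2 * L / (m / 2) by rewrite !divr_gt0// mulr_gt0.
have key (z w : C) : normc z <= 1 -> normc w <= 1 -> m / 2 <= normc (V z) ->
    m / 2 <= normc (V w) ->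
    `|2 * ln (normc (V z)) - 2 * ln (normc (V w))| <= 2 * L / (m / 2) * normc (z - w).
  move=> z1 w1 mz mw; rewrite -mulrBr normrM (ger0_norm (ler0n R 2)).
  have h := ln_lip m2 mz mw.
  have h2 := le_trans (dist (V z) (V w)) (LP z w z1 w1).
  have h3 : `|normc (V z) - normc (V w)| / (m / 2) <= L * normc (z - w) / (m / 2).
    by rewrite ler_pM2r ?invr_gt0.
  have := le_trans h h3; set x := `|_|.
  have -> : 2 * L / (m / 2) * normc (z - w) = 2 * (L * normc (z - w) / (m / 2)).
    by field; rewrite gt_eqF.
  by rewrite ler_pM2l.
have mc t : m / 2 <= normc (V (eit t)).
  by have := mP (eit t) (normc_eit t); lra.
split; first by apply: (lipschitz_nearly (ltW K0)) => t s; exact: key.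
(* The first entry keeps |V| >= m/2 at radius r; the second makes the Lipschitz bound for the
   logarithm at most e. *)
move=> e e0; pose d := Num.min (m / 2 / L) (e / (2 * L / (m / 2))).
have d0 : 0 < d by rewrite lt_min !divr_gt0// mulr_gt0.
exists (1 - d); first by rewrite ltrBlDr ltrDl.
move=> r t r0 rr r1.
have c1 : normc (cpt r t) <= 1 by rewrite normc_cpt ger0_norm// ltW.
have cd : normc (cpt r t - eit t) = 1 - r.
  by rewrite cptB_eit distrC ger0_norm// subr_ge0 ltW.
have : 1 - r < d by lra.
rewrite lt_min => /andP[d1 d2].
have mr : m / 2 <= normc (V (cpt r t)).
  have := dist (V (cpt r t)) (V (eit t)); have := LP _ _ c1 (e1 t); rewrite cd.
  have := mP (eit t) (normc_eit t).
  move: d1; rewrite ltr_pdivlMr// ler_norml mulrC; lra.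
apply: le_trans (key _ _ c1 (e1 t) mr (mc t)) _.
by rewrite cd mulrC -ler_pdivlMr// ltW.
Qed.

End holo.

End CircleBounds.

(** * The Szego function as a Herglotz exponential *)

Section SzegoFunction.
Context {R : realType}.
Local Notation C := R[i].
Local Notation leb := (@lebesgue_measure R).
Local Notation T := (measurableTypeR R).
Local Notation c := ((pi *+ 2)^-1 : R).
Variable w : R -> R.

Lemma szegoE (z : C) :
  szego w z = cexp (cI leb (fun t => ln (w t) * (pi *+ 4)^-1) (herg z)).
Proof.
rewrite /szego cintE; congr cexp; apply: eq_cintg => t _.
by rewrite rmorphM fmorphV /herg /= mulrA.
Qed.

Lemma szego_neq0 (z : C) : szego w z != 0.
Proof. by rewrite szegoE cexp_neq0. Qed.

Hypothesis lni : leb.-integrable circ (EFin \o (fun t => ln (w t))).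

Lemma ln_scale_integrable (r : R) :
  leb.-integrable circ (EFin \o (fun t => ln (w t) * r)).
Proof.
have := integrable_scale measurable_circ r lni.
by apply: eq_integrable => [|t _ /=]; [exact: measurable_circ|rewrite mulrC].
Qed.

Lemma cdiff_szego (z : C) : normc z < 1 -> cdiff (szego w) z.
Proof.
move=> z1.
rewrite (_ : szego w = fun z => cexp (cI leb (fun t => ln (w t) * (pi *+ 4)^-1) (herg z))).
  apply: cdiff_comp; last exact: cdiff_exp.
  by apply: cdiff_cI_herg => //; exact: ln_scale_integrable.
by apply/funext => x; exact: szegoE.
Qed.

Lemma ln_normc_szego (z : C) : normc z < 1 -> 2 * ln (normc (szego w z)) =
  Rintegral leb circ (fun t => complex.Re (herg z t) * (ln (w t) * c)).
Proof.
move=> z1; rewrite szegoE normc_cexp expRK Re_cI.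
have hi : leb.-integrable circ (EFin \o (fun t =>
    complex.Re (herg z t) * (ln (w t) * (pi *+ 4)^-1))).
  apply: integrable_continuousM; first exact: rcont_Re (rcont_herg z1).
  exact: ln_scale_integrable.
rewrite -(RintegralZl 2 measurable_circ hi); apply: eq_Rintegral => t _.
have p0 : pi != 0 :> R by rewrite gt_eqF// pi_gt0.
rewrite -[pi *+ 2]mulr_natr -[pi *+ 4]mulr_natr.
by move: (pi) p0 => p p0; field.
Qed.

End SzegoFunction.

(** * Consequences of the Szego condition *)

Section SzegoCondition.
Context {R : realType}.
Local Notation C := R[i].
Local Notation leb := (@lebesgue_measure R).
Local Notation T := (measurableTypeR R).
Local Notation c := ((pi *+ 2)^-1 : R).
Variables (mu : {measure set T -> \bar R}) (w : R -> R).
Hypotheses (mu1 : circle_prob mu) (wdec : lebesgue_decomp mu w mzero).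
Hypothesis wsz : szego_cond w.

Lemma weight_ge0 t : 0 <= w t. Proof. by have [+ _] := wdec. Qed.

Lemma weight_measurable : measurable_fun (circ : set T) w.
Proof. by have [_ [+ _]] := wdec. Qed.

Lemma weight_measure A : measurable A ->
  mu A = (\int[leb]_(t in A `&` circ) (w t * c)%:E)%E.
Proof.
have [_ [_ [_ H]]] := wdec; move=> mA.
by rewrite (H A mA) [X in (_ + X)%E](_ : _ = 0%E)// adde0.
Qed.

Lemma prob_fin : (mu setT < +oo)%E.
Proof. by case: mu1 => -> _; rewrite ltry. Qed.

Lemma weightc_ge0 t : 0 <= w t * c.
Proof. by rewrite mulr_ge0 ?weight_ge0// inv2pi_ge0. Qed.

Lemma weightc_measurable : measurable_fun (circ : set T) (fun t => w t * c).
Proof. by apply: measurable_funM => //; exact: weight_measurable. Qed.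

Lemma weightc_integrable : leb.-integrable circ (EFin \o (fun t => w t * c)).
Proof.
apply/integrableP; split; first by apply/measurable_EFinP; exact: weightc_measurable.
under eq_integral do rewrite /= ger0_norm ?weightc_ge0//.
by have := weight_measure measurableT; rewrite setTI => <-; exact: prob_fin.
Qed.

Lemma Rintegral_weight : Rintegral leb circ (fun t => w t * c) = 1.
Proof.
rewrite /Rintegral; have := weight_measure measurableT; rewrite setTI => <-.
by case: mu1 => -> _.
Qed.

Let f t : \bar R := (logE (w t) * c%:E)%E.

Lemma measurable_logEw : measurable_fun (circ : set T) f.
Proof.
have mw := weight_measurable.
have mw0 : measurable_fun (circ : set T) (fun t => 0 < w t).
  by apply: measurable_fun_ltr => //.
apply: emeasurable_funM => //; apply: measurable_fun_if => //.
- exact: measurable_circ.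
- apply: (@measurable_funS _ _ _ _ circ) => //; first exact: measurable_circ.
  apply/measurable_EFinP; apply: measurableT_comp => //; exact: measurable_ln.
Qed.

(** In the extended reals x + (-oo) = -oo for every x, so an infinite negative part would force the
    whole integral to be -oo, whatever the positive part is. *)
Lemma logEw_neg_integrable : leb.-integrable circ f^\-%E.
Proof.
have mf := measurable_logEw.
apply/integrableP; split; first exact: measurable_funeneg.
under eq_integral do rewrite gee0_abs ?funeneg_ge0//.
have wsz' : (-oo < \int[leb]_(t in circ) f t)%E := wsz.
rewrite ltey; apply/eqP => E; move: wsz'.
by rewrite integralE E addeNy ltxx.
Qed.

(** ln w <= w controls the positive part. Where w = 0 the real [ln] takes the default value 0,
    unlike [logE], and the bound is trivial. *)
Lemma ln_weight_bound t : (`|(ln (w t) * c)%:E| <= (w t * c)%:E + f^\- t)%E.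
Proof.
have c0 := @inv2pi_ge0 R; have wc := weightc_ge0 t.
have fn := funeneg_ge0 f t.
have [w0|w0] := ltP 0 (w t); last first.
  by rewrite ln0// mul0r abse0 adde_ge0// lee_fin.
have lw : ln (w t) <= w t.
  by have := expR_ge1Dx (ln (w t)); rewrite lnK ?posrE//; lra.
have [l0|l0] := leP 0 (ln (w t)).
  rewrite gee0_abs ?lee_fin ?mulr_ge0//.
  apply: (@le_trans _ _ (w t * c)%:E); last by rewrite leeDl.
  by rewrite lee_fin ler_wpM2r.
have fE : f t = (ln (w t) * c)%:E by rewrite /f /logE w0.
have n0 : ((ln (w t) * c)%:E <= 0)%E by rewrite lee_fin nmulr_rle0.
rewrite lee0_abs// funenegE fE.
apply: (@le_trans _ _ (maxe (- (ln (w t) * c)%:E) 0)%E); first by rewrite le_max lexx.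
by rewrite leeDr// lee_fin.
Qed.

Lemma ln_weight_integrable : leb.-integrable circ (EFin \o (fun t => ln (w t))).
Proof.
have mw := weight_measurable.
have mln : measurable_fun (circ : set T) (fun t => ln (w t)).
  by apply: measurableT_comp => //; exact: measurable_ln.
have H : leb.-integrable circ (EFin \o (fun t => ln (w t) * c)).
  apply: (le_integrable measurable_circ _ _
    (integrableD measurable_circ weightc_integrable logEw_neg_integrable)).
    by apply/measurable_EFinP; exact: measurable_funM.
  move=> t _; apply: le_trans (ln_weight_bound t) _.
  by rewrite [leRHS]gee0_abs// adde_ge0// ?lee_fin ?weightc_ge0// funeneg_ge0.
have := integrable_scale measurable_circ (pi *+ 2) H.
apply: eq_integrable => [|t _ /=]; first exact: measurable_circ.
by rewrite mulrCA divff ?mulr1// gt_eqF// pi2_gt0.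
Qed.

(** [logE] is -oo at a zero of w, and an integrable negative part is finite almost everywhere. Hence
    the default value of [ln] at 0 matters only on a null set. *)
Lemma weight_gt0_ae : {ae leb, forall t, circ t -> 0 < w t}.
Proof.
have := integrable_ae measurable_circ logEw_neg_integrable.
apply: filterS => t H /H; rewrite funenegE /f /logE; case: ifPn => // _.
rewrite mulNyr gtr0_sg ?mul1e; last by rewrite invr_gt0 pi2_gt0.
by rewrite /= maxye.
Qed.

(* Jensen: for the probability measure [pker r t s ds/2pi],
   [ln w <= ln K + w/K - 1] with [K] an upper bound of [pker]. *)
Lemma szego_growth (r t : R) : 0 <= r -> r < 1 -> expR 1 <= 2 / (1 - r) ->
  2 * ln (normc (szego w (cpt r t))) <= ln (2 / (1 - r)).
Proof.
move=> r0 r1 er; set K := 2 / (1 - r) in er *.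
have h1 : 0 < 1 - r by lra.
have K0 : 0 < K by rewrite divr_gt0.
(* Needed where w = 0: there [ln] is 0 by default, and 0 <= ln K - 1 + w/K must still hold. *)
have lnK1 : 1 <= ln K by rewrite -[1]expRK ler_ln ?posrE ?expR_gt0.
rewrite (ln_normc_szego ln_weight_integrable) ?normc_cpt_lt1//.
have pc := @continuous_pker R r t r0 r1.
have c0 := @inv2pi_ge0 R.
(* The kernel is at most (1 + r)/(1 - r), hence at most 2/(1 - r). *)
have pK s : pker r t s <= K.
  rewrite pkerE// ler_pdivrMr; last first.
    by rewrite -normc_eit_sub exprn_gt0// normc_gt0 eit_neq// normc_cpt_lt1.
  rewrite /K mulrAC ler_pdivlMr//.
  have := cos_le1 (t - s) => cl.
  have : r * cos (t - s) <= r by nra.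
  have : 0 <= (1 - r) ^+ 3 by rewrite exprn_ge0// ltW.
  rewrite !(exprS _ 2) !expr2 => h3 h2; lra.
have i1 : leb.-integrable circ (EFin \o (fun s => (ln K - 1) * (pker r t s * c))).
  by apply: integrable_scale; [exact: measurable_circ|exact: rmean_int].
have i2 : leb.-integrable circ (EFin \o (fun s => w s * c)) := weightc_integrable.
have i3 : leb.-integrable circ (EFin \o (fun s => pker r t s * (ln (w s) * c))).
  by apply: integrable_continuousM => //; exact: (ln_scale_integrable ln_weight_integrable).
have i4 : leb.-integrable circ (EFin \o (fun s => (ln K - 1) * (pker r t s * c) + w s * c)).
  have := integrableD measurable_circ i1 i2.
  by apply: eq_integrable => [|s _ /=]; [exact: measurable_circ|rewrite EFinD].
apply: (@le_trans _ _ (Rintegral leb circ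
    (fun s => (ln K - 1) * (pker r t s * c) + w s * c))).
  apply: (le_Rintegral measurable_circ i3 i4) => s _.
  have p0 := ltW (@pker_gt0 R r t s r0 r1).
  have lw : ln (w s) <= ln K - 1 + w s / K.
    have [w0|w0] := ltP 0 (w s); last first.
      by rewrite ln0// addr_ge0 ?subr_ge0// divr_ge0 ?weight_ge0// ltW.
    have := expR_ge1Dx (ln (w s / K)); rewrite lnK ?posrE ?divr_gt0//.
    by rewrite ln_div ?posrE//; lra.
  have : pker r t s * (ln (w s) * c) <= pker r t s * ((ln K - 1 + w s / K) * c).
    by rewrite ler_wpM2l// ler_wpM2r.
  move/le_trans; apply.
  have -> : pker r t s * ((ln K - 1 + w s / K) * c) =
    (ln K - 1) * (pker r t s * c) + pker r t s / K * (w s * c) by ring.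
  rewrite lerD2l -[leRHS]mul1r ler_wpM2r ?weightc_ge0//.
  by rewrite ler_pdivrMr// mul1r.
rewrite (RintegralD measurable_circ i1 i2) Rintegral_weight.
rewrite (RintegralZl _ measurable_circ (rmean_int pc)) -/(rmean (pker r t)).
by rewrite rmean_pker// mulr1 subrK.
Qed.

End SzegoCondition.

(** * The weight as 1/|g|^2 on the circle *)

Section Extension.
Context {R : realType}.
Local Notation C := R[i].
Local Notation leb := (@lebesgue_measure R).
Local Notation T := (measurableTypeR R).
Local Notation c := ((pi *+ 2)^-1 : R).
Variables (mu : {measure set T -> \bar R}) (w : R -> R) (Rad : R) (g : C -> C).
Hypotheses (mu1 : circle_prob mu) (wdec : lebesgue_decomp mu w mzero).
Hypotheses (wsz : szego_cond w) (Rad1 : 1 < Rad).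
Hypothesis gd : forall z, normc z < Rad -> cdiff g z.
Hypothesis gS : forall z, normc z < 1 -> g z = (szego w z)^-1.

Let lni := ln_weight_integrable mu1 wdec wsz.

Lemma g_neq0_disc z : normc z < 1 -> g z != 0.
Proof. by move=> z1; rewrite gS// invr_neq0// szego_neq0. Qed.

Lemma ln_g_szego z : normc z < 1 -> 2 * ln (normc (g z)) = - (2 * ln (normc (szego w z))).
Proof.
by move=> z1; rewrite gS// normcV lnV ?posrE ?normc_gt0 ?szego_neq0// mulrN.
Qed.

(* A zero [e] on the circle would give [|g(r e)| = O(1 - r)], against
   [|D(r e)|^2 <= 2 / (1 - r)]. *)
Lemma g_neq0_circle z : normc z = 1 -> g z != 0.
Proof.
move=> z1; apply/eqP => gz.
have [t _ tz] := circle_polar z1.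
have [d gder] := gd (z := z) ltac:(by rewrite z1).
have [dl dl0 dlP] := gder _ ltr01.
pose K := 1 + normc d.
have K0 : 0 < K by rewrite ltr_pwDl// normc_ge0.
have e0 := expR_gt0 (1 : R).
(* n = 1 - r is the distance to the supposed zero. The third bound validates |g| <= K n, the fourth
   is the hypothesis of [szego_growth], and the last contradicts its outcome n <= 2 |g|^2 <= 2 K^2
   n^2. *)
have [n [n0 n1 n2 n3 n4]] : exists n : R,
    [/\ 0 < n, n < 1, n < dl, n <= 2 / expR 1 & n <= 1 / (4 * K ^+ 2)].
  exists (Num.min (Num.min (1 / 2) (dl / 2)) (Num.min (2 / expR 1) (1 / (4 * K ^+ 2)))).
  have K2 : 0 < 4 * K ^+ 2 by rewrite mulr_gt0// exprn_gt0.
  split; rewrite ?lt_min ?gt_min ?ge_min ?lexx ?orbT//.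
  - by rewrite !divr_gt0.
  - by apply/orP; left; apply/orP; left; lra.
  - by apply/orP; left; apply/orP; right; lra.
have r0 : 0 <= 1 - n by lra.
have r1 : 1 - n < 1 by lra.
have cd : normc (cpt (1 - n) t - z) = n.
  by rewrite -tz cptB_eit addrAC subrr add0r normrN gtr0_norm.
have gle : normc (g (cpt (1 - n) t)) <= K * n.
  have := dlP (cpt (1 - n) t); rewrite cd => /(_ n2); rewrite gz subr0 mul1r => H.
  have -> : g (cpt (1 - n) t) = (g (cpt (1 - n) t) - d * (cpt (1 - n) t - z))
      + d * (cpt (1 - n) t - z) by ring.
  by rewrite (le_trans (ler_normcD _ _))// normcM cd /K mulrDl mul1r lerD2r.
have c1 : normc (cpt (1 - n) t) < 1 by exact: normc_cpt_lt1.
have g0 : 0 < normc (g (cpt (1 - n) t)) by rewrite normc_gt0 g_neq0_disc.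
have := szego_growth mu1 wdec wsz t r0 r1.
rewrite opprB addrCA subrr addr0 => /(_ ltac:(by rewrite ler_pdivlMr// mulrC -ler_pdivlMr)).
rewrite -[leLHS]opprK -ln_g_szego//.
set x := normc _ in gle g0 *.
have -> : - (2 * ln x) = ln ((x * x)^-1).
  by rewrite lnV ?posrE ?mulr_gt0// lnM ?posrE//; ring.
rewrite ler_ln ?posrE ?invr_gt0 ?mulr_gt0 ?invr_gt0//.
rewrite ler_pdivlMr// ler_pdivrMl ?mulr_gt0// => H.
have : x * x <= K * n * (K * n) by apply: ler_pM => //; exact: ltW.
move: n4; rewrite ler_pdivlMr ?mulr_gt0 ?exprn_gt0// !expr2 => n4 h.
have : n * (n * (4 * (K * K))) <= n * 1 by rewrite ler_pM2l.
lra.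
Qed.

Lemma g_neq0 z : normc z <= 1 -> g z != 0.
Proof. by rewrite le_eqVlt => /predU1P[/g_neq0_circle|/g_neq0_disc]. Qed.

Let H (t : R) := - (2 * ln (normc (g (eit t)))).

Lemma ln_weight_ae : ae_eq leb (circ : set T) (EFin \o (fun t => ln (w t))) (EFin \o H).
Proof.
have [HL Hlim] := log_boundary Rad1 gd g_neq0_circle.
have HL' : nearly_lipschitz H.
  move=> e /HL[K K0 KP]; exists K => // t s.
  by rewrite /H -opprD normrN; exact: KP.
apply: log_boundary_value => //; first exact: nearly_lipschitz_cont.
move=> e /Hlim[r0 r01 rP]; exists r0 => // r t rge0 rr r1.
rewrite -ln_normc_szego ?normc_cpt_lt1//.
have -> : 2 * ln (normc (szego w (cpt r t))) - H t =
    - (2 * ln (normc (g (cpt r t))) - 2 * ln (normc (g (eit t)))).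
  by rewrite /H (@ln_g_szego (cpt r t)) ?normc_cpt_lt1//; ring.
by rewrite normrN; exact: rP.
Qed.

(** The continuous representative of the weight w. *)
Definition bw (t : R) : R := (normc (g (eit t)) ^+ 2)^-1.

Lemma bw_gt0 t : 0 < bw t.
Proof. by rewrite invr_gt0 exprn_gt0// normc_gt0 g_neq0_circle// normc_eit. Qed.

(** The equality of logarithms can be exponentiated only where w > 0, that is, almost everywhere by
    the Szego condition. *)
Lemma weight_ae : ae_eq leb (circ : set T) (EFin \o w) (EFin \o bw).
Proof.
have W := weight_gt0_ae wdec wsz.
apply: filterS2 ln_weight_ae W => t lnw w0 ct.
have [E] := lnw ct; rewrite /=; congr EFin.
have n0 : 0 < normc (g (eit t)) by rewrite normc_gt0 g_neq0_circle// normc_eit.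
apply: ln_inj; rewrite ?posrE ?bw_gt0 ?w0//.
by rewrite E /H /bw lnV ?posrE ?exprn_gt0// expr2 lnM ?posrE//; ring.
Qed.

Lemma rcont_g : rcont (fun t => g (eit t)).
Proof.
apply: (rcont_comp rcont_eit) => t; apply: cdiff_cont; apply: gd.
by rewrite normc_eit.
Qed.

Lemma continuous_bw : continuous bw.
Proof.
have nc := rcont_normc rcont_g.
move=> t; apply: cvgV.
  by rewrite expf_neq0// normc_eq0 g_neq0_circle// normc_eit.
rewrite (_ : (fun t => _) = fun t => normc (g (eit t)) * normc (g (eit t))).
  by apply: cvgM; exact: nc.
by apply/funext => s; rewrite expr2.
Qed.

Lemma Rintegral_mu (b : R -> R) : continuous b ->
  Rintegral mu circ b = rmean (fun t => b t * bw t).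
Proof.
move=> bc.
rewrite (Rintegral_density (prob_fin mu1) (weightc_ge0 wdec) (weightc_measurable wdec)
  (weight_measure wdec) bc).
congr fine; apply: ae_eq_integral.
- exact: measurable_circ.
- apply/measurable_EFinP; apply: measurable_funM.
    by apply: measurable_funTS; exact: continuous_measurable_fun.
  exact: (weightc_measurable wdec).
- apply/measurable_EFinP; apply: measurable_funTS; apply: continuous_measurable_fun => t.
  apply: cvgM; last exact: cvg_cst.
  by apply: cvgM; [exact: bc|exact: continuous_bw].
- apply: filterS weight_ae => t wE ct; have [->] := wE ct.
  by congr EFin; rewrite mulrA.
Qed.

Lemma carathE z : carath mu z = cI mu (fun=> 1) (herg z).
Proof.
rewrite /carath cintE; apply: eq_cintg => t _.
by rewrite rmorph1 mulr1.
Qed.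

Lemma cI_mu_mean (b : R -> C) : rcont b ->
  cI mu (fun=> 1) b = cmean (fun t => b t * (bw t)%:C%C).
Proof.
move=> bc; apply: complex_eq.
  rewrite Re_cI Re_cmean.
  transitivity (Rintegral mu circ (fun t => complex.Re (b t))).
    by apply: eq_Rintegral => t _; rewrite mulr1.
  rewrite Rintegral_mu; last exact: rcont_Re.
  by congr rmean; apply/funext => t; rewrite ReM /= mulr0 subr0.
transitivity (Rintegral mu circ (fun t => complex.Im (b t))).
  by rewrite /cI /cintg /=; apply: eq_Rintegral => t _ /=; rewrite ImM /= mulr1 mulr0 add0r.
rewrite Rintegral_mu; last exact: rcont_Im.
rewrite /cmean /cI /cintg /=; apply: eq_Rintegral => t _ /=.
by rewrite !ImM /= !mulr0 !add0r.
Qed.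

Lemma carath_mean z : normc z < 1 ->
  carath mu z = cmean (fun t => herg z t * (bw t)%:C%C).
Proof. by move=> z1; rewrite carathE cI_mu_mean//; exact: rcont_herg. Qed.

End Extension.

(** * Reflection in the circle and Herglotz integrals off the circle *)

Section Reflection.
Context {R : realType}.
Local Notation C := R[i].

Lemma cdiff_conj (f : C -> C) z : cdiff f (conjc z) ->
  cdiff (fun x => conjc (f (conjc x))) z.
Proof.
move=> [d dP]; exists (conjc d) => e /dP[r r0 rP]; exists r => // x xz.
have xz' : normc (conjc x - conjc z) = normc (x - z) by rewrite -conjcB normc_conj.
have := rP (conjc x); rewrite xz' => /(_ xz); apply: le_trans.
rewrite -[leRHS]normc_conj !conjcB conjcM conjcB !conjcK; exact: lexx.
Qed.

Lemma cdiff_mean_kernel (r : R) (b : R -> C) z (dl : R) : rcont b -> 0 < dl ->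
  (forall t, dl <= normc (cpt r t - z)) ->
  cdiff (fun x => cmean (fun t => (cpt r t + x) / (cpt r t - x) * b t)) z.
Proof.
move=> bc dl0 far.
have eb : rcont (fun t => cpt r t * b t) by apply: rcontM => //; exact: rcont_cpt.
have D := cdiff_cI inv2pi_int (@rcont_cpt R r) eb dl0 far.
apply: (@cdiff_near _ (fun x => 2 * cmean (fun t => cpt r t * b t / (cpt r t - x)) -
  cmean b) _ _ _ dl0); last first.
  apply: cdiffB; last exact: cdiff_cst.
  by apply: cdiffM => //; exact: cdiff_cst.
move=> x xz.
have n0 t : cpt r t - x != 0.
  rewrite subr_eq0; apply: contraTneq xz => <-; rewrite -leNgt; exact: far.
have rx : rcont (fun t => cpt r t * b t / (cpt r t - x)).
  by apply: rcontM => //; apply: rcontV => //; exact: rcont_cptB.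
rewrite -cmeanZ// -cmeanB//; last by apply: rcontM => //; exact: rcont_cst.
by apply: eq_cI => t; field; exact: n0.
Qed.

Lemma cmean_kernel_out (z : C) : 1 < normc z ->
  cmean (fun t => cpt 1 t / (cpt 1 t - z)) = 0.
Proof.
move=> z1.
have Kd x : normc x <= 1 -> cdiff (fun x => x / (x - z)) x.
  move=> x1; apply: cdiff_div; last by apply: cdiffB; [exact: cdiff_id|exact: cdiff_cst].
    by rewrite subr_eq0; apply: contraTneq z1 => <-; rewrite -leNgt.
  exact: cdiff_id.
have := @cmean_center R (fun x => x / (x - z)) 0 1 ltr01
  (fun x xr => cdiff_cont (Kd x xr)) (fun x xr _ => Kd x xr).
by rewrite mul0r.
Qed.

End Reflection.

(** * Continuation of g F across the circle *)

Section MeromorphicExtension.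
Context {R : realType}.
Local Notation C := R[i].
Local Notation leb := (@lebesgue_measure R).
Local Notation T := (measurableTypeR R).
Variables (mu : {measure set T -> \bar R}) (w : R -> R) (Rad : R) (g : C -> C).
Hypotheses (mu1 : circle_prob mu) (wdec : lebesgue_decomp mu w mzero).
Hypotheses (wsz : szego_cond w) (Rad1 : 1 < Rad).
Hypothesis gd : forall z, normc z < Rad -> cdiff g z.
Hypothesis gS : forall z, normc z < 1 -> g z = (szego w z)^-1.

Let g0 := g_neq0 mu1 wdec wsz Rad1 gd gS.

Lemma bw_nearly_lipschitz : nearly_lipschitz (bw g).
Proof.
have [L L0 LP] := lipschitz_disc Rad1 gd.
have [m m0 mP] : exists2 m : R, 0 < m & forall z, normc z = 1 -> m <= normc (g z).
  apply: circle_min => z z1; last by rewrite g0// z1.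
  by apply: cdiff_cont; apply: gd; rewrite z1.
have M0 : 0 <= 2 / m * (L / (m * m)) by rewrite mulr_ge0// divr_ge0 ?mulr_ge0// ltW.
apply: (lipschitz_nearly M0) => t s.
have e1 u : normc (eit u : C) <= 1 by rewrite normc_eit.
have xy := LP _ _ (e1 s) (e1 t).
have := mP _ (normc_eit s); have := mP _ (normc_eit t).
have : `|normc (g (eit s)) - normc (g (eit t))| <= normc (g (eit s) - g (eit t)).
  by rewrite ler_norml lerB_normc andbT lerNl opprB normcB lerB_normc.
rewrite /bw; set x := normc (g (eit s)); set y := normc (g (eit t)).
move=> dxy my mx.
have x0 : 0 < x := lt_le_trans m0 mx; have y0 : 0 < y := lt_le_trans m0 my.
have -> : (x ^+ 2)^-1 - (y ^+ 2)^-1 = (x^-1 + y^-1) * ((y - x) * (x^-1 * y^-1)).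
  by field; rewrite !gt_eqF.
have ix : x^-1 <= m^-1 by rewrite lef_pV2 ?posrE.
have iy : y^-1 <= m^-1 by rewrite lef_pV2 ?posrE.
have ix0 : 0 < x^-1 by rewrite invr_gt0.
have iy0 : 0 < y^-1 by rewrite invr_gt0.
rewrite normrM normrM distrC [ `|x^-1 + _|]gtr0_norm ?addr_gt0//.
rewrite [ `|x^-1 * _|]gtr0_norm ?mulr_gt0// -[leRHS]mulrA.
have h1 : x^-1 + y^-1 <= 2 / m by rewrite mulr_natl mulr2n lerD.
apply: ler_pM; rewrite ?mulr_ge0 ?addr_ge0 ?(ltW ix0) ?(ltW iy0)//.
have -> : L / (m * m) * normc (eit s - eit t) = L * normc (eit s - eit t) * (m^-1 * m^-1).
  by field; rewrite gt_eqF.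
apply: ler_pM; rewrite ?mulr_ge0 ?(ltW ix0) ?(ltW iy0)//; first exact: le_trans dxy xy.
by apply: ler_pM; rewrite ?(ltW ix0) ?(ltW iy0).
Qed.

(** [Q] continues g F to the whole disc of radius [Rad]. [Fh] continues F itself, but only to a disc
    where g has no zero; it serves to read off Re F on the circle. *)
Theorem caratheodory_extension : exists (Q Fh : C -> C) (r0 : R),
  [/\ 1 < r0, r0 < Rad, forall z, normc z < Rad -> cdiff Q z
    & forall z, normc z < r0 -> [/\ cdiff Fh z, g z != 0 & Q z = g z * Fh z]] /\
  [/\ forall z, normc z < 1 -> Fh z = carath mu z,
      forall z, normc z < Rad -> g z = 0 -> Q z != 0
    & forall t, complex.Re (Fh (eit t)) = bw g t].
Proof.
have [r1 [r11 r1R r1P]] := nonvanish_extend Rad1 gd g0.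
(* Strictly below [r1], so that 1/(g g^#) is differentiable on the closed annulus 1 <= |z| <= r0. *)
pose r0 := (1 + r1) / 2.
have r01 : 1 < r0 by rewrite /r0; lra.
have r0r : r0 < r1 by rewrite /r0; lra.
have r0R : r0 < Rad by lra.
have r0p : 0 < r0 by lra.
clearbody r0.
pose gs z := conjc (g ((conjc z)^-1)).
have gsd z : z != 0 -> (normc z)^-1 < Rad -> cdiff gs z.
  move=> z0 zR; apply: (@cdiff_conj _ (fun x => g x^-1)).
  apply: (@cdiff_comp _ (fun x => x^-1) g).
    by apply: (@cdiffV _ (fun x => x)); [rewrite conjc_eq0|exact: cdiff_id].
  by apply: gd; rewrite normcV normc_conj.
have gs0 z : (normc z)^-1 < r1 -> gs z != 0.
  by move=> zr; rewrite /gs conjc_eq0 r1P// normcV normc_conj.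
pose v z := (g z * gs z)^-1.
have nz (z : C) : 1 <= normc z -> z != 0 by move=> z1; rewrite -normc_gt0; lra.
have inv1 (z : C) : 1 <= normc z -> (normc z)^-1 < r1.
  move=> z1; apply: le_lt_trans r11; rewrite invf_le1//; lra.
have vd z : 1 <= normc z -> normc z < Rad -> g z != 0 -> cdiff v z.
  move=> z1 zr gz; apply: (@cdiffV _ (fun z => g z * gs z)).
    by rewrite mulf_neq0// gs0// inv1.
  apply: cdiffM; first by apply: gd.
  by apply: gsd; [exact: nz|exact: lt_trans (inv1 _ z1) r1R].
have vd' z : 1 <= normc z -> normc z <= r0 -> cdiff v z.
  by move=> z1 zr; apply: vd => //; [exact: le_lt_trans r0R|apply: r1P; exact: le_lt_trans r0r].
have vE t : v (cpt 1 t) = (bw g t)%:C%C.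
  rewrite /cpt mul1r /v /gs (@conjc_unit _ (eit t)) ?normc_eit// invrK mulc_conj.
  by rewrite /bw fmorphV.
have rv r : 1 <= r -> r <= r0 -> rcont (fun t => v (cpt r t)).
  move=> q1 q2; apply: rcont_circ => t; apply: cdiff_cont.
  by apply: vd'; rewrite normc_cpt ger0_norm//; lra.
have rv0 := rv r0 (ltW r01) (lexx _). have rv1 := rv 1 (lexx _) (ltW r01).
pose Fh z := cmean (fun t => (cpt r0 t + z) / (cpt r0 t - z) * v (cpt r0 t)).
(* The Herglotz integral over the unit circle, used at points outside it. It does not continue F; it
   differs from the continuation by the residue computed in [jump]. *)
pose Fo z := cmean (fun t => (cpt 1 t + z) / (cpt 1 t - z) * v (cpt 1 t)).
have Fhd z : normc z < r0 -> cdiff Fh z.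
  move=> zr; apply: (@cdiff_mean_kernel R r0 (fun t => v (cpt r0 t)) z (r0 - normc z)) => //.
    by rewrite subr_gt0.
  by move=> t; exact: cpt_sub_ge.
have Fod z : 1 < normc z -> cdiff Fo z.
  move=> zr; apply: (@cdiff_mean_kernel R 1 (fun t => v (cpt 1 t)) z (normc z - 1)) => //.
    by rewrite subr_gt0.
  by move=> t; rewrite normcB (le_trans _ (lerB_normc _ _))// normc_cpt normr1.
have FhE z : normc z < 1 -> Fh z = carath mu z.
  move=> z1; rewrite (carath_mean mu1 wdec wsz Rad1 gd gS z1).
  transitivity (cmean (fun t => (cpt 1 t + z) / (cpt 1 t - z) * v (cpt 1 t))); last first.
    by apply: eq_cI => t; rewrite vE /herg /cpt mul1r.
  have qd x : 1 <= normc x <= r0 -> cdiff (fun x => (x + z) / (x - z) * v x) x.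
    move=> /andP[x1 x2]; apply: cdiffM; last exact: vd'.
    apply: cdiff_div; last by apply: cdiffB; [exact: cdiff_id|exact: cdiff_cst].
      by rewrite subr_eq0; apply: contraTneq z1 => <-; rewrite -leNgt.
    by apply: cdiffD; [exact: cdiff_id|exact: cdiff_cst].
  by rewrite (@cmean_annulus R (fun x => (x + z) / (x - z) * v x) 0 1 r0) ?(ltW r01)// =>
    x xa; [apply: cdiff_cont|move=> _]; exact: qd.
(* With v(x) - v(z) in place of v(x) the integrand is continuous at x = z, so its means over both
   circles agree. The kernel (x + z)/(x - z) itself has mean 1 when z lies inside the circle and -1
   when it lies outside, which leaves 2 v(z). *)
have jump z : 1 < normc z -> normc z < r0 -> Fh z = Fo z + 2 * v z.
  move=> z1 zr; have [d dP] := vd' z (ltW z1) (ltW zr).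
  have qc x : 1 <= normc x <= r0 -> ccont (fun x => (x + z) * dquot v z d x) x.
    move=> /andP[x1 x2]; apply: ccontM.
      by apply: cdiff_cont; apply: cdiffD; [exact: cdiff_id|exact: cdiff_cst].
    have [->|xz] := eqVneq x z; first exact: dquot_cont.
    by apply: cdiff_cont; apply: dquot_diff => //; exact: vd'.
  have qd x : 1 <= normc x <= r0 -> x != z -> cdiff (fun x => (x + z) * dquot v z d x) x.
    move=> /andP[x1 x2] xz; apply: cdiffM.
      by apply: cdiffD; [exact: cdiff_id|exact: cdiff_cst].
    by apply: dquot_diff => //; exact: vd'.
  have := cmean_annulus ltr01 (ltW r01) qc qd.
  have E r : (forall t, cpt r t - z != 0) -> rcont (fun t => v (cpt r t)) ->
      cmean (fun t => (cpt r t + z) * dquot v z d (cpt r t)) =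
      cmean (fun t => (cpt r t + z) / (cpt r t - z) * v (cpt r t)) -
      v z * (2 * cmean (fun t => cpt r t / (cpt r t - z)) - 1).
    move=> n0 rvr.
    have rk : rcont (fun t => (cpt r t - z)^-1) by apply: rcontV => //; exact: rcont_cptB.
    have rc : rcont (cpt r) := rcont_cpt r.
    have rk1 : rcont (fun t => cpt r t / (cpt r t - z)) by exact: rcontM.
    have rk2 : rcont (fun t => 2 * (cpt r t / (cpt r t - z))).
      by apply: rcontM => //; exact: rcont_cst.
    have -> : 2 * cmean (fun t => cpt r t / (cpt r t - z)) - 1 =
        cmean (fun t => 2 * (cpt r t / (cpt r t - z)) - 1).
      by rewrite cmeanB//; [rewrite cmeanZ// cmean1|exact: rcont_cst].
    have rk3 : rcont (fun t => 2 * (cpt r t / (cpt r t - z)) - 1).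
      by apply: rcontB => //; exact: rcont_cst.
    rewrite -cmeanZ// -cmeanB//; last 2 first.
    - apply: rcontM => //; apply: rcontM => //; apply: rcontD => //; exact: rcont_cst.
    - by apply: rcontM => //; exact: rcont_cst.
    apply: eq_cI => t; rewrite /dquot -subr_eq0 (negbTE (n0 t)).
    by field; exact: n0.
  have n1 t : cpt 1 t - z != 0.
    by rewrite subr_eq0; apply: contraTneq z1 => <-; rewrite -leNgt normc_cpt normr1.
  rewrite (E 1 n1 rv1) (E r0 _ rv0); last by move=> t; exact: cpt_neq.
  rewrite (cmean_kernel zr) (cmean_kernel_out z1) -/(Fh z) -/(Fo z) => H.
  have -> : Fh z = (Fh z - v z * (2 * 1 - 1)) + v z by ring.
  by rewrite -H; ring.
(* Multiplied by g, the residue 2 v becomes 2/g^#, with no pole at the zeros of g; by [jump] both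
   branches agree on 1 < |z| < r0. *)
pose Q z := if normc z < r0 then g z * Fh z else g z * Fo z + 2 / gs z.
have Qout z : 1 < normc z -> Q z = g z * Fo z + 2 / gs z.
  move=> z1; rewrite /Q; case: ifPn => // zr.
  have gz : g z != 0 by apply: r1P; lra.
  have gsz : gs z != 0 by apply: gs0; apply: inv1; exact: ltW.
  by rewrite (jump z z1 zr) /v; field; rewrite gz gsz.
exists Q, Fh, r0; split; split => //.
- move=> z zR; have [zr|zr] := ltP (normc z) r0.
    have d0 : 0 < r0 - normc z by rewrite subr_gt0.
    apply: (@cdiff_near _ (fun x => g x * Fh x) _ _ _ d0).
      move=> x xz; rewrite /Q ifT//.
      by have := lerB_normc x z; lra.
    by apply: cdiffM; [exact: gd|exact: Fhd].
  have z1 : 1 < normc z by lra.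
  have d0 : 0 < normc z - 1 by rewrite subr_gt0.
  apply: (@cdiff_near _ (fun x => g x * Fo x + 2 / gs x) _ _ _ d0).
    by move=> x xz; rewrite Qout//; have := lerB_normc z x; rewrite normcB; lra.
  apply: cdiffD; first by apply: cdiffM; [exact: gd|exact: Fod].
  apply: cdiff_div; last by apply: gsd; [exact/nz/ltW|exact: lt_trans (inv1 _ (ltW z1)) r1R].
    by apply: gs0; apply: inv1; exact: ltW.
  exact: cdiff_cst.
- move=> z zr; split; [exact: Fhd|apply: r1P; lra|by rewrite /Q zr].
- move=> z zR gz; have zr : ~ normc z < r1 by move=> /r1P; rewrite gz eqxx.
  have z1 : 1 < normc z by move/negP: zr; rewrite -leNgt; lra.
  rewrite Qout// gz mul0r add0r mulf_neq0 ?invr_neq0 ?pnatr_eq0//.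
  by apply: gs0; apply: inv1; exact: ltW.
(* At radius q < 1, Re Fh is the Poisson mean of [bw]; as q tends to 1 it approaches Re Fh at the
   boundary point by continuity and [bw] by Poisson approximation, each within D/3. *)
- move=> t; apply/eqP; rewrite -subr_eq0 -normr_eq0; apply/negPn/negP => D0.
  set D := `|_| in D0; have {}D0 : 0 < D by rewrite lt_def D0 normr_ge0.
  have D3 : 0 < D / 3 by rewrite divr_gt0.
  have [_ /(_ _ D3)[q1 q11 P1]] := re_boundary r01 Fhd.
  have cb := continuous_bw mu1 wdec wsz Rad1 gd gS.
  have [q2 q21 P2] := poisson_mean_cvg cb bw_nearly_lipschitz D3.
  pose q := (1 + Num.max 0 (Num.max q1 q2)) / 2.
  have m1 : Num.max 0 (Num.max q1 q2) < 1 by rewrite !gt_max ltr01 q11.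
  have m0 : 0 <= Num.max 0 (Num.max q1 q2) by rewrite le_max lexx.
  have mq1 : q1 <= Num.max 0 (Num.max q1 q2) by rewrite !le_max lexx orbT.
  have mq2 : q2 <= Num.max 0 (Num.max q1 q2) by rewrite !le_max lexx !orbT.
  have q0 : 0 <= q by rewrite /q; lra.
  have ql : q < 1 by rewrite /q; lra.
  have := P1 q t q0 (ltac:(by rewrite /q; lra)) ql.
  have := P2 q t q0 (ltac:(by rewrite /q; lra)) ql.
  have c1 := @normc_cpt_lt1 R q t q0 ql.
  rewrite FhE// (carath_mean mu1 wdec wsz Rad1 gd gS c1) Re_cmean.
  have -> : rmean (fun s => complex.Re (herg (cpt q t) s * (bw g s)%:C%C)) =
      rmean (fun s => pker q t s * bw g s).
    by congr rmean; apply/funext => s; rewrite ReM /= mulr0 subr0.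
  set x := rmean _ => h1 h2.
  have : D <= `|x - complex.Re (Fh (eit t))| + `|x - bw g t|.
    rewrite /D; have -> : complex.Re (Fh (eit t)) - bw g t =
      (complex.Re (Fh (eit t)) - x) + (x - bw g t) by ring.
    by rewrite (le_trans (ler_normD _ _))// distrC.
  lra.
Qed.

End MeromorphicExtension.

(** * Orthogonal polynomials and their Cauchy integrals *)

Section Verblunsky.
Context {R : realType}.
Local Notation C := R[i].
Local Notation T := (measurableTypeR R).

Lemma size_opuc (al : nat -> C) n : (size (opuc al n) <= n.+1)%N.
Proof.
elim: n => [|n IH] /=; first by rewrite size_poly1.
apply: leq_trans (size_polyD _ _) _; rewrite geq_max size_polyN; apply/andP; split.
  by rewrite mulrC (leq_trans (size_polyMleq _ _))// size_polyX addn2.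
rewrite mul_polyC (leq_trans (size_scale_leq _ _))//.
by rewrite (leq_trans (size_poly _ _)).
Qed.

Lemma coef_opuc (al : nat -> C) n : (opuc al n)`_n = 1.
Proof.
elim: n => [|n IH] /=; first by rewrite coef1.
rewrite coefB coefXM /= IH coefCM coef_poly ltnn mulr0 subr0 //.
Qed.

Lemma pstar_circle n (p : {poly C}) e : (size p <= n.+1)%N -> normc e = 1 ->
  (pstar n p).[e] = e ^+ n * conjc p.[e].
Proof.
move=> sp e1; have e0 : e != 0 by rewrite -normc_eq0 e1 oner_eq0.
rewrite /pstar horner_poly (horner_coef_wide _ sp) rmorph_sum /= mulr_sumr.
rewrite (reindex_inj rev_ord_inj) /=; apply: eq_bigr => i _.
have ni : (i <= n)%N by rewrite -ltnS.
rewrite subSS subKn// conjcM rmorphXn /= (conjc_unit e1) -[X in X * _]/(conjc p`_i).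
have -> : e ^+ n = e ^+ (n - i) * e ^+ i by rewrite -exprD subnK.
by rewrite exprVn; field; rewrite expf_neq0.
Qed.

Lemma conjc_eitX n (t : R) : conjc (eit t ^+ n) = (eit t)^-1 ^+ n.
Proof. by rewrite conjc_unit ?exprVn// normcX normc_eit expr1n. Qed.

Section measure.
Variables (m : {measure set T -> \bar R}) (al : nat -> C).
Hypotheses (m1 : circle_prob m) (mal : verblunsky m al).

Let mT := prob_fin m1.
Let onei := integrable_cst_fin 1 mT.
Local Notation mI := (cI m (fun=> 1)).

Definition Phi n (t : R) : C := (opuc al n).[eit t].
Definition Phis n (t : R) : C := eit t ^+ n * conjc (Phi n t).

Lemma PhiS n t : Phi n.+1 t = eit t * Phi n t - conjc (al n) * Phis n t.
Proof.
rewrite /Phi /= hornerD hornerN hornerM hornerX hornerM hornerC.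
by rewrite (pstar_circle (size_opuc al n) (normc_eit t)).
Qed.

Lemma PhisS n t : Phis n.+1 t = Phis n t - al n * (eit t * Phi n t).
Proof.
have e0 := eit_neq0 t.
rewrite /Phis PhiS conjcB !conjcM conjcK conjc_eitX exprVn conjcK (conjc_unit (normc_eit t)).
by rewrite exprS; field; rewrite e0 expf_neq0.
Qed.

Lemma rcontX (b : R -> C) n : rcont b -> rcont (fun t => b t ^+ n).
Proof.
move=> bc; elim: n => [|n IH].
  by rewrite (_ : (fun t => _) = fun=> 1); [exact: rcont_cst|apply/funext].
rewrite (_ : (fun t => _) = fun t => b t * b t ^+ n); first exact: rcontM.
by apply/funext => t; rewrite exprS.
Qed.

Lemma rcont_Phi n : rcont (Phi n).
Proof.
rewrite (_ : Phi n = fun t => \sum_(i < n.+1) (opuc al n)`_i * eit t ^+ i); last first.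
  by apply/funext => t; rewrite /Phi (horner_coef_wide _ (size_opuc al n)).
elim: (n.+1) => [|k IH].
  rewrite (_ : (fun t => _) = fun=> 0); first exact: rcont_cst.
  by apply/funext => t; rewrite big_ord0.
rewrite (_ : (fun t => _) = fun t => \sum_(i < k) (opuc al n)`_i * eit t ^+ i +
  (opuc al n)`_k * eit t ^+ k); last by apply/funext => t; rewrite big_ord_recr.
by apply: rcontD => //; apply: rcontM; [exact: rcont_cst|apply: rcontX; exact: rcont_eit].
Qed.

Lemma rcont_Phis n : rcont (Phis n).
Proof.
by apply: rcontM; [apply: rcontX; exact: rcont_eit|apply: rcont_conj; exact: rcont_Phi].
Qed.

Lemma rcont_eitV n : rcont (fun t : R => (eit t)^-1 ^+ n).
Proof. by apply: rcontX; apply: rcontV; [exact: rcont_eit|exact: eit_neq0]. Qed.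

Lemma rcont_cauchy_eit (z : C) : normc z < 1 -> rcont (fun t : R => (eit t - z)^-1).
Proof.
move=> z1; apply: rcontV => [|t]; last exact: eit_neq.
by apply: rcontB; [exact: rcont_eit|exact: rcont_cst].
Qed.

(* Up to the factors z^n and z^(n+1), these are F Phi_n + Psi_n and
   F Phi_n^* - Psi_n^*, with Psi_n the second kind polynomials; b_n / a_n is
   the n-th Schur function. *)
Definition an n (z : C) : C :=
  2 * mI (fun t => (eit t)^-1 ^+ n * (eit t * Phi n t) / (eit t - z)).
Definition bn n (z : C) : C :=
  2 * mI (fun t => (eit t)^-1 ^+ n * Phis n t / (eit t - z)).

Lemma rcont_an n z : normc z < 1 ->
  rcont (fun t => (eit t)^-1 ^+ n * (eit t * Phi n t) / (eit t - z)).
Proof.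
move=> z1; apply: rcontM; last exact: rcont_cauchy_eit.
apply: rcontM; first exact: rcont_eitV.
by apply: rcontM; [exact: rcont_eit|exact: rcont_Phi].
Qed.

Lemma rcont_bn n z : normc z < 1 ->
  rcont (fun t => (eit t)^-1 ^+ n * Phis n t / (eit t - z)).
Proof.
move=> z1; apply: rcontM; last exact: rcont_cauchy_eit.
by apply: rcontM; [exact: rcont_eitV|exact: rcont_Phis].
Qed.

Lemma anS n z : normc z < 1 -> an n.+1 z = an n z - conjc (al n) * bn n z.
Proof.
move=> z1; have ra := rcont_an n z1; have rb := rcont_bn n z1.
rewrite /an /bn mulrCA -mulrBr; congr (2 * _).
rewrite -(cIZ onei)// -(cIB onei)//; last by apply: rcontM => //; exact: rcont_cst.
apply: eq_cI => t; rewrite PhiS exprS.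
by field; rewrite eit_neq0 eit_neq.
Qed.

Lemma mean_Phi_eq0 n : mI (Phi n.+1) = 0.
Proof.
have := mal (ltn0Sn n); rewrite cintE => H; rewrite -[RHS]H.
by apply: eq_cintg => t _; rewrite expr0 -[1^*]/(conjc 1) conjc1 mulr1 mul1r.
Qed.

(** The integrands of the two sides differ by conj(Phi_(n+1)) exactly, and its integral vanishes
    because Phi_(n+1) is orthogonal to 1. *)
Lemma bnS n z : normc z < 1 -> z * bn n.+1 z = bn n z - al n * an n z.
Proof.
move=> z1; have ra := rcont_an n z1; have rb := rcont_bn n z1.
have rb1 := rcont_bn n.+1 z1.
rewrite /an /bn mulrCA [al n * _]mulrCA -mulrBr; congr (2 * _).
rewrite -!(cIZ onei)// -(cIB onei)//; last by apply: rcontM => //; exact: rcont_cst.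
have : mI (fun t => conjc (Phi n.+1 t)) = 0.
  by rewrite (cI_conj onei) ?mean_Phi_eq0 ?conjc0//; exact: rcont_Phi.
move=> E; apply/eqP; rewrite eq_sym -subr_eq0 -(cIB onei); last 2 first.
- by apply: rcontB => //; apply: rcontM => //; exact: rcont_cst.
- by apply: rcontM => //; exact: rcont_cst.
rewrite -E; apply/eqP; apply: eq_cI => t.
have PE : conjc (Phi n.+1 t) = (eit t)^-1 ^+ n.+1 * Phis n.+1 t.
  by rewrite /Phis mulrA -exprMn mulVf ?eit_neq0// expr1n mul1r.
rewrite PE PhisS exprS.
by field; rewrite eit_neq0 eit_neq.
Qed.

Lemma mI1 : mI (fun=> 1) = 1.
Proof.
apply: complex_eq; rewrite /cI /cintg /=.
  transitivity (Rintegral m circ (fun=> 1)).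
    by apply: eq_Rintegral => t _ /=; rewrite mul1r mulr0 subr0.
  rewrite Rintegral_cst ?mul1r; last exact: measurable_circ.
  have [mS mC] := m1.
  have : m [set: T] = (m circ + m (~` circ))%E.
    rewrite -(setUv (circ : set T)) measureU ?setICr//; first exact: measurable_circ.
    by apply: measurableC; exact: measurable_circ.
  by rewrite [LHS]mS [X in (_ + X)%E]mC adde0 => <-.
transitivity (Rintegral m circ (fun=> 0)).
  by apply: eq_Rintegral => t _ /=; rewrite mulr0 mul0r addr0.
by rewrite Rintegral_cst ?mul0r//; exact: measurable_circ.
Qed.

Lemma an0 z : normc z < 1 -> an 0 z = carath m z + 1.
Proof.
move=> z1; rewrite /carath cintE.
have -> : cintg m circ (fun t => (eit t + z) / (eit t - z)) = mI (herg z).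
  by apply: eq_cintg => t _; rewrite rmorph1 mulr1.
have ra := rcont_an 0 z1.
rewrite -mI1 -(cID onei); [|exact: rcont_herg|exact: rcont_cst].
rewrite /an -(cIZ onei)//; apply: eq_cI => t.
rewrite /herg /Phi /= hornerC expr0; field; exact: eit_neq.
Qed.

Lemma bn0 z : normc z < 1 -> z * bn 0 z = carath m z - 1.
Proof.
move=> z1; rewrite /carath cintE.
have -> : cintg m circ (fun t => (eit t + z) / (eit t - z)) = mI (herg z).
  by apply: eq_cintg => t _; rewrite rmorph1 mulr1.
have ra := rcont_bn 0 z1.
rewrite -mI1 -(cIB onei); [|exact: rcont_herg|exact: rcont_cst].
rewrite /bn mulrCA -(cIZ onei)// -(cIZ onei); last by apply: rcontM => //; exact: rcont_cst.
apply: eq_cI => t.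
rewrite /herg /Phis /Phi /= hornerC !expr0 conjc1; field; exact: eit_neq.
Qed.

Lemma cdiff_an n z : normc z < 1 -> cdiff (an n) z.
Proof.
move=> z1; apply: cdiffM; first exact: cdiff_cst.
apply: (@cdiff_cI _ m (fun=> 1) (@eit R) (fun t => (eit t)^-1 ^+ n * (eit t * Phi n t))
  z (1 - normc z)) => //.
- exact: rcont_eit.
- apply: rcontM; first exact: rcont_eitV.
  by apply: rcontM; [exact: rcont_eit|exact: rcont_Phi].
- by rewrite subr_gt0.
- by move=> t; apply: le_trans (lerB_normc _ _); rewrite normc_eit.
Qed.

Lemma cdiff_bn n z : normc z < 1 -> cdiff (bn n) z.
Proof.
move=> z1; apply: cdiffM; first exact: cdiff_cst.
apply: (@cdiff_cI _ m (fun=> 1) (@eit R) (fun t => (eit t)^-1 ^+ n * Phis n t)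
  z (1 - normc z)) => //.
- exact: rcont_eit.
- by apply: rcontM; [exact: rcont_eitV|exact: rcont_Phis].
- by rewrite subr_gt0.
- by move=> t; apply: le_trans (lerB_normc _ _); rewrite normc_eit.
Qed.

(** At z = 0 the integrand is e^(-int) Phi_n. As Phi_n is monic and orthogonal to lower powers, this
    pairing is its squared norm. *)
Lemma an_at0 n : an n 0 = 2 * (Rintegral m circ (fun t => normc (Phi n t) ^+ 2))%:C%C.
Proof.
rewrite /an; congr (2 * _).
have rP := rcont_Phi n.
have orth j : (j < n)%N -> mI (fun t => (eit t)^-1 ^+ j * Phi n t) = 0.
  move=> /mal; rewrite cintE => H; rewrite -[RHS]H; apply: eq_cintg => t _.
  by rewrite rmorph1 mulr1 -[_^*]/(conjc _) conjc_eitX.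
have E : mI (fun t => conjc (Phi n t) * Phi n t) =
    mI (fun t => (eit t)^-1 ^+ n * Phi n t).
  pose S k t := \sum_(i < k) conjc ((opuc al n)`_i) * (eit t)^-1 ^+ i.
  have SE k t : S k.+1 t = S k t + conjc ((opuc al n)`_k) * (eit t)^-1 ^+ k.
    by rewrite /S big_ord_recr.
  have rS k : rcont (S k).
    elim: k => [|k IH].
      by rewrite (_ : S 0%N = fun=> 0); [exact: rcont_cst|apply/funext => t; rewrite /S big_ord0].
    rewrite (_ : S k.+1 = fun t => S k t + conjc ((opuc al n)`_k) * (eit t)^-1 ^+ k).
      by apply: rcontD => //; apply: rcontM; [exact: rcont_cst|exact: rcont_eitV].
    by apply/funext => t; rewrite SE.
  have SI k : (k <= n)%N -> mI (fun t => S k t * Phi n t) = 0.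
    elim: k => [_|k IH kn].
      rewrite (@eq_cI _ _ _ _ (fun t => 0 * Phi n t)); first by rewrite (cIZ onei)// mul0r.
      by move=> t; rewrite /S big_ord0.
    rewrite (@eq_cI _ _ _ _ (fun t => S k t * Phi n t +
      conjc ((opuc al n)`_k) * ((eit t)^-1 ^+ k * Phi n t))); last first.
      by move=> t; rewrite SE mulrDl mulrA.
    have rk : rcont (fun t => (eit t)^-1 ^+ k * Phi n t).
      by apply: rcontM => //; exact: rcont_eitV.
    rewrite (cID onei); last 2 first.
    - exact: rcontM.
    - by apply: rcontM => //; exact: rcont_cst.
    by rewrite IH ?(ltnW kn)// add0r (cIZ onei)// orth// mulr0.
  rewrite (@eq_cI _ _ _ _ (fun t => S n t * Phi n t + (eit t)^-1 ^+ n * Phi n t)).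
    rewrite (cID onei); last 2 first.
    - exact: rcontM.
    - by apply: rcontM => //; exact: rcont_eitV.
    by rewrite SI// add0r.
  move=> t; rewrite -mulrDl; congr (_ * _).
  rewrite /Phi (horner_coef_wide _ (size_opuc al n)) rmorph_sum /= big_ord_recr /=.
  rewrite coef_opuc mul1r conjc_eitX.
  congr (_ + _); apply: eq_bigr => i _.
  by rewrite conjcM conjc_eitX.
transitivity (mI (fun t => (eit t)^-1 ^+ n * Phi n t)).
  by apply: eq_cI => t; rewrite subr0; field; rewrite eit_neq0.
rewrite -E; apply: complex_eq.
  rewrite Re_cI /=; apply: eq_Rintegral => t _.
  by rewrite [conjc _ * _]mulrC mulc_conj /= mulr1.
rewrite /cI /cintg /= (_ : Rintegral _ _ _ = Rintegral m circ (fun=> 0)).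
  by rewrite Rintegral_cst ?mul0r//; exact: measurable_circ.
apply: eq_Rintegral => t _ /=; rewrite [conjc _ * _]mulrC mulc_conj.
by rewrite ImM /= mulr0 mul0r addr0.
Qed.

(** [bnS] at z = 0 forces b_n(0) = alpha_n a_n(0). This is the classical recursion for the norms of
    the polynomials. *)
Lemma an_at0S n : an n.+1 0 = (1 - (normc (al n) ^+ 2)%:C%C) * an n 0.
Proof.
have z0 : normc (0 : C) < 1 by rewrite normc0.
rewrite anS//; have := bnS n z0; rewrite mul0r => /esym/eqP.
rewrite subr_eq0 => /eqP ->; rewrite -mulc_conj; ring.
Qed.

End measure.

End Verblunsky.

(** * Lebesgue means of the orthogonal polynomials *)

Section PolynomialMeans.
Context {R : realType}.
Local Notation C := R[i].

Lemma cdiff_horner (p : {poly C}) z : cdiff (fun x => p.[x]) z.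
Proof.
elim/poly_ind: p => [|p c IH].
  by rewrite (_ : (fun x => _) = fun=> 0);
    [exact: cdiff_cst|apply/funext => x; rewrite horner0].
rewrite (_ : (fun x => _) = fun x => p.[x] * x + c); last first.
  by apply/funext => x; rewrite hornerMXaddC.
by apply: cdiffD; [apply: cdiffM => //; exact: cdiff_id|exact: cdiff_cst].
Qed.

Lemma cmean_Phis (al : nat -> C) n : cmean (Phis al n) = 1.
Proof.
pose G (x : C) := (pstar n (opuc al n)).[x].
have Gd x : cdiff G x by exact: cdiff_horner.
rewrite (_ : Phis al n = fun t => G (cpt 1 t)); last first.
  apply/funext => t; rewrite /G /cpt mul1r.
  by rewrite (pstar_circle (size_opuc al n) (normc_eit t)).
rewrite (@cmean_center _ G 0 1)//; last by move=> x _; exact: cdiff_cont.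
by rewrite /G horner_coef0 coef_poly /= subn0 coef_opuc -[_^*]/(conjc 1) conjc1.
Qed.

Lemma normc_Phis (al : nat -> C) n t : normc (Phis al n t) = normc (Phi al n t).
Proof. by rewrite normcM normcX normc_eit expr1n mul1r normc_conj. Qed.

(** Phi_n^* has constant term 1, hence mean 1, and |Phi_n|^2 = |Phi_n^*|^2 >= 2 Re Phi_n^* - 1 on
    the circle. *)
Lemma rmean_Phi_ge1 (al : nat -> C) n :
  1 <= rmean (fun t => normc (Phi al n t) ^+ 2).
Proof.
have rP := rcont_Phi al n; have rS := rcont_Phis al n.
have cS := rcont_Re rS.
have c1 : continuous (fun t : R => 2 * complex.Re (Phis al n t)).
  by move=> t; apply: cvgM; [exact: cvg_cst|exact: cS].
have c2 : continuous (fun t : R => 2 * complex.Re (Phis al n t) + -1).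
  by move=> t; apply: cvgD; [exact: c1|exact: cvg_cst].
have c3 : continuous (fun t : R => normc (Phi al n t) ^+ 2).
  by move=> t; apply: cvgM; exact: rcont_normc.
have : rmean (fun t => 2 * complex.Re (Phis al n t) + -1) = 1.
  rewrite rmeanD//; last by move=> t; exact: cvg_cst.
  by rewrite rmeanZ// -Re_cmean cmean_Phis rmean_cst /=; lra.
move=> <-; apply: le_rmean => // t _.
rewrite -normc_Phis sqr_normcE; have := sqr_ge0 (complex.Im (Phis al n t)).
have := sqr_ge0 (complex.Re (Phis al n t) - 1); nra.
Qed.

End PolynomialMeans.

(** * Bounds on the coefficients and the Caratheodory function of mu^(n) *)

Section VerblunskyBound.
Context {R : realType}.
Local Notation C := R[i].
Local Notation T := (measurableTypeR R).
Variables (mu : {measure set T -> \bar R}) (w : R -> R) (Rad : R) (g : C -> C).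
Hypotheses (mu1 : circle_prob mu) (wdec : lebesgue_decomp mu w mzero).
Hypotheses (wsz : szego_cond w) (Rad1 : 1 < Rad).
Hypothesis gd : forall z, normc z < Rad -> cdiff g z.
Hypothesis gS : forall z, normc z < 1 -> g z = (szego w z)^-1.
Variable al : nat -> C.
Hypothesis mal : verblunsky mu al.

(** The density 1/|g|^2 is bounded below, so the norm is comparable with the Lebesgue norm. *)
Lemma int_Phi_gt0 n : 0 < Rintegral mu circ (fun t => normc (Phi al n t) ^+ 2).
Proof.
have c3 : continuous (fun t : R => normc (Phi al n t) ^+ 2).
  by move=> t; apply: cvgM; apply: rcont_normc; exact: rcont_Phi.
rewrite (Rintegral_mu mu1 wdec wsz Rad1 gd gS c3).
have [M M0 MP] := rcont_bounded (rcont_g Rad1 gd).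
apply: (@lt_le_trans _ _ (rmean (fun t => (M ^+ 2)^-1 * normc (Phi al n t) ^+ 2))).
  rewrite rmeanZ// mulr_gt0 ?invr_gt0 ?exprn_gt0//.
  exact: lt_le_trans ltr01 (rmean_Phi_ge1 al n).
apply: le_rmean => [t|t|t ct].
- by apply: cvgM; [exact: cvg_cst|exact: c3].
- by apply: cvgM; [exact: c3|exact: (continuous_bw mu1 wdec wsz Rad1 gd gS)].
rewrite mulrC ler_wpM2l ?sqr_ge0// /bw.
have := bw_gt0 mu1 wdec wsz Rad1 gd gS t; rewrite /bw invr_gt0 => g0.
rewrite lef_pV2 ?posrE ?(exprn_gt0 2 M0)//.
by rewrite ler_sqr ?nnegrE ?normc_ge0 ?(ltW M0)// MP.
Qed.

Lemma an_at0_neq0 n : an mu al n 0 != 0.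
Proof.
rewrite an_at0// mulf_neq0 ?pnatr_eq0// -normc_eq0 normcR normr_eq0.
by rewrite gt_eqF// int_Phi_gt0.
Qed.

(** 1 - |alpha_n|^2 is the quotient of two consecutive squared norms, both positive. *)
Lemma verblunsky_lt1 n : normc (al n) < 1.
Proof.
have := an_at0S mu1 mal n; rewrite !an_at0//.
set x := Rintegral _ _ _; set y := Rintegral _ _ _ => /(congr1 (@complex.Re R)).
have x0 : 0 < x by exact: int_Phi_gt0.
have y0 : 0 < y by exact: int_Phi_gt0.
rewrite (_ : _ * (2 * y%:C%C) = ((1 - normc (al n) ^+ 2) * (2 * y))%:C%C); last first.
  by apply: complex_eq => /=; ring.
rewrite (_ : 2 * x%:C%C = (2 * x)%:C%C) /=; last by apply: complex_eq => /=; ring.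
move=> E; have n0 := normc_ge0 (al n); rewrite ltNge; apply/negP => n1.
have n2 : 1 <= normc (al n) ^+ 2 by rewrite exprn_ege1.
have : 0 <= (normc (al n) ^+ 2 - 1) * y by rewrite mulr_ge0 ?subr_ge0// ltW.
move: E; lra.
Qed.

Lemma verblunsky_defect_neq0 n : 1 - (normc (al n) ^+ 2)%:C%C != 0 :> C.
Proof.
rewrite (_ : 1 - _ = (1 - normc (al n) ^+ 2)%:C%C); last by apply: complex_eq => /=; ring.
rewrite -normc_eq0 normcR normr_eq0 gt_eqF//.
rewrite subr_gt0; have := verblunsky_lt1 n; have := normc_ge0 (al n); nra.
Qed.

Lemma Re_carath_ge0 z : normc z < 1 -> 0 <= complex.Re (carath mu z).
Proof.
move=> z1; rewrite carathE -poisE; apply: Rintegral_ge0 => t _.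
rewrite Re_herg// divr_ge0 ?sqr_ge0// subr_ge0.
by have := normc_ge0 z; nra.
Qed.

(** A common zero descends along the recursion, because 1 - |alpha|^2 != 0, down to a_0 = F + 1,
    which has no zero since Re F >= 0. *)
Lemma an_bn_neq0 n z : normc z < 1 -> an mu al n z = 0 -> bn mu al n z != 0.
Proof.
move=> z1; elim: n => [a0|n IH aS]; apply/eqP => b0.
  have := Re_carath_ge0 z1; move: a0; rewrite an0// => /(congr1 (@complex.Re R)).
  by rewrite ReD /= => ? ?; lra.
have := bnS mu1 mal n z1; rewrite b0 mulr0 => /esym/eqP; rewrite subr_eq0 => /eqP bE.
move: aS; rewrite anS// bE mulrA [conjc _ * _]mulrC mulc_conj -{1}[an _ _ _ _]mul1r -mulrBl.
move=> /eqP; rewrite mulf_eq0 (negPf (verblunsky_defect_neq0 n)) /= => /eqP a0.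
by have := IH a0; rewrite bE a0 mulr0 eqxx.
Qed.

Section stripped.
Variables (n : nat) (nu : {measure set T -> \bar R}).
Hypotheses (nu1 : circle_prob nu) (nal : verblunsky nu (fun k => al (n + k)%N)).
Local Notation al' := (fun k => al (n + k)%N).

(** Cross determinant of the pair of [mu] at level n + k with that of [nu] at level k. Both pairs
    follow the same recursion, so z W_(k+1) = (1 - |alpha|^2) W_k; hence W_0 is divisible by every
    power of z and vanishes, which says that b_n/a_n is the Schur function of [nu]. *)
Let W k z := bn mu al (n + k) z * an nu al' k z - an mu al (n + k) z * bn nu al' k z.

Let WS k z : normc z < 1 -> z * W k.+1 z = (1 - (normc (al (n + k)) ^+ 2)%:C%C) * W k z.
Proof.
move=> z1; rewrite /W addnS.
have b1 := bnS mu1 mal (n + k) z1; have a1 := anS al mu1 (n + k) z1.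
have b2 := bnS nu1 nal k z1; have a2 := anS al' nu1 k z1.
rewrite a1 a2 -mulc_conj.
transitivity (z * bn mu al (n + k).+1 z * (an nu al' k z - conjc (al' k) * bn nu al' k z)
  - (an mu al (n + k) z - conjc (al (n + k)) * bn mu al (n + k) z) * (z * bn nu al' k.+1 z)).
  by ring.
rewrite b1 b2 /=; ring.
Qed.

Let W_cdiff k z : normc z < 1 -> cdiff (W k) z.
Proof.
move=> z1; apply: cdiffB; apply: cdiffM.
- exact: cdiff_bn.
- exact: cdiff_an.
- exact: cdiff_an.
- exact: cdiff_bn.
Qed.

Let W_eq0 z : normc z < 1 -> W 0 z = 0.
Proof.
apply: vanish_all_orders => [x x1|k]; first exact: W_cdiff.
suff [c cP] : exists c : C, forall x, normc x < 1 -> W 0 x = x ^+ k * (c * W k x).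
  exists (fun x => c * W k x); split=> // x x1.
  by apply: cdiffM; [exact: cdiff_cst|exact: W_cdiff].
elim: k => [|k [c IH]]; first by exists 1 => x x1; rewrite expr0 !mul1r.
have d0 := verblunsky_defect_neq0 (n + k); set d := (X in X != 0) in d0.
exists (c / d) => x /[dup] x1 /IH ->; have := WS k x1; rewrite -/d => E.
have -> : W k x = x * W k.+1 x / d by rewrite E [d * _]mulrC mulfK.
rewrite exprSr; ring.
Qed.

Lemma carath_stripped z : normc z < 1 ->
  carath nu z * (an mu al n z - z * bn mu al n z) = an mu al n z + z * bn mu al n z.
Proof.
move=> z1; have := W_eq0 z1; rewrite /W addn0 => W0.
have a0 := an0 al' nu1 z1; have b0 := bn0 al' nu1 z1.
have : z * (bn mu al n z * an nu al' 0 z - an mu al n z * bn nu al' 0 z) = 0.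
  by rewrite W0 mulr0.
move: a0 b0; set F := carath nu z; set a := an mu al n z; set b := bn mu al n z.
set a' := an nu al' 0 z; set b' := bn nu al' 0 z => a0 b0 E.
apply/eqP; rewrite -subr_eq0; apply/eqP; rewrite -[RHS]oppr0 -E a0.
transitivity (- (z * b * (F + 1) - a * (F - 1))); first by ring.
by rewrite -b0; ring.
Qed.

(** If it vanished, [carath_stripped] would make a_n + z b_n vanish as well, hence a_n = 0 and z b_n
    = 0. This contradicts a_n(0) != 0 at the origin and the absence of common zeros elsewhere. *)
Lemma stripped_denom_neq0 z : normc z < 1 -> an mu al n z - z * bn mu al n z != 0.
Proof.
move=> z1; apply/eqP => V0; have := carath_stripped z1; rewrite V0 mulr0 => S0.
have a0 : an mu al n z = 0.
  have : 2 * an mu al n z = 0.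
    by rewrite -[RHS]addr0 {1}S0 -V0; ring.
  by move/eqP; rewrite mulf_eq0 pnatr_eq0 /= => /eqP.
have [z0|z0] := eqVneq z 0; first by have := an_at0_neq0 n; move: a0; rewrite z0 => ->; rewrite eqxx.
move: V0; rewrite a0 sub0r => /eqP; rewrite oppr_eq0 mulf_eq0 (negPf z0) /=.
by rewrite (negPf (an_bn_neq0 z1 a0)).
Qed.

End stripped.

End VerblunskyBound.

(** * Functions of constant boundary modulus *)

Section ConstantModulus.
Context {R : realType}.
Local Notation C := R[i].
Local Notation leb := (@lebesgue_measure R).

Lemma normc_cmean_le (b : R -> C) (k : R -> R) : rcont b -> continuous k ->
  (forall t, circ t -> normc (b t) <= k t) -> normc (cmean b) <= rmean k.
Proof.
move=> bc kc bk.
apply: (normc_cintg measurable_circ (cintegrable_contM bc inv2pi_int) (rmean_int kc)).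
by move=> t ct; rewrite normcM normcR ger0_norm ?(@inv2pi_ge0 R)// ler_wpM2r ?(@inv2pi_ge0 R)// bk.
Qed.

Lemma boundary_modulus (q : C -> C) (kap e : R) : 0 < e -> e < kap ->
  (forall z, normc z < 1 -> q z != 0) ->
  (forall e : R, 0 < e -> exists2 r0 : R, r0 < 1 & forall r t, 0 <= r -> r0 < r -> r < 1 ->
    `|2 * ln (normc (q (cpt r t))) - ln kap| <= e) ->
  exists2 r0 : R, r0 < 1 & forall r t, 0 <= r -> r0 < r -> r < 1 ->
    kap - e <= normc (q (cpt r t)) ^+ 2 <= kap + e.
Proof.
move=> e0 ek q0 qk; have k0 : 0 < kap by lra.
have d1 : 0 < ln ((kap + e) / kap) by rewrite ln_gt0// ltr_pdivlMr//; lra.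
have d2 : 0 < ln (kap / (kap - e)) by rewrite ln_gt0// ltr_pdivlMr//; lra.
have d0 : 0 < Num.min (ln ((kap + e) / kap)) (ln (kap / (kap - e))) by rewrite lt_min d1.
have [r0 r01 rP] := qk _ d0; exists r0 => // r t rge0 rr r1.
have n0 : 0 < normc (q (cpt r t)) by rewrite normc_gt0 q0// normc_cpt_lt1.
have lE : 2 * ln (normc (q (cpt r t))) = ln (normc (q (cpt r t)) ^+ 2).
  by rewrite expr2 lnM ?posrE//; ring.
have := rP r t rge0 rr r1; rewrite le_min => /andP[].
rewrite lE !ln_div ?posrE; try lra.
rewrite !ler_norml => /andP[_ h1] /andP[h2 _].
have p1 : 0 < normc (q (cpt r t)) ^+ 2 by rewrite exprn_gt0.
apply/andP; split; rewrite -ler_ln ?posrE//; lra.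
Qed.

(* [1/q^2] and Cauchy's formula at 0 give [|q(0)|^2 = kap], so the circular
   means of [|q - q(0)|^2] tend to 0; then Cauchy's formula is applied to
   [(q - q(0))^2]. *)
Lemma constant_modulus (q : C -> C) (kap : R) : 0 < kap ->
  (forall z, normc z < 1 -> cdiff q z) -> (forall z, normc z < 1 -> q z != 0) ->
  (forall e : R, 0 < e -> exists2 r0 : R, r0 < 1 & forall r t, 0 <= r -> r0 < r -> r < 1 ->
    `|2 * ln (normc (q (cpt r t))) - ln kap| <= e) ->
  forall z, normc z < 1 -> q z = q 0.
Proof.
move=> k0 qd q0 qk z z1; apply: contrapT => /eqP; rewrite -subr_eq0 -normc_gt0 => D0.
set D := normc (q z - q 0) in D0.
have s0 : 0 < 1 - normc z by lra.
(* The final estimate is D^2 (1 - |z|) <= 4 e, which this bound contradicts. The factor 2/(1 - |z|)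
   behind it comes from the Cauchy kernel, the radius r being chosen at least (1 + |z|)/2. *)
pose e := Num.min (kap / 2) (D ^+ 2 * (1 - normc z) / 8).
have e0 : 0 < e by rewrite lt_min !divr_gt0// mulr_gt0// exprn_gt0.
have ek : e < kap.
  have : e <= kap / 2 by rewrite ge_min lexx.
  by lra.
have eD : e <= D ^+ 2 * (1 - normc z) / 8 by rewrite ge_min lexx orbT.
have [r0 r01 rP] := boundary_modulus e0 ek q0 qk.
pose r := (Num.max r0 ((1 + normc z) / 2) + 1) / 2.
have z0 := normc_ge0 z.
have m1 : r0 <= Num.max r0 ((1 + normc z) / 2) by rewrite le_max lexx.
have m2 : (1 + normc z) / 2 <= Num.max r0 ((1 + normc z) / 2) by rewrite le_max lexx orbT.
have m3 : Num.max r0 ((1 + normc z) / 2) < 1 by rewrite gt_max r01 /=; lra.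
have [rge0 rr r1 rz] : [/\ 0 < r, r0 < r, r < 1 & (1 + normc z) / 2 <= r].
  by rewrite /r; split; lra.
have {}rP t : kap - e <= normc (q (cpt r t)) ^+ 2 <= kap + e.
  by apply: rP => //; exact: ltW.
have qdr x : normc x <= r -> cdiff q x by move=> xr; apply: qd; lra.
have rq : rcont (fun t => q (cpt r t)).
  by apply: (rcont_on_circle (G := q)) => //; exact: ltW.
have qc t : q (cpt r t) != 0 by apply: q0; rewrite normc_cpt gtr0_norm.
have n0 : 0 < normc (q 0) ^+ 2 by rewrite exprn_gt0// normc_gt0 q0// normc0.
have lower : kap - e <= normc (q 0) ^+ 2.
  have dV x : normc x <= r -> cdiff (fun x => (q x)^-1 * (q x)^-1) x.
    move=> xr; have x1 : normc x < 1 by lra.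
    by apply: cdiffM; apply: cdiffV; rewrite ?q0//; exact: qd.
  have := @cmean_center R _ 0 r rge0 (fun x xr => cdiff_cont (dV x xr)) (fun x xr _ => dV x xr).
  move=> /(congr1 (@normc R)); rewrite normcM normcV -expr2 exprVn => E.
  rewrite -[leLHS]invrK -[leRHS]invrK lef_pV2 ?posrE ?invr_gt0//; last lra.
  rewrite -E; apply: cmean_norm; first by apply: rcontM; exact: rcontV.
  move=> t _; rewrite normcM normcV -expr2 exprVn lef_pV2 ?posrE ?exprn_gt0 ?normc_gt0//.
    by have /andP[] := rP t.
  lra.
pose k t := normc (q (cpt r t) - q 0) ^+ 2.
have rqB : rcont (fun t => q (cpt r t) - q 0) by apply: rcontB => //; exact: rcont_cst.
have kc : continuous k by move=> t; apply: cvgM; exact: rcont_normc.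
(* Expanding the square, the mean is at most (kap + e) + |q(0)|^2 - 2 |q(0)|^2, since q has mean
   q(0); then [lower] applies. *)
have kmean : rmean k <= 2 * e.
  pose b t := - 2 * conjc (q 0) * q (cpt r t).
  have rb : rcont b by apply: rcontM => //; exact: rcont_cst.
  have cb := rcont_Re rb.
  have cst_c (a : R) : continuous (fun _ : R => a) by move=> t; exact: cvg_cst.
  apply: (@le_trans _ _ (rmean (fun t => (kap + e + normc (q 0) ^+ 2) + complex.Re (b t)))).
    apply: le_rmean => // [t|t _].
      by apply: cvgD; [exact: cvg_cst|exact: cb].
    have /andP[_] := rP t; rewrite /k /b !sqr_normcE.
    case: (q (cpt r t)) (q 0) => [x y] [u v] /=; lra.
  rewrite rmeanD// rmean_cst -Re_cmean cmeanZ//.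
  rewrite (@cmean_center _ q 0 r)// => [|x xr|x xr _]; first last.
  - exact: qdr.
  - by apply: cdiff_cont; exact: qdr.
  rewrite -mulrA [conjc _ * _]mulrC mulc_conj.
  rewrite (_ : complex.Re _ = - 2 * normc (q 0) ^+ 2); last by rewrite /=; ring.
  lra.
have dB x : normc x <= r -> cdiff (fun x => (q x - q 0) * (q x - q 0)) x.
  by move=> xr; apply: cdiffM; apply: cdiffB; [exact: qdr|exact: cdiff_cst|exact: qdr|exact: cdiff_cst].
have zr : normc z < r by lra.
have := cauchy_formula dB zr => /(congr1 (@normc R)); rewrite normcM -expr2 -/D => E.
pose A := 2 / (1 - normc z).
have A0 : 0 < A by rewrite divr_gt0.
have : D ^+ 2 <= rmean (fun t => A * k t).
  rewrite -E; apply: normc_cmean_le.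
  - apply: rcontM; first by apply: rcontM; [exact: rcont_cpt|exact: rcontM].
    by apply: rcontV; [exact: rcont_cptB|move=> t; exact: cpt_neq].
  - by move=> t; apply: cvgM; [exact: cvg_cst|exact: kc].
  move=> t _; rewrite normcM (normcM (cpt r t)) normc_cpt normcV normcM gtr0_norm// -expr2 -/(k t).
  have k1 : 0 <= k t by exact: sqr_ge0.
  have ge := cpt_sub_ge r t z.
  rewrite mulrAC ler_wpM2r// /A.
  apply: (@le_trans _ _ (1 / ((1 - normc z) / 2))); last by rewrite invf_div mul1r.
  apply: ler_pM; rewrite ?invr_ge0 ?normc_ge0 ?(ltW rge0) ?(ltW r1)//.
  rewrite lef_pV2 ?posrE; lra.
rewrite rmeanZ// => H.
have : D ^+ 2 <= A * (2 * e) by apply: le_trans H _; rewrite ler_wpM2l// ltW.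
rewrite /A mulrAC ler_pdivlMr// leNgt => /negP; apply.
have : 0 < D ^+ 2 * (1 - normc z) by rewrite mulr_gt0// exprn_gt0.
by move: eD; lra.
Qed.

End ConstantModulus.

(** * Division by z *)

Section Backshift.
Context {R : realType}.
Local Notation C := R[i].

(** (f(z) - f(0))/z completed at 0 by the derivative, which [xget] selects; it continues
    analytically wherever f does. *)
Definition backshift (f : C -> C) : C -> C :=
  dquot f 0 (xget 0 [set d | cder f 0 d]).

Lemma backshiftE f z : f 0 = 0 -> z * backshift f z = f z.
Proof.
move=> f0; rewrite /backshift /dquot; case: eqVneq => [->|z0].
  by rewrite mul0r f0.
by rewrite f0 !subr0 mulrC divfK.
Qed.

Lemma cdiff_backshift f (Rad : R) z : 0 < Rad ->
  (forall x, normc x < Rad -> cdiff f x) -> normc z < Rad -> cdiff (backshift f) z.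
Proof.
move=> R0 fd zR; have n0 : normc (0 : C) < Rad by rewrite normc0.
apply: (dquot_holo fd n0 _ zR).
by have [d dP] := fd 0 n0; apply: (@xgetPex _ 0 [set d | cder f 0 d]); exists d.
Qed.

Lemma backshift_disc f h z : (forall x, normc x < 1 -> f x = x * h x) -> cdiff h 0 ->
  normc z < 1 -> backshift f z = h z.
Proof.
move=> fh [d hd] z1; have n0 : normc (0 : C) < 1 by rewrite normc0.
have f0 : f 0 = 0 by rewrite fh// mul0r.
have [z0|z0] := eqVneq z 0; last first.
  by apply: (mulfI z0); rewrite backshiftE// fh.
rewrite z0 /backshift /dquot eqxx.
have fd : cder f 0 (h 0).
  apply: (@cder_near _ (fun x => x * h x) f 0 _ 1 ltr01) => [x|].
    by rewrite subr0 => x1; rewrite fh.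
  by have := cderM (@cder_id _ 0) hd; rewrite mul0r add0r mulr1.
apply: (cder_unique _ fd).
by apply: (@xgetPex _ 0 [set d | cder f 0 d]); exists (h 0).
Qed.

End Backshift.

(** * Continuation of 1/D^(n) *)

Section StrippedExtension.
Context {R : realType}.
Local Notation C := R[i].
Local Notation leb := (@lebesgue_measure R).
Local Notation T := (measurableTypeR R).
Variables (mu : {measure set T -> \bar R}) (w : R -> R) (Rad : R) (g : C -> C).
Hypotheses (mu1 : circle_prob mu) (wdec : lebesgue_decomp mu w mzero).
Hypotheses (wsz : szego_cond w) (Rad1 : 1 < Rad).
Hypothesis gd : forall z, normc z < Rad -> cdiff g z.
Hypothesis gS : forall z, normc z < 1 -> g z = (szego w z)^-1.
Variable al : nat -> C.
Hypothesis mal : verblunsky mu al.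
Variables (Q Fh : C -> C) (r0 : R).
Hypotheses (r01 : 1 < r0) (Qd : forall z, normc z < Rad -> cdiff Q z).
Hypothesis QF : forall z, normc z < r0 -> Q z = g z * Fh z.
Hypothesis FhE : forall z, normc z < 1 -> Fh z = carath mu z.
Hypothesis FhRe : forall t, complex.Re (Fh (eit t)) = bw g t.

(** The continuations of g a_n and g b_n: the recursion is run on Q = g F instead of F, and each
    division by z is a [backshift]. *)
Fixpoint eab n : (C -> C) * (C -> C) :=
  if n is k.+1 then
    (fun z => (eab k).1 z - conjc (al k) * (eab k).2 z,
     backshift (fun z => (eab k).2 z - al k * (eab k).1 z))
  else (fun z => Q z + g z, backshift (fun z => Q z - g z)).

Definition ea n := (eab n).1.
Definition eb n := (eab n).2.

Let Q_disc z : normc z < 1 -> Q z = g z * carath mu z.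
Proof. by move=> z1; rewrite QF ?FhE//; exact: lt_trans r01. Qed.

Lemma eab_disc n z : normc z < 1 ->
  ea n z = g z * an mu al n z /\ eb n z = g z * bn mu al n z.
Proof.
have d0 k : cdiff (fun x => g x * bn mu al k x) 0.
  apply: cdiffM; first by apply: gd; rewrite normc0 (lt_trans ltr01).
  by apply: (cdiff_bn al mu1); rewrite normc0.
elim: n z => [|n IH] z z1.
  split; first by rewrite /ea /= Q_disc// (an0 al mu1 z1); ring.
  rewrite /eb /=; apply: (backshift_disc _ (d0 0%N) z1) => x x1.
  by rewrite Q_disc// mulrCA (bn0 al mu1 x1); ring.
have [a b] := IH z z1; split.
  by rewrite /ea /= -/(ea n) -/(eb n) a b (anS al mu1 n z1); ring.
rewrite /eb /= -/(ea n) -/(eb n).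
apply: (backshift_disc _ (d0 n.+1) z1) => x x1; have [-> ->] := IH x x1.
by rewrite [RHS]mulrCA (bnS mu1 mal n x1); ring.
Qed.

Lemma eb0 z : z * eb 0 z = Q z - g z.
Proof.
rewrite /eb /= backshiftE//; have n0 : normc (0 : C) < 1 by rewrite normc0.
by rewrite Q_disc// -[X in _ - X]mulr1 -mulrBr -(bn0 al mu1 n0) mul0r mulr0.
Qed.

Lemma ebS n z : z * eb n.+1 z = eb n z - al n * ea n z.
Proof.
rewrite /eb /= -/(ea n) -/(eb n) backshiftE//.
have n0 : normc (0 : C) < 1 by rewrite normc0.
have [-> ->] := eab_disc n n0.
by rewrite [al n * _]mulrCA -mulrBr -(bnS mu1 mal n n0) mul0r mulr0.
Qed.

Lemma eaS n z : ea n.+1 z = ea n z - conjc (al n) * eb n z.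
Proof. by []. Qed.

Lemma cdiff_eab n z : normc z < Rad -> cdiff (ea n) z /\ cdiff (eb n) z.
Proof.
have Rad0 : 0 < Rad := lt_trans ltr01 Rad1.
elim: n z => [|n IH] z zR.
  split; first by apply: cdiffD; [exact: Qd|exact: gd].
  apply: (cdiff_backshift Rad0 _ zR) => x xR.
  by apply: cdiffB; [exact: Qd|exact: gd].
split.
  have [a b] := IH z zR.
  by apply: cdiffB => //; apply: cdiffM => //; exact: cdiff_cst.
apply: (cdiff_backshift Rad0 _ zR) => x xR; have [a b] := IH x xR.
by apply: cdiffB => //; apply: cdiffM => //; exact: cdiff_cst.
Qed.

Definition defect n : R := 4 * \prod_(i < n) (1 - normc (al i) ^+ 2).

Lemma defect_gt0 n : 0 < defect n.
Proof.
rewrite /defect mulr_gt0// prodr_gt0// => i _.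
have := verblunsky_lt1 mu1 wdec wsz Rad1 gd gS mal i; have := normc_ge0 (al i).
by rewrite subr_gt0 => n0 n1; rewrite expr_lt1.
Qed.

(** At n = 0, |Q + g|^2 - |Q - g|^2 = 4 |g|^2 Re F = 4 because Re F = 1/|g|^2. The map (a, b) to (a
    - conj(alpha) b, b - alpha a) multiplies |a|^2 - |b|^2 by 1 - |alpha|^2, and dividing b by z
    does not change its modulus on the circle. *)
Lemma eab_circle n z : normc z = 1 ->
  normc (ea n z) ^+ 2 - normc (eb n z) ^+ 2 = defect n.
Proof.
move=> z1; elim: n => [|n IH].
  rewrite /defect big_ord0 mulr1.
  have -> : normc (eb 0 z) = normc (Q z - g z) by rewrite -eb0 normcM z1 mul1r.
  rewrite /ea /=; have [t _ tz] := circle_polar z1.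
  have g0 := g_neq0_circle mu1 wdec wsz Rad1 gd gS z1.
  have zr : normc z < r0 by rewrite z1.
  have := FhRe t; rewrite tz /bw tz.
  have : normc (g z) ^+ 2 != 0 by rewrite sqrf_eq0 normc_eq0.
  rewrite QF// !sqr_normcE; case: (g z) (Fh z) => [x y] [u v] /=.
  by move=> xy0 ->; field.
have -> : normc (eb n.+1 z) = normc (eb n z - al n * ea n z).
  by rewrite -ebS normcM z1 mul1r.
rewrite /defect big_ord_recr /= mulrA -/(defect n) -IH eaS !sqr_normcE.
case: (ea n z) (eb n z) (al n) => [x y] [u v] [a b] /=; ring.
Qed.

Definition eV n z : C := ea n z - z * eb n z.

Lemma cdiff_eV n z : normc z < Rad -> cdiff (eV n) z.
Proof.
move=> zR; have [a b] := cdiff_eab n zR.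
by apply: cdiffB => //; apply: cdiffM => //; exact: cdiff_id.
Qed.

Section stripped.
Variables (n : nat) (nu : {measure set T -> \bar R}) (wn : R -> R).
Variable nus : {measure set T -> \bar R}.
Hypotheses (nu1 : circle_prob nu) (nudec : lebesgue_decomp nu wn nus).
Hypothesis nal : verblunsky nu (fun k => al (n + k)%N).

(** On the circle a zero would give equal moduli to the two terms, against the positive [defect]; in
    the open disc it is excluded by [stripped_denom_neq0]. *)
Lemma eV_neq0 z : normc z <= 1 -> eV n z != 0.
Proof.
rewrite le_eqVlt => /orP[/eqP z1|z1].
  apply/eqP => V0; have := defect_gt0 n; rewrite -(eab_circle n z1).
  have -> : ea n z = z * eb n z by apply/eqP; rewrite -subr_eq0; exact/eqP.
  by rewrite normcM z1 mul1r subrr ltxx.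
have [a b] := eab_disc n z1.
have -> : eV n z = g z * (an mu al n z - z * bn mu al n z).
  by rewrite /eV a b; ring.
rewrite mulf_neq0//; first exact: (g_neq0_disc gS z1).
exact: (stripped_denom_neq0 mu1 wdec wsz Rad1 gd gS mal nu1 nal z1).
Qed.

Let X z := (ea n z + z * eb n z) / eV n z.

Let X_disc z : normc z < 1 -> X z = carath nu z.
Proof.
move=> z1; have [a b] := eab_disc n z1; have V0 := eV_neq0 (ltW z1).
apply: (mulIf V0); rewrite /X divfK//.
have E := carath_stripped mu1 wdec wsz Rad1 gd gS mal nu1 nal z1.
rewrite /eV a b; transitivity (g z * (an mu al n z + z * bn mu al n z)); first by ring.
by rewrite -E; ring.
Qed.

Lemma normc_eV_gt0 t : 0 < normc (eV n (eit t)).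
Proof. by rewrite normc_gt0 eV_neq0// normc_eit. Qed.

Let Re_X t : complex.Re (X (eit t)) = defect n / normc (eV n (eit t)) ^+ 2.
Proof.
have v0 := normc_eV_gt0 t; rewrite /X -(eab_circle n (normc_eit t)).
have -> : normc (eb n (eit t)) = normc (eit t * eb n (eit t)).
  by rewrite normcM normc_eit mul1r.
move: v0; rewrite /eV; set a := ea n _; set b := _ * eb n _ => v0.
have v1 : normc (a - b) ^+ 2 != 0 by rewrite expf_neq0// gt_eqF.
have V0 : a - b != 0 by rewrite -normc_gt0.
have -> : (a + b) / (a - b) = ((a + b) * conjc (a - b)) * ((normc (a - b) ^+ 2)^-1)%:C%C.
  have c0 : conjc (a - b) != 0 by rewrite -normc_eq0 normc_conj gt_eqF.
  rewrite fmorphV /= -mulc_conj; move: c0; move: (conjc _) => k c0.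
  by field; rewrite c0.
rewrite ReM /= mulr0 subr0; congr (_ / _).
rewrite !sqr_normcE; case: (a) (b) => [x y] [u v] /=; ring.
Qed.

Lemma stripped_weight_ae : ae_eq leb (circ : set T) (EFin \o wn)
  (EFin \o (fun t => defect n / normc (eV n (eit t)) ^+ 2)).
Proof.
have [r2 [r21 r2R V2]] := nonvanish_extend Rad1 (@cdiff_eV n) eV_neq0.
have Xd z : normc z < r2 -> cdiff X z.
  move=> zr; have zR := lt_trans zr r2R; have [a b] := cdiff_eab n zR.
  apply: cdiff_div; [exact: V2| |exact: cdiff_eV].
  by apply: cdiffD => //; apply: cdiffM => //; exact: cdiff_id.
have [XL Xlim] := re_boundary r21 Xd.
rewrite (_ : (fun t => defect n / _) = fun t => complex.Re (X (eit t))); last first.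
  by apply/funext => t; rewrite Re_X.
apply: (density_boundary_value nu1 nudec).
- exact: nearly_lipschitz_cont.
- exact: XL.
- by move=> t; rewrite Re_X divr_ge0 ?sqr_ge0// ltW// defect_gt0.
move=> e /Xlim[r rr1 rP]; exists r => // s t s0 rs s1.
rewrite poisE -carathE -X_disc ?normc_cpt_lt1//; exact: rP.
Qed.

Let L t : R := ln (defect n) - 2 * ln (normc (eV n (eit t))).

Let lnH t : ln (defect n / normc (eV n (eit t)) ^+ 2) = L t.
Proof.
have v0 := normc_eV_gt0 t; have d0 := defect_gt0 n.
move: v0 d0; rewrite /L; move: (normc _) (defect n) => v d v0 d0.
by rewrite ln_div ?posrE ?exprn_gt0// expr2 lnM ?posrE//; ring.
Qed.

Let Vlog := log_boundary Rad1 (@cdiff_eV n)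
  (fun z z1 => eV_neq0 (eq_ind_r (fun x => x <= 1) (lexx 1) z1)).

Let L_lip : nearly_lipschitz L.
Proof.
move=> e e0; have [K K0 KP] := Vlog.1 e e0; exists K => // t s.
have -> : L s - L t = 2 * ln (normc (eV n (eit t))) - 2 * ln (normc (eV n (eit s))).
  by rewrite /L; ring.
by rewrite distrC; exact: KP.
Qed.

Let ln_wn_ae : ae_eq leb (circ : set T) (EFin \o (fun t => ln (wn t))) (EFin \o L).
Proof.
apply: filterS stripped_weight_ae => t H ct; have [E] := H ct.
by rewrite /= E lnH.
Qed.

Let L_int : leb.-integrable circ (EFin \o L).
Proof.
have := integrable_continuousM (nearly_lipschitz_cont L_lip) (@integrable_circ_cst R 1).
by apply: eq_integrable => [|t _ /=]; [exact: measurable_circ|rewrite mulr1].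
Qed.

Let ln_wn_measurable : measurable_fun (circ : set T) (fun t => ln (wn t)).
Proof.
have [_ [mw _]] := nudec.
by apply: measurableT_comp => //; exact: measurable_ln.
Qed.

(** No Szego condition is assumed for [nu]: integrability is inherited from the continuous function
    [L], equal to ln wn almost everywhere. *)
Let ln_wn_int : leb.-integrable circ (EFin \o (fun t => ln (wn t))).
Proof.
apply/integrableP; split; first exact/measurable_EFinP.
have /integrableP[mL] := L_int; apply: le_lt_trans.
rewrite le_eqVlt; apply/orP; left; apply/eqP.
apply: ge0_ae_eq_integral => //.
- exact: measurable_circ.
- by apply: measurableT_comp => //; exact/measurable_EFinP.
- exact: measurableT_comp.
- by apply: filterS ln_wn_ae => t H ct; rewrite H.
Qed.

Let szego_boundary (e : R) : 0 < e -> exists2 r0 : R, r0 < 1 &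
  forall r t, 0 <= r -> r0 < r -> r < 1 ->
  `|2 * ln (normc (szego wn (cpt r t))) - L t| <= e.
Proof.
move=> e0; have [r1 r11 rP] := poisson_mean_cvg (nearly_lipschitz_cont L_lip) L_lip e0.
exists r1 => // r t rge0 rr rlt1.
rewrite (ln_normc_szego ln_wn_int) ?normc_cpt_lt1//.
rewrite (_ : Rintegral _ _ _ = rmean (fun s => pker r t s * L s)); first exact: rP.
have mk : measurable_fun (circ : set T) (pker r t).
  apply: measurable_funS (continuous_measurable_fun (continuous_pker rge0 rlt1)) => //.
rewrite /rmean /Rintegral; congr fine; apply: ae_eq_integral.
- exact: measurable_circ.
- apply/measurable_EFinP; apply: measurable_funM => //.
  by apply: measurable_funM.
- apply/measurable_EFinP; apply: measurable_funM => //.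
  apply: measurable_funM => //.
  by have /integrableP[/measurable_EFinP] := L_int.
apply: filterS ln_wn_ae => s H cs; have [E] := H cs.
by rewrite /= E mulrA.
Qed.

(** On the circle |D^(n)|^2 is the weight, [defect] over |V|^2, so V D^(n) has constant boundary
    modulus and no zeros; it equals its value c at 0. *)
Lemma szego_stripped : exists2 c : C, c != 0 &
  forall z, normc z < 1 -> (szego wn z)^-1 = eV n z / c.
Proof.
pose q z := eV n z * szego wn z.
have qn z : normc z < 1 -> q z != 0.
  by move=> z1; rewrite mulf_neq0 ?szego_neq0// eV_neq0// ltW.
have qd z : normc z < 1 -> cdiff q z.
  move=> z1; apply: cdiffM; last exact: cdiff_szego.
  by apply: cdiff_eV; exact: lt_trans Rad1.
have qb (e : R) : 0 < e -> exists2 r0 : R, r0 < 1 & forall r t, 0 <= r -> r0 < r -> r < 1 ->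
    `|2 * ln (normc (q (cpt r t))) - ln (defect n)| <= e.
  move=> e0; have e2 : 0 < e / 2 by rewrite divr_gt0.
  have [s1 s11 s1P] := szego_boundary e2.
  have [s2 s21 s2P] := Vlog.2 _ e2.
  exists (Num.max s1 s2); first by rewrite gt_max s11.
  move=> r t r0ge; rewrite gt_max => /andP[r1 r2] rlt1.
  have := s1P r t r0ge r1 rlt1; have := s2P r t r0ge r2 rlt1; rewrite /L.
  have c1 := normc_cpt_lt1 t r0ge rlt1.
  have v0 : 0 < normc (eV n (cpt r t)) by rewrite normc_gt0 eV_neq0// ltW.
  have z0 : 0 < normc (szego wn (cpt r t)) by rewrite normc_gt0 szego_neq0.
  rewrite (_ : normc (q _) = normc (eV n (cpt r t)) * normc (szego wn (cpt r t))); last exact: normcM.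
  move: v0 z0; move: (ln (defect n)) (normc (szego _ _)) (normc (eV _ (cpt r t))) => k x y v0 z0.
  rewrite lnM ?posrE// !ler_norml; lra.
exists (q 0); first by apply: qn; rewrite normc0.
move=> z z1; rewrite -(constant_modulus (defect_gt0 n) qd qn qb z1) /q.
have V0 := eV_neq0 (ltW z1); have s0 := szego_neq0 wn z.
move: V0 s0; move: (eV n z) (szego wn z) => v s v0 s0.
by field; rewrite s0.
Qed.

End stripped.

End StrippedExtension.

(** * Orders of zeros and poles *)

Section ZerosAndPoles.
Context {R : realType}.
Local Notation C := R[i].

(** Because N(p) != 0, no cancellation occurs and a single k serves as both orders. *)
Lemma zero_pole_order (g N : C -> C) (Rad : R) p :
  (forall z, normc z < Rad -> cdiff g z) -> (forall z, normc z < Rad -> cdiff N z) ->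
  g 0 != 0 -> normc p < Rad -> g p = 0 -> N p != 0 ->
  exists k, zero_order g p k /\ pole_order (fun z => N z / g z) p k.
Proof.
move=> gd Nd g0 pR gp Np.
have [k [h [hd hp gE]]] := finite_order_zero gd g0 pR.
have k0 : (0 < k)%N.
  by case: k gE => // /(_ p pR); rewrite gp expr0 mul1r => hp0; rewrite -hp0 eqxx in hp.
have hp0 : 0 < normc (h p) by rewrite normc_gt0.
have [r r0 rP] := cdiff_cont (hd p pR) hp0.
(* Small enough to stay in the disc and to keep the cofactor h away from 0, so that N/h is analytic
   on the ball. *)
pose e := Num.min r (Rad - normc p).
have e0 : 0 < e by rewrite lt_min r0 subr_gt0.
have eR z : cball p e z -> normc z < Rad.
  rewrite in_cball lt_min => /andP[_ zp].
  have := ler_normcD (z - p) p; rewrite subrK; lra.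
have eh z : cball p e z -> h z != 0.
  rewrite in_cball lt_min => /andP[/rP + _]; apply: contraTneq => ->.
  by rewrite sub0r normcN ltxx.
exists k; split.
  exists e; split => //; exists h; split; first by apply/holoP => z /eR; exact: hd.
  by split=> // z /eR; exact: gE.
split=> //; exists e; split => //; exists (fun z => N z / h z); split.
  apply/holoP => z ze; apply: cdiff_div; first exact: eh.
    by apply: Nd; exact: eR.
  by apply: hd; exact: eR.
split; first by rewrite mulf_neq0// invr_neq0.
move=> z ze zp; rewrite gE ?eR//; have hz := eh z ze.
have zk : (z - p) ^+ k != 0 by rewrite expf_neq0// subr_eq0.
by field; rewrite hz zk.
Qed.

End ZerosAndPoles.

(** * Schur functions in terms of a_0 and b_0 *)

Section RelativeSzego.
Context {R : realType}.
Local Notation C := R[i].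
Local Notation T := (measurableTypeR R).

Lemma an0_neq0 (m : {measure set T -> \bar R}) (al : nat -> C) z :
  circle_prob m -> normc z < 1 -> an m al 0 z != 0.
Proof.
move=> m1 z1; rewrite (an0 al m1 z1); have := Re_carath_ge0 m z1.
move: (carath m z) => F F0; apply/eqP => /(congr1 (@complex.Re R)).
by rewrite ReD /=; move: F0; lra.
Qed.

(** At the origin [schur] is defined by F'(0)/2; since F = 1 + z b_0, F'(0) = b_0(0), while a_0(0) =
    F(0) + 1 = 2. *)
Lemma schurE (m : {measure set T -> \bar R}) (al : nat -> C) z :
  circle_prob m -> normc z < 1 -> schur m z = bn m al 0 z / an m al 0 z.
Proof.
move=> m1 z1; rewrite /schur; case: eqVneq => [->|z0]; last first.
  have a0 := an0_neq0 al m1 z1.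
  rewrite -(bn0 al m1 z1) -(an0 al m1 z1); move: a0.
  by move: (bn _ _ _ _) (an _ _ _ _) => b a a0; field; rewrite a0.
have n0 : normc (0 : C) < 1 by rewrite normc0.
have [d bd] := cdiff_bn al m1 0 n0.
have : cder (carath m) 0 (bn m al 0 0).
  apply: (@cder_near _ (fun x => x * bn m al 0 x + 1) (carath m) 0 _ 1 ltr01) => [x|].
    by rewrite subr0 => x1; rewrite (bn0 al m1 x1) subrK.
  have := cderD (cderM (@cder_id _ 0) bd) (@cder_cst _ 1 0).
  by rewrite mul0r add0r mulr1 addr0.
move=> /cderP[_ ->]; rewrite (an0 al m1 n0); congr (_ / _).
by have := bn0 al m1 n0; rewrite mul0r => /esym/eqP; rewrite subr_eq0 => /eqP ->.
Qed.

Lemma rho_neq0 (a : C) : 1 - (normc a ^+ 2)%:C%C != 0 :> C -> rho a != 0.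
Proof. by move=> h; rewrite /rho normcE sqrtC_eq0 -rmorphXn. Qed.

End RelativeSzego.

Theorem theorem2p5 (R : realType) (mu : {measure set (measurableTypeR R) -> \bar R})
    (w : R -> R) (Rad : R) :
  circle_prob mu -> lebesgue_decomp mu w mzero -> szego_cond w -> 1 < Rad ->
  forall g : R[i] -> R[i],
    holo (cball 0 Rad) g -> (forall z, cball 0 1 z -> g z = (szego w z)^-1) ->
  let Z := [set z | cball 0 Rad z /\ g z = 0] in
  (* F is meromorphic in |z| < Rad, poles exactly at the zeros of g = D^{-1},
     pole order = zero order *)
  (exists G : R[i] -> R[i],
     (forall z, cball 0 1 z -> G z = carath mu z) /\
     holo (cball 0 Rad `\` Z) G /\
     forall p, Z p -> exists k : nat, zero_order g p k /\ pole_order G p k) /\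
  (forall alpha : nat -> R[i], verblunsky mu alpha ->
     (* mu1 = mu^(1), with Lebesgue decomposition w1 dtheta/2pi + mus1 *)
     forall (mu1 : {measure set (measurableTypeR R) -> \bar R}) (w1 : R -> R)
            (mus1 : {measure set (measurableTypeR R) -> \bar R}),
       circle_prob mu1 -> lebesgue_decomp mu1 w1 mus1 ->
       verblunsky mu1 (fun k => alpha k.+1) ->
       (* delta_0 D is meromorphic in |z| < Rad, poles exactly at the poles
          of F, of order at most the order of the pole of F *)
       (exists H : R[i] -> R[i],
          (forall z, cball 0 1 z -> H z = rel_szego mu mu1 (alpha 0%N) z) /\
          holo (cball 0 Rad `\` Z) H /\
          forall p, Z p -> exists k k' : nat,
              zero_order g p k /\ pole_order H p k' /\ (k' <= k)%N) /\
       (* (D^(1))^{-1} is analytic in |z| < Rad *)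
       analytic_cont (fun z => (szego w1 z)^-1) Rad) /\
  (* and so is (D^(n))^{-1} for every n >= 1 *)
  (forall alpha : nat -> R[i], verblunsky mu alpha ->
     forall n : nat, (1 <= n)%N ->
     forall (nu : {measure set (measurableTypeR R) -> \bar R}) (wn : R -> R)
            (nus : {measure set (measurableTypeR R) -> \bar R}),
       circle_prob nu -> lebesgue_decomp nu wn nus ->
       verblunsky nu (fun k => alpha (n + k)%N) ->
       analytic_cont (fun z => (szego wn z)^-1) Rad).
Proof.
move=> mu1 wdec wsz Rad1 g gh gS Z.
have gd z : normc z < Rad -> cdiff g z.
  by move=> zR; move/holoP: gh; apply; rewrite in_cball0.
have {}gS z : normc z < 1 -> g z = (szego w z)^-1.
  by move=> z1; apply: gS; rewrite in_cball0.
have [Q [Fh [r0 [[r01 r0R Qd FhP] [FhE QZ FhRe]]]]] :=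
  caratheodory_extension mu1 wdec wsz Rad1 gd gS.
have QF z : normc z < r0 -> Q z = g z * Fh z by case/FhP.
have g1 z : normc z <= 1 -> g z != 0 by exact: g_neq0 mu1 wdec wsz Rad1 gd gS z.
have g0 : g 0 != 0 by rewrite g1// normc0.
have hol N : (forall z, normc z < Rad -> cdiff N z) ->
    holo (cball 0 Rad `\` Z) (fun z => N z / g z).
  move=> Nd; apply/holoP => z [/[dup] zb]; rewrite in_cball0 => zR nZ.
  apply: cdiff_div; [|exact: Nd|exact: gd].
  by apply/eqP => gz; apply: nZ; split.
have cont alpha : verblunsky mu alpha -> forall n nu wn nus,
    circle_prob nu -> lebesgue_decomp nu wn nus ->
    verblunsky nu (fun k => alpha (n + k)%N) ->
    analytic_cont (fun z => (szego wn z)^-1) Rad.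
  move=> mal n nu wn nus nu1 nudec nal.
  have [c c0 cP] := szego_stripped mu1 wdec wsz Rad1 gd gS mal r01 Qd QF FhE FhRe
    nu1 nudec nal.
  exists (fun z => eV g alpha Q n z / c); split.
    apply/holoP => z; rewrite in_cball0 => zR.
    apply: cdiffM; last exact: cdiff_cst.
    exact: (cdiff_eV Rad1 gd alpha Qd n zR).
  by move=> z; rewrite in_cball0 => z1; rewrite cP.
split; [|split]; last by move=> alpha mal n _; exact: cont.
  exists (fun z => Q z / g z); split; [|split]; last 2 first.
  - exact: hol.
  - move=> p [pb gp]; rewrite in_cball0 in pb.
    exact: zero_pole_order gd Qd g0 pb gp (QZ p pb gp).
  move=> z; rewrite in_cball0 => z1.
  by rewrite QF ?(lt_trans z1)// FhE// mulrC mulKf// g1// ltW.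
move=> al mal m1 w1 mus1 m11 m1dec m1al; split; last exact: (cont al mal 1%N) m11 m1dec m1al.
pose V := eV g al Q 1.
have dal n := verblunsky_defect_neq0 mu1 wdec wsz Rad1 gd gS mal n.
have rho0 := rho_neq0 (dal 0%N).
(* The numerator of delta_0 D over the denominator g; it is analytic in |z| < Rad. *)
pose N z := V z / (2 * rho (al 0%N)).
have Nd z : normc z < Rad -> cdiff N z.
  move=> zR; apply: cdiffM; last exact: cdiff_cst.
  exact: (cdiff_eV Rad1 gd al Qd 1 zR).
exists (fun z => N z / g z); split; [|split]; last 2 first.
- exact: hol.
- move=> p [pb gp]; rewrite in_cball0 in pb.
  (* A nonvanishing numerator gives a pole of the full order k of the zero of g, so the required
     inequality between the orders is an equality here. *)
  suff Np : N p != 0.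
    have [k [zk pk]] := zero_pole_order gd Nd g0 pb gp Np.
    by exists k, k; split.
  rewrite /N mulf_neq0 ?invr_neq0 ?mulf_neq0 ?pnatr_eq0//.
  have p1 : 1 < normc p by rewrite ltNge; apply/negP => /g1; rewrite gp eqxx.
  have pn0 : p != 0 by rewrite -normc_gt0 (lt_trans ltr01).
  have B0 := eb0 mu1 al r01 QF FhE p; rewrite gp subr0 in B0.
  have B1 := ebS mu1 Rad1 gd mal r01 QF FhE 0 p.
  (* At a zero of g both a_0 = Q + g and p b_0 = Q - g, in continued form, reduce to Q(p); one step
     of the recursion then expresses V through Q(p) alone. *)
  have VE : p * V p = Q p * ((1 + al 0%N) * p - conjc (1 + al 0%N)).
    rewrite /V /eV B1 eaS {1}/ea /= gp addr0 conjcD conjc1.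
    rewrite (_ : ea g al Q 0 p = Q p); last by rewrite /ea /= gp addr0.
    transitivity (p * Q p - conjc (al 0%N) * (p * eb g al Q 0 p)
      - (p * eb g al Q 0 p) + al 0%N * (p * Q p)); first by ring.
    by rewrite B0; ring.
  apply/eqP => V0; move: VE; rewrite V0 mulr0 => /esym/eqP.
  rewrite mulf_eq0 (negPf (QZ p pb gp)) /= subr_eq0 => /eqP /(congr1 (@normc R)).
  rewrite normcM normc_conj => E.
  have a1 := verblunsky_lt1 mu1 wdec wsz Rad1 gd gS mal 0.
  (* With V(p) = 0 the moduli would satisfy |1 + alpha_0| |p| = |1 + alpha_0|, impossible as |p| > 1
     and |alpha_0| < 1. *)
  have : 0 < normc (1 + al 0%N).
    by have := lerB_normc 1 (- al 0%N); rewrite opprK normcN normc1; lra.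
  by move: E p1; nra.
move=> z; rewrite in_cball0 => z1.
have [a b] := eab_disc mu1 Rad1 gd mal r01 QF FhE 1 z1.
have gz := g1 z (ltW z1).
have S := carath_stripped mu1 wdec wsz Rad1 gd gS mal (n := 1) m11 m1al z1.
have am := an0_neq0 al mu1 z1; have am1 := an0_neq0 (fun k => al k.+1) m11 z1.
rewrite /rel_szego (schurE al mu1 z1) (schurE (fun k => al k.+1) m11 z1).
(* This is 1 - z f = 2/(F + 1), so the quotient (1 - z f^(1))/(1 - z f) becomes (F + 1)/(F^(1) + 1),
   and the first factor turns F + 1 into a_1. *)
have one_sub (m : {measure set (measurableTypeR R) -> \bar R}) be : circle_prob m ->
    1 - z * (bn m be 0 z / an m be 0 z) = 2 / an m be 0 z.
  move=> m_1; have n0 := an0_neq0 be m_1 z1.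
  apply: (mulIf n0); rewrite mulrBl -!mulrA mulVf// !mulr1 mul1r (bn0 be m_1 z1) (an0 be m_1 z1).
  by move: (carath m z) => F; ring.
rewrite !one_sub// /N /V /eV a b; move: S am am1 rho0 gz.
have := anS al mu1 0 z1; have := an0 (fun k => al k.+1) m11 z1.
rewrite -[_^*]/(conjc (al 0%N)).
move: (an mu al 0 z) (an m1 _ 0 z) (bn mu al 0 z) (an mu al 1 z) (bn mu al 1 z).
move: (rho _) (g z) (carath m1 z) (conjc _) => rh gz F c A A' B A1 B1 -> A1E S A0 F0 rh0 gz0.
have DE : A1 - z * B1 = 2 * A1 / (F + 1).
  by apply: (mulIf F0); rewrite divfK// mulrDr mulr1 mulrC S; ring.
transitivity ((A1 - z * B1) / (2 * rh)); first by field; rewrite gz0 rh0.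
rewrite DE A1E; field; by rewrite rh0 F0 A0.
Qed.
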